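(* Let $\mathcal R$ be a strong CCTRS and $s\in\mathcal T(\mathcal G)$ a ground labeled term. (1) If $\zeta(s)$ is terminating with respect to $\to_{\Xi(\mathcal R),\mu}$ and there is a context-sensitive reduction $\zeta(s)\to^*_{\Xi(\mathcal R),\mu}t$ with cost $N$ for some $t$, then there is a complexity-conscious reduction $s\rightharpoonup^* t'$ for some $t'$ with cost at least $N$. (2) If there is an infinite $(\Xi(\mathcal R),\mu)$-reduction starting from $\zeta(s)$, then $s\rightharpoonup^\infty$.
   Context: A CCTRS over $\mathcal F$ is a set $\mathcal R$ of conditional rules each of the form $f(\ell_1,\dots,\ell_n)\to r\Leftarrow a_1\approx b_1,\dots,a_k\approx b_k$ (defined symbols are roots of left-hand sides, others constructors; constructor terms contain only constructors and variables) where $\ell_1,\dots,\ell_n,b_1,\dots,b_k$ are constructor terms, the terms $f(\ell_1,\dots,\ell_n),b_1,\dots,b_k$ pairwise share no variables, $\mathrm{Var}(r)\subseteq\mathrm{Var}(\ell_1,\dots,\ell_n,b_1,\dots,b_k)$, and $\mathrm{Var}(a_i)\subseteq\mathrm{Var}(\ell_1,\dots,\ell_n,b_1,\dots,b_{i-1})$. $\mathcal R{\restriction}f$ is the set of rules with left-hand root $f$. A strong CCTRS is a CCTRS with each $\mathcal R{\restriction}f$ finite and each $f(\ell_1,\dots,\ell_n)$ and $b_j$ linear. Let $m_f=|\mathcal R{\restriction}f|$ (0 for constructors), with fixed enumeration $\rho^f_1,\dots,\rho^f_{m_f}$. Labeled reduction: $\mathcal G$ consists of the constructors and symbols $f_R$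 ($R\subseteq\mathcal R{\restriction}f$, same arity as $f$); $\mathrm{label}$ replaces each defined $f$ by $f_{\mathcal R\restriction f}$; $\mathrm{erase}$ removes labels; labeled normal forms are terms over constructors, symbols $f_\emptyset$ and variables. $s\rightharpoonup t$ is defined inductively: either (i, ''$\bot$-step'') there are $p$ and a rule $\rho\colon\ell\to r\Leftarrow c$ with $s|_p=f_R(s_1,\dots,s_n)$, $\rho\in R$, $t=s[f_{R\setminus\{\rho\}}(s_1,\dots,s_n)]_p$, and linear labeled normal forms $u_1,\dots,u_n$ on fresh variables and $\sigma$ with $s|_p=f_R(u_1,\dots,u_n)\sigma$ and $f(\mathrm{erase}(u_1),\dots,\mathrm{erase}(u_n))$ not unifiable with $\ell$; or (ii) there are $p$, $\rho\colon f(\ell_1,\dots,\ell_n)\to r\Leftarrow a_1\approx b_1,\dots,a_k\approx b_k$, $\sigma$, $0\le j\le k$ with $s|_p=f_R(\ell_1\sigma,\dots,\ell_n\sigma)$, $\rho\in R$, $\mathrm{label}(a_i)\sigma\rightharpoonup^*b_i\sigma$ for $1\le i\le j$, and either (successful) $j=k$, $t=s[\mathrm{label}(r)\sigma]_p$, or (failed) $j<k$, $\mathrm{label}(a_{j+1})\sigma\rightharpoonup^*u\tau$ for a linear labeled normal form $u$ with $\mathrm{erase}(u)$ not unifiable with $b_{j+1}$, and $t=s[f_{R\setminus\{\rho\}}(\ell_1\sigma,\dots,\ell_n\sigma)]_p$. A complexity-conscious reduction is a labeled reduction together with chosen witnessing condition reductions; its cost is the sum of its step costs, where a $\bot$-step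 costs $0$, a successful step costs $1$ plus the costs of the $k$ condition reductions, and a failed step costs the sum of the costs of the $j$ condition reductions and of $\mathrm{label}(a_{j+1})\sigma\rightharpoonup^*u\tau$. $s\rightharpoonup_\rhd t$ if there are $p$, $\rho$ as in (ii), $\sigma$, $0\le j<k$ with $s|_p=f_R(\ell_1\sigma,\dots,\ell_n\sigma)$, $\rho\in R$, $\mathrm{label}(a_i)\sigma\rightharpoonup^*b_i\sigma$ for $i\le j$, and $t=\mathrm{label}(a_{j+1})\sigma$; $s\rightharpoonup^\infty$ means an infinite sequence of $\rightharpoonup\cup\rightharpoonup_\rhd$ steps from $s$. The transformed system: signature $\mathcal H$ with constants $\bot,\top$ ($\mu=\emptyset$); every $f\in\mathcal F$ of arity $n$ as a symbol of arity $n+m_f$ with $\mu(f)=\{1,\dots,n\}$; and for every defined $f$ of arity $n$, every $\rho^f_i$ with $k>0$ conditions and $1\le j\le k$ a symbol $f_i^j$ of arity $n+m_f+j-1$ with $\mu(f_i^j)=\{n+i+j-1\}$. A position is active in $t$ if it is $\epsilon$ or $iq$ with $i\in\mu(\mathrm{root}(t))$ and $q$ active in $t|_i$; $\to_{\Xi(\mathcal R),\mu}$ rewrites only at active positions. $\xi_\star$ ($\star\in\{\bot,\top\}$): identity on variables, homomorphic on constructors, $f(t_1..t_n)\mapsto f(\xi_\star(t_1),\dots,\xi_\star(t_n),\star,\dots,\star)$ ($m_f$ copies) for defined $f$; $\bot$-patterns are linear terms $\xi_\bot(t)$. For a linear constructor term $t$: $\mathrm{AP}(x)=\emptyset$, and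 $\mathrm{AP}(f(t_1,\dots,t_n))$ consists of $g(x_1,\dots,x_m)$ for every constructor $g\neq f$ of arity $m$, $g(x_1,\dots,x_m,\bot,\dots,\bot)$ for every defined $g$ of arity $m$, and $f(x_1,\dots,x_{i-1},u,x_{i+1},\dots,x_n)$ for $u\in\mathrm{AP}(t_i)$ (fresh distinct $x$'s). Notation: $\langle t_1,\dots,t_n\rangle[u_1,\dots,u_j]_i$ is $t_1,\dots,t_{i-1},u_1,\dots,u_j,t_{i+1},\dots,t_n$. For the $i$-th rule $\rho_i\colon f(\vec\ell)\to r\Leftarrow a_1\approx b_1,\dots,a_k\approx b_k$ of $\mathcal R{\restriction}f$ and fresh distinct $x_1,\dots,x_{m_f},y_1,\dots,y_n$, $\Xi(\mathcal R)$ contains: $(1)$ if $k=0$: $f(\vec\ell,\langle\vec x\rangle[\top]_i)\to\xi_\top(r)$; if $k>0$: $(2)$ $f(\vec\ell,\langle\vec x\rangle[\top]_i)\to f_i^1(\vec\ell,\langle\vec x\rangle[\xi_\top(a_1)]_i)$, $(3)$ $f_i^k(\vec\ell,\langle\vec x\rangle[b_1,\dots,b_k]_i)\to\xi_\top(r)$, $(4)$ for $1\le j<k$: $f_i^j(\vec\ell,\langle\vec x\rangle[b_1,\dots,b_j]_i)\to f_i^{j+1}(\vec\ell,\langle\vec x\rangle[b_1,\dots,b_j,\xi_\top(a_{j+1})]_i)$, $(5)$ for $1\le j\le k$ and $v\in\mathrm{AP}(b_j)$ (fresh variables): $f_i^j(\vec\ell,\langle\vec x\rangle[b_1,\dots,b_{j-1},v]_i)\to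 f(\vec\ell,\langle\vec x\rangle[\bot]_i)$; and for any $k$: $(6)$ for $1\le j\le n$ and $v\in\mathrm{AP}(\ell_j)$ (fresh variables): $f(\langle\vec y\rangle[v]_j,\langle\vec x\rangle[\top]_i)\to f(\langle\vec y\rangle[v]_j,\langle\vec x\rangle[\bot]_i)$. The cost of a $(\Xi(\mathcal R),\mu)$-reduction is the number of steps using rules of type (1) or (3). The map $\zeta\colon\mathcal T(\mathcal G,\mathcal V)\to\mathcal T(\mathcal H,\mathcal V)$: identity on variables, homomorphic on constructors, $\zeta(f_R(t_1,\dots,t_n))=f(\zeta(t_1),\dots,\zeta(t_n),c_1,\dots,c_{m_f})$ with $c_i=\top$ iff $\rho^f_i\in R$, else $\bot$. *)

(* Defs.v *)
From Stdlib Require Import List Arith.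
Import ListNotations.
Set Implicit Arguments.

Inductive term (S : Type) : Type :=
| Var (x : nat)
| App (f : S) (args : list (term S)).
Arguments Var {S} x.
Arguments App {S} f args.

Fixpoint tsubst {S} (sg : nat -> term S) (t : term S) : term S :=
  match t with
  | Var x => sg x
  | App f ts => App f (map (tsubst sg) ts)
  end.

Fixpoint tvars {S} (t : term S) : list nat :=
  match t with
  | Var x => [x]
  | App _ ts => flat_map tvars ts
  end.

Fixpoint tmap {S T} (h : S -> T) (t : term S) : term T :=
  match t with
  | Var x => Var x
  | App f ts => App (h f) (map (tmap h) ts)
  end.

Inductive all_syms {S} (P : S -> nat -> Prop) : term S -> Prop :=
| as_var x : all_syms P (Var x)
| as_app f ts : P f (length ts) -> Forall (all_syms P) ts -> all_syms P (App f ts).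

Definition linear {S} (t : term S) : Prop := NoDup (tvars t).

Definition disjoint (l1 l2 : list nat) : Prop := forall x, In x l1 -> ~ In x l2.

Definition pairwise_disjoint (ls : list (list nat)) : Prop :=
  forall i j li lj, i <> j -> nth_error ls i = Some li -> nth_error ls j = Some lj ->
  disjoint li lj.

Definition unifiable {S} (a b : term S) : Prop :=
  exists th : nat -> term S, tsubst th a = tsubst th b.

Fixpoint set_nth {A} (l : list A) (i : nat) (x : A) : list A :=
  match l, i with
  | [], _ => []
  | _ :: l', 0 => x :: l'
  | y :: l', S i' => y :: set_nth l' i' x
  end.

(* <t_1,...,t_n>[u_1,...,u_j]_i  (i is 1-based) *)
Definition repl {A} (xs : list A) (i : nat) (us : list A) : list A :=
  firstn (i - 1) xs ++ us ++ skipn i xs.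

(* rule  f(l_1..l_n) -> r <= a_1 ~ b_1, ..., a_k ~ b_k  ; the root f is
   determined by the list  rules f  the rule belongs to. *)
Record rule (F : Type) := mkRule {
  r_lhs : list (term F);
  r_rhs : term F;
  r_conds : list (term F * term F) }.
Arguments r_lhs {F}. Arguments r_rhs {F}. Arguments r_conds {F}.

(* A signature with arities together with a finitely branching rule set:
   rules f = the enumeration rho^f_1, ..., rho^f_{m_f} of R|f. *)
Record trs (F : Type) := mkTrs {
  ar : F -> nat;
  rules : F -> list (rule F) }.
Arguments ar {F}. Arguments rules {F}.

Definition defined {F} (Rs : trs F) (f : F) : Prop := rules Rs f <> [].
Definition constructor {F} (Rs : trs F) (f : F) : Prop := rules Rs f = [].
Definition msz {F} (Rs : trs F) (f : F) : nat := length (rules Rs f).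

Definition wfF {F} (Rs : trs F) : term F -> Prop := all_syms (fun f n => n = ar Rs f).
Definition con_term {F} (Rs : trs F) : term F -> Prop :=
  all_syms (fun f _ => constructor Rs f).

Definition lvars {F} (ts : list (term F)) : list nat := flat_map tvars ts.

Definition rule_ok {F} (Rs : trs F) (f : F) (rho : rule F) : Prop :=
  let ls := r_lhs rho in
  let cs := r_conds rho in
  length ls = ar Rs f /\
  Forall (wfF Rs) ls /\ wfF Rs (r_rhs rho) /\
  Forall (fun ab => wfF Rs (fst ab) /\ wfF Rs (snd ab)) cs /\
  Forall (con_term Rs) ls /\ Forall (fun ab => con_term Rs (snd ab)) cs /\
  pairwise_disjoint (lvars ls :: map (fun ab => tvars (snd ab)) cs) /\
  incl (tvars (r_rhs rho)) (lvars ls ++ lvars (map snd cs)) /\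
  (forall i a b, nth_error cs i = Some (a, b) ->
     incl (tvars a) (lvars ls ++ lvars (map snd (firstn i cs)))) /\
  (* strong: f(l) and each b_j linear *)
  NoDup (lvars ls) /\ Forall (fun ab => linear (snd ab)) cs.

(* strong CCTRS (each R|f finite is built in: it is the list rules f) *)
Definition strong_cctrs {F} (Rs : trs F) : Prop :=
  forall f, NoDup (rules Rs f) /\ forall rho, In rho (rules Rs f) -> rule_ok Rs f rho.

Definition rvars {F} (rho : rule F) : list nat :=
  lvars (r_lhs rho) ++ flat_map (fun ab => tvars (fst ab) ++ tvars (snd ab)) (r_conds rho)
  ++ tvars (r_rhs rho).

(* GLab f R : the symbol f_R, with R subset of R|f given as its characteristic
   bit list w.r.t. the enumeration rules f (bit i  <->  rho^f_{i+1} in R). *)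
Inductive gsym (F : Type) := GCon (c : F) | GLab (f : F) (R : list bool).
Arguments GCon {F} c. Arguments GLab {F} f R.

Definition wfG {F} (Rs : trs F) : term (gsym F) -> Prop :=
  all_syms (fun g n => match g with
                       | GCon c => constructor Rs c /\ n = ar Rs c
                       | GLab f R => defined Rs f /\ length R = msz Rs f /\ n = ar Rs f
                       end).

Fixpoint label {F} (Rs : trs F) (t : term F) : term (gsym F) :=
  match t with
  | Var x => Var x
  | App f ts =>
      App (match rules Rs f with
           | [] => GCon f
           | l => GLab f (repeat true (length l))
           end) (map (label Rs) ts)
  end.

Definition erase_sym {F} (g : gsym F) : F :=
  match g with GCon c => c | GLab f _ => f end.
Definition erase {F} : term (gsym F) -> term F := tmap erase_sym.

Definition labeled_nf {F} : term (gsym F) -> Prop :=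
  all_syms (fun g _ => match g with GCon _ => True | GLab _ R => Forall (eq false) R end).

Definition lhsG {F} (Rs : trs F) (rho : rule F) (sg : nat -> term (gsym F)) :=
  map (fun l => tsubst sg (label Rs l)) (r_lhs rho).

Inductive lstep {F} (Rs : trs F) : term (gsym F) -> term (gsym F) -> nat -> Prop :=
| ls_bot f R i rho us sg :
    nth_error (rules Rs f) i = Some rho -> nth_error R i = Some true ->
    Forall labeled_nf us ->
    NoDup (lvars us) -> disjoint (lvars us) (rvars rho) ->
    ~ unifiable (App f (map erase us)) (App f (r_lhs rho)) ->
    lstep Rs (App (GLab f R) (map (tsubst sg) us))
             (App (GLab f (set_nth R i false)) (map (tsubst sg) us)) 0
| ls_succ f R i rho sg cs :
    nth_error (rules Rs f) i = Some rho -> nth_error R i = Some true ->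
    length cs = length (r_conds rho) ->
    (forall q a b c, nth_error (r_conds rho) q = Some (a, b) -> nth_error cs q = Some c ->
       lsteps Rs (tsubst sg (label Rs a)) (tsubst sg (label Rs b)) c) ->
    lstep Rs (App (GLab f R) (lhsG Rs rho sg)) (tsubst sg (label Rs (r_rhs rho)))
          (S (list_sum cs))
| ls_fail f R i rho sg j cs a b u tau c :
    nth_error (rules Rs f) i = Some rho -> nth_error R i = Some true ->
    nth_error (r_conds rho) j = Some (a, b) ->
    length cs = j ->
    (forall q a' b' c', nth_error (r_conds rho) q = Some (a', b') -> nth_error cs q = Some c' ->
       lsteps Rs (tsubst sg (label Rs a')) (tsubst sg (label Rs b')) c') ->
    lsteps Rs (tsubst sg (label Rs a)) (tsubst tau u) c ->
    labeled_nf u -> linear u -> disjoint (tvars u) (tvars b) ->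
    ~ unifiable (erase u) b ->
    lstep Rs (App (GLab f R) (lhsG Rs rho sg))
             (App (GLab f (set_nth R i false)) (lhsG Rs rho sg)) (list_sum cs + c)
| ls_ctx g ts q t t' c :
    nth_error ts q = Some t -> lstep Rs t t' c ->
    lstep Rs (App g ts) (App g (set_nth ts q t')) c
with lsteps {F} (Rs : trs F) : term (gsym F) -> term (gsym F) -> nat -> Prop :=
| lss_refl t : lsteps Rs t t 0
| lss_step t1 t2 t3 c1 c2 : lstep Rs t1 t2 c1 -> lsteps Rs t2 t3 c2 -> lsteps Rs t1 t3 (c1 + c2).

Inductive lcond_root {F} (Rs : trs F) : term (gsym F) -> term (gsym F) -> Prop :=
| lc_intro f R i rho sg j cs a b :
    nth_error (rules Rs f) i = Some rho -> nth_error R i = Some true ->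
    nth_error (r_conds rho) j = Some (a, b) ->
    length cs = j ->
    (forall q a' b' c', nth_error (r_conds rho) q = Some (a', b') -> nth_error cs q = Some c' ->
       lsteps Rs (tsubst sg (label Rs a')) (tsubst sg (label Rs b')) c') ->
    lcond_root Rs (App (GLab f R) (lhsG Rs rho sg)) (tsubst sg (label Rs a)).

Inductive subterm {S} : term S -> term S -> Prop :=
| st_refl t : subterm t t
| st_arg s g ts t : In t ts -> subterm s t -> subterm s (App g ts).

Definition lcond {F} (Rs : trs F) (s t : term (gsym F)) : Prop :=
  exists s', subterm s' s /\ lcond_root Rs s' t.

Definition linf {F} (Rs : trs F) (s : term (gsym F)) : Prop :=
  exists g : nat -> term (gsym F), g 0 = s /\
    forall n, (exists c, lstep Rs (g n) (g (S n)) c) \/ lcond Rs (g n) (g (S n)).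

(* HAux f i j  is  f_i^j  (i, j 1-based) *)
Inductive hsym (F : Type) := HBot | HTop | HF (f : F) | HAux (f : F) (i j : nat).
Arguments HBot {F}. Arguments HTop {F}. Arguments HF {F} f. Arguments HAux {F} f i j.

Definition hc {F} (h : hsym F) : term (hsym F) := App h [].

(* replacement map mu on argument indices (1-based) *)
Definition mu {F} (Rs : trs F) (h : hsym F) (p : nat) : Prop :=
  match h with
  | HF f => 1 <= p <= ar Rs f
  | HAux f i j => 1 <= p /\ p = ar Rs f + i + j - 1
  | _ => False
  end.

Fixpoint xi {F} (Rs : trs F) (st : hsym F) (t : term F) : term (hsym F) :=
  match t with
  | Var x => Var x
  | App f ts => App (HF f) (map (xi Rs st) ts ++ repeat (hc st) (msz Rs f))
  end.

Definition bit2h {F} (b : bool) : term (hsym F) := if b then hc HTop else hc HBot.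

Fixpoint zeta {F} (Rs : trs F) (t : term (gsym F)) : term (hsym F) :=
  match t with
  | Var x => Var x
  | App (GCon c) ts => App (HF c) (map (zeta Rs) ts)
  | App (GLab f R) ts => App (HF f) (map (zeta Rs) ts ++ map bit2h R)
  end.

(* AP(t) for a (linear constructor) term t; freshness/distinctness of the
   variables is imposed where AP is used (NoDup on all variables). *)
Inductive AP {F} (Rs : trs F) : term F -> term (hsym F) -> Prop :=
| ap_con f ts g xs :
    constructor Rs g -> g <> f -> length xs = ar Rs g ->
    AP Rs (App f ts) (App (HF g) (map Var xs))
| ap_def f ts g xs :
    defined Rs g -> length xs = ar Rs g ->
    AP Rs (App f ts) (App (HF g) (map Var xs ++ repeat (hc HBot) (msz Rs g)))
| ap_arg f ts i ti u xs :
    1 <= i -> nth_error ts (i - 1) = Some ti -> AP Rs ti u -> length xs = length ts ->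
    AP Rs (App f ts) (App (HF f) (repl (map Var xs) i [u])).

Definition Lh {F} (Rs : trs F) (rho : rule F) := map (xi Rs HTop) (r_lhs rho).
Definition Bh {F} (Rs : trs F) (rho : rule F) :=
  map (fun ab => xi Rs HTop (snd ab)) (r_conds rho).

(* XiRule Rs l r c : (l -> r) in Xi(R); c = 1 for rules of type (1) or (3),
   c = 0 otherwise.  i is the 1-based index of rho in rules f. *)
Inductive XiRule {F} (Rs : trs F) : term (hsym F) -> term (hsym F) -> nat -> Prop :=
| xi_1 f i rho xs :
    1 <= i -> nth_error (rules Rs f) (i - 1) = Some rho -> r_conds rho = [] ->
    length xs = msz Rs f -> NoDup xs -> disjoint xs (rvars rho) ->
    XiRule Rs (App (HF f) (Lh Rs rho ++ repl (map Var xs) i [hc HTop]))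
              (xi Rs HTop (r_rhs rho)) 1
| xi_2 f i rho xs a1 b1 cs :
    1 <= i -> nth_error (rules Rs f) (i - 1) = Some rho -> r_conds rho = (a1, b1) :: cs ->
    length xs = msz Rs f -> NoDup xs -> disjoint xs (rvars rho) ->
    XiRule Rs (App (HF f) (Lh Rs rho ++ repl (map Var xs) i [hc HTop]))
              (App (HAux f i 1) (Lh Rs rho ++ repl (map Var xs) i [xi Rs HTop a1])) 0
| xi_3 f i rho xs :
    1 <= i -> nth_error (rules Rs f) (i - 1) = Some rho -> r_conds rho <> [] ->
    length xs = msz Rs f -> NoDup xs -> disjoint xs (rvars rho) ->
    XiRule Rs (App (HAux f i (length (r_conds rho))) (Lh Rs rho ++ repl (map Var xs) i (Bh Rs rho)))
              (xi Rs HTop (r_rhs rho)) 1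
| xi_4 f i rho xs j a b :
    1 <= i -> nth_error (rules Rs f) (i - 1) = Some rho ->
    1 <= j -> j < length (r_conds rho) -> nth_error (r_conds rho) j = Some (a, b) ->
    length xs = msz Rs f -> NoDup xs -> disjoint xs (rvars rho) ->
    XiRule Rs (App (HAux f i j) (Lh Rs rho ++ repl (map Var xs) i (firstn j (Bh Rs rho))))
              (App (HAux f i (S j))
                   (Lh Rs rho ++ repl (map Var xs) i (firstn j (Bh Rs rho) ++ [xi Rs HTop a]))) 0
| xi_5 f i rho xs j a b v :
    1 <= i -> nth_error (rules Rs f) (i - 1) = Some rho ->
    1 <= j -> j <= length (r_conds rho) -> nth_error (r_conds rho) (j - 1) = Some (a, b) ->
    AP Rs b v ->
    length xs = msz Rs f -> NoDup (xs ++ tvars v) -> disjoint (xs ++ tvars v) (rvars rho) ->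
    XiRule Rs (App (HAux f i j)
                   (Lh Rs rho ++ repl (map Var xs) i (firstn (j - 1) (Bh Rs rho) ++ [v])))
              (App (HF f) (Lh Rs rho ++ repl (map Var xs) i [hc HBot])) 0
| xi_6 f i rho xs ys j lj v :
    1 <= i -> nth_error (rules Rs f) (i - 1) = Some rho ->
    1 <= j -> nth_error (r_lhs rho) (j - 1) = Some lj -> AP Rs lj v ->
    length xs = msz Rs f -> length ys = ar Rs f ->
    NoDup (xs ++ ys ++ tvars v) -> disjoint (xs ++ ys ++ tvars v) (rvars rho) ->
    XiRule Rs (App (HF f) (repl (map Var ys) j [v] ++ repl (map Var xs) i [hc HTop]))
              (App (HF f) (repl (map Var ys) j [v] ++ repl (map Var xs) i [hc HBot])) 0.

Inductive cs_step {F} (Rs : trs F) : term (hsym F) -> term (hsym F) -> nat -> Prop :=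
| cs_root l r c sg : XiRule Rs l r c -> cs_step Rs (tsubst sg l) (tsubst sg r) c
| cs_ctx h ts p t t' c :
    mu Rs h p -> nth_error ts (p - 1) = Some t -> cs_step Rs t t' c ->
    cs_step Rs (App h ts) (App h (set_nth ts (p - 1) t')) c.

Inductive cs_steps {F} (Rs : trs F) : term (hsym F) -> term (hsym F) -> nat -> Prop :=
| css_refl t : cs_steps Rs t t 0
| css_step t1 t2 t3 c1 c2 :
    cs_step Rs t1 t2 c1 -> cs_steps Rs t2 t3 c2 -> cs_steps Rs t1 t3 (c1 + c2).

Definition cs_infinite {F} (Rs : trs F) (t : term (hsym F)) : Prop :=
  exists g : nat -> term (hsym F), g 0 = t /\ forall n, exists c, cs_step Rs (g n) (g (S n)) c.

Definition cs_terminating {F} (Rs : trs F) (t : term (hsym F)) : Prop :=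
  ~ cs_infinite Rs t.

(* Main.v *)
(** A context-sensitive reduction [zeta s ->* t] is replayed on the labeled side from the
    outside in.  By induction on the active subterms and reducts of [zeta s], each reduct with
    root [HF f] is explained by labeled steps [s -> g(us)] together with reductions
    [zeta us_i ->* t_i]: the costs of the latter are debts, still to be paid by the [us_i].
    If a substitution instance of a left-hand side is reached, the debts belong to the values
    [s x] of its variables.  A debt is inherited by every later occurrence of [x], so it is only
    lost when [x] does not occur in the conditions used and in the result; then [s x] is reduced,
    by induction at a cost of at least the debt, before the rule is applied.  This leaves the
    condition reductions intact, as they do not use [x].  While a condition is being evaluated
    below [HAux f i j] nothing can be replayed yet, but in the terminating case the reduction can
    be extended to a normal form, and such terms are never normal, because a ground normal form
    matches the constructor pattern [b] or one of the patterns [AP b].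
    An infinite reduction, taken at a subterm of [s] with terminating arguments, must leave every
    such explanation, hence it produces a proper labeled step or an infinite condition. *)
Require Import Defs.
From Stdlib Require Import List Arith Lia Classical ClassicalEpsilon Relations.
Import ListNotations.

(** * Lists, substitutions and sums *)

(** Replaying eagerly, that is, reducing an argument on the labeled side as soon as it is reduced on
    the other, is blocked when the argument currently sits inside a pending condition: such a term
    is the image of no labeled term. So arguments stay untouched until a pattern inspects them, and
    then only as much is exposed as the pattern shows. Linearity of left-hand sides and of the [b_j]
    makes this consistent: separately exposed pieces bind disjoint variables, so substitutions and
    debts can be glued. Costs need not agree, only be bounded from below: a value reduced once and
    then copied is reduced again for each copy on the labeled side, which can only raise the labeled
    cost. The induction runs over terms of the transformed signature while costs are counted over
    labeled terms, so every labeled reduction is accompanied by a context-sensitive one between the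
    images under [zeta]. The infinite case relies on the terminating one: there the conditions
    terminate, and tameness is what allows their results to be matched against the [b_j]. *)

Lemma term_nested_ind {S} (P : term S -> Prop) :
  (forall x, P (Var x)) -> (forall f ts, Forall P ts -> P (App f ts)) -> forall t, P t.
Proof.
  intros HV HA. fix IH 1. intros [x | f ts]; [apply HV | apply HA].
  induction ts; constructor; auto.
Qed.

Lemma all_syms_inv {S} (P : S -> nat -> Prop) f ts :
  all_syms P (App f ts) -> P f (length ts) /\ Forall (all_syms P) ts.
Proof. intros H; inversion H; auto. Qed.

Lemma app_inj_length {A} (a b c d : list A) :
  length a = length c -> a ++ b = c ++ d -> a = c /\ b = d.
Proof.
  revert c; induction a; destruct c; simpl; intros H1 H2; try discriminate; auto.
  injection H2; intros; destruct (IHa c); auto; subst; auto.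
Qed.

Lemma nth_error_split_at {A} (l : list A) n x :
  nth_error l n = Some x -> l = firstn n l ++ x :: skipn (S n) l /\ length (firstn n l) = n.
Proof.
  revert n; induction l; destruct n; simpl; intros H; try discriminate.
  - injection H; intros; subst; auto.
  - destruct (IHl n H) as [E L]; split; [f_equal; exact E | f_equal; exact L].
Qed.

Lemma set_nth_app {A} (pre post : list A) x y :
  set_nth (pre ++ x :: post) (length pre) y = pre ++ y :: post.
Proof. induction pre; simpl; congruence. Qed.

Lemma set_nth_firstn_skipn {A} (l : list A) n y :
  n < length l -> set_nth l n y = firstn n l ++ y :: skipn (S n) l.
Proof.
  revert n; induction l; simpl; intros n H; [lia |].
  destruct n; auto. simpl; f_equal; apply IHl; lia.
Qed.

Lemma length_set_nth {A} (l : list A) n x : length (set_nth l n x) = length l.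
Proof. revert n; induction l; destruct n; simpl; auto. Qed.

Lemma map_repl {A B} (f : A -> B) xs i us : map f (repl xs i us) = repl (map f xs) i (map f us).
Proof. unfold repl. rewrite !map_app, firstn_map, skipn_map. reflexivity. Qed.

(** Used with [xs] the values of a rule's bit variables and [ys] the actual bits: matching
    determines slot [i], and the remaining entries agree, so refilling the slot gives the same list
    from either side. *)
Lemma repl_inv {A} (xs ys : list A) i a :
  1 <= i -> i <= length xs -> length xs = length ys -> repl xs i [a] = ys ->
  nth_error ys (i - 1) = Some a /\ forall L, repl xs i L = repl ys i L.
Proof.
  intros H1 H2 H3 <-. unfold repl in *.
  assert (L : length (firstn (i - 1) xs) = i - 1) by (rewrite length_firstn; lia).
  split.
  - rewrite nth_error_app2, L, Nat.sub_diag by lia. reflexivity.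
  - intros us. f_equal; [| f_equal].
    + rewrite firstn_app, L, Nat.sub_diag; simpl. rewrite app_nil_r.
      rewrite firstn_firstn, Nat.min_id. reflexivity.
    + rewrite skipn_app, L. rewrite (skipn_all2 (firstn (i - 1) xs)) by lia.
      replace (i - (i - 1)) with 1 by lia. reflexivity.
Qed.

Lemma repl_self {A} (xs : list A) i a :
  1 <= i -> nth_error xs (i - 1) = Some a -> repl xs i [a] = xs.
Proof.
  intros H1 H2. destruct (nth_error_split_at _ _ _ H2) as [E _].
  unfold repl. simpl. replace i with (S (i - 1)) at 2 by lia. symmetry; exact E.
Qed.

Lemma set_nth_repl {A} (xs : list A) i y :
  1 <= i -> i <= length xs -> set_nth xs (i - 1) y = repl xs i [y].
Proof.
  intros. rewrite set_nth_firstn_skipn by lia. unfold repl. cbn [app].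
  replace (S (i - 1)) with i by lia. reflexivity.
Qed.

Lemma length_repl1 {A} (xs : list A) i y : 1 <= i -> i <= length xs -> length (repl xs i [y]) = length xs.
Proof.
  intros. unfold repl. rewrite !length_app, length_firstn, length_skipn. simpl. lia.
Qed.

Definition sumv (d : nat -> nat) (l : list nat) : nat := list_sum (map d l).

Lemma sumv_app d l1 l2 : sumv d (l1 ++ l2) = sumv d l1 + sumv d l2.
Proof. unfold sumv. rewrite map_app. apply list_sum_app. Qed.

Lemma sumv_cons d x l : sumv d (x :: l) = d x + sumv d l.
Proof. reflexivity. Qed.

Lemma sumv_le d d' l : (forall x, In x l -> d x <= d' x) -> sumv d l <= sumv d' l.
Proof.
  induction l; intros H; [apply le_n |]. rewrite !sumv_cons.
  pose proof (H a (or_introl eq_refl)).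
  assert (sumv d l <= sumv d' l) by (apply IHl; intros; apply H; right; auto). lia.
Qed.

Lemma sumv_ext d d' l : (forall x, In x l -> d x = d' x) -> sumv d l = sumv d' l.
Proof. intros H. apply Nat.le_antisymm; apply sumv_le; intros; rewrite H; auto. Qed.

Definition override {A} (l : list nat) (f g : nat -> A) (x : nat) : A :=
  if in_dec Nat.eq_dec x l then f x else g x.

Lemma override_in {A} l (f g : nat -> A) x : In x l -> override l f g x = f x.
Proof. unfold override. destruct (in_dec Nat.eq_dec x l); tauto. Qed.

Lemma override_out {A} l (f g : nat -> A) x : ~ In x l -> override l f g x = g x.
Proof. unfold override. destruct (in_dec Nat.eq_dec x l); tauto. Qed.

(* The debts of the variables of [V] outside [A]. *)
Definition unused (d : nat -> nat) (A V : list nat) : nat := sumv (override A (fun _ => 0) d) V.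

Lemma in_lvars {S} (ts : list (term S)) t x : In t ts -> In x (tvars t) -> In x (lvars ts).
Proof. intros. apply in_flat_map. eauto. Qed.

Lemma NoDup_app_inv {A} (l1 l2 : list A) :
  NoDup (l1 ++ l2) -> NoDup l1 /\ NoDup l2 /\ forall x, In x l1 -> ~ In x l2.
Proof.
  induction l1; simpl; intros H.
  - repeat split; auto; constructor.
  - inversion H; subst. destruct (IHl1 H3) as (? & ? & ?).
    rewrite in_app_iff in H2. repeat split; auto.
    + constructor; tauto.
    + intros x [-> | ?]; [tauto | auto].
Qed.

Lemma NoDup_app_intro {A} (l1 l2 : list A) :
  NoDup l1 -> NoDup l2 -> (forall x, In x l1 -> ~ In x l2) -> NoDup (l1 ++ l2).
Proof.
  induction l1; simpl; intros H1 H2 H3; auto. inversion H1; subst.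
  constructor; [rewrite in_app_iff; intros [?|?]; [tauto | apply (H3 a); auto] |].
  apply IHl1; auto.
Qed.

Lemma tsubst_ext {S} (s1 s2 : nat -> term S) t :
  (forall x, In x (tvars t) -> s1 x = s2 x) -> tsubst s1 t = tsubst s2 t.
Proof.
  induction t as [x | f ts IH] using term_nested_ind; simpl; intros H; auto.
  f_equal. apply map_ext_in. intros t Ht.
  apply (proj1 (Forall_forall _ _) IH t Ht). intros x Hx. apply H. apply in_flat_map. eauto.
Qed.

Lemma map_tsubst_ext {S} (s1 s2 : nat -> term S) ts :
  (forall x, In x (lvars ts) -> s1 x = s2 x) -> map (tsubst s1) ts = map (tsubst s2) ts.
Proof.
  intros H. apply map_ext_in. intros t Ht. apply tsubst_ext. intros x Hx. apply H.
  eapply in_lvars; eauto.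
Qed.

Lemma map_tsubst_agree {S} (s1 s2 : nat -> term S) ts :
  Forall (fun t => tsubst s1 t = tsubst s2 t -> forall x, In x (tvars t) -> s1 x = s2 x) ts ->
  map (tsubst s1) ts = map (tsubst s2) ts -> forall x, In x (lvars ts) -> s1 x = s2 x.
Proof.
  induction 1 as [| t ts H _ IH]; simpl; intros E x Hx; [tauto |].
  injection E; intros E1 E2. apply in_app_iff in Hx. destruct Hx; auto.
Qed.

Lemma tsubst_agree {S} (s1 s2 : nat -> term S) t :
  tsubst s1 t = tsubst s2 t -> forall x, In x (tvars t) -> s1 x = s2 x.
Proof.
  induction t as [y | f ts IH] using term_nested_ind; simpl; intros E x Hx.
  - destruct Hx as [<- | []]; auto.
  - injection E; intros E1. eapply map_tsubst_agree; eauto.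
Qed.

Lemma tsubst_agree_list {S} (s1 s2 : nat -> term S) ts :
  map (tsubst s1) ts = map (tsubst s2) ts -> forall x, In x (lvars ts) -> s1 x = s2 x.
Proof. apply map_tsubst_agree. apply Forall_forall. intros; eapply tsubst_agree; eauto. Qed.

(** * Labeled terms and their images under zeta *)

Definition bits {F} (g : gsym F) : list (term (hsym F)) :=
  match g with GCon _ => [] | GLab _ R => map bit2h R end.

Definition gsym_ok {F} (Rs : trs F) (g : gsym F) (n : nat) : Prop :=
  match g with
  | GCon c => constructor Rs c /\ n = ar Rs c
  | GLab f R => defined Rs f /\ length R = msz Rs f /\ n = ar Rs f
  end.

(** Combines [wfG] with the absence of variables, so that one inversion yields both for all
    arguments. *)
Inductive ground_ok {F} (Rs : trs F) : term (gsym F) -> Prop :=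
| ground_ok_app g us :
    gsym_ok Rs g (length us) -> Forall (ground_ok Rs) us -> ground_ok Rs (App g us).

Lemma ground_ok_inv {F} (Rs : trs F) g us :
  ground_ok Rs (App g us) -> gsym_ok Rs g (length us) /\ Forall (ground_ok Rs) us.
Proof. intros H; inversion H; auto. Qed.

Lemma gsym_ok_arity {F} (Rs : trs F) g n : gsym_ok Rs g n -> n = ar Rs (erase_sym g).
Proof. destruct g; simpl; tauto. Qed.

Lemma gsym_ok_bits {F} (Rs : trs F) g n : gsym_ok Rs g n -> length (bits g) = msz Rs (erase_sym g).
Proof.
  destruct g; simpl; unfold msz.
  - intros [-> _]. reflexivity.
  - rewrite length_map; tauto.
Qed.

Lemma bit2h_inj {F} (R R' : list bool) : map (@bit2h F) R = map bit2h R' -> R = R'.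
Proof.
  revert R'; induction R as [| b R IH]; destruct R' as [| b' R']; simpl; intros H; try discriminate; auto.
  injection H; intros H1 H2. rewrite (IH _ H1). f_equal.
  destruct b, b'; simpl in H2; auto; discriminate.
Qed.

Lemma gsym_eq {F} (Rs : trs F) g g' n n' :
  gsym_ok Rs g n -> gsym_ok Rs g' n' -> erase_sym g = erase_sym g' -> bits g = bits g' -> g = g'.
Proof.
  destruct g as [c | f R], g' as [c' | f' R']; simpl; unfold constructor, defined; intros H1 H2 -> H4.
  - auto.
  - destruct H1, H2; congruence.
  - destruct H1, H2; congruence.
  - apply bit2h_inj in H4. congruence.
Qed.

Lemma zeta_app {F} (Rs : trs F) g us :
  zeta Rs (App g us) = App (HF (erase_sym g)) (map (zeta Rs) us ++ bits g).
Proof. destruct g; simpl; rewrite ?app_nil_r; reflexivity. Qed.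

Lemma tsubst_bits {F} (s : nat -> term (hsym F)) g : map (tsubst s) (bits g) = bits g.
Proof.
  destruct g; simpl; auto. rewrite map_map. apply map_ext. intros []; reflexivity.
Qed.

Lemma lvars_bits {F} (g : gsym F) : lvars (bits g) = [].
Proof. destruct g; simpl; auto. induction R as [| [] R IH]; simpl; auto. Qed.

Lemma tsubst_zeta {F} (Rs : trs F) s q :
  zeta Rs (tsubst s q) = tsubst (fun x => zeta Rs (s x)) (zeta Rs q).
Proof.
  induction q as [x | g qs IH] using term_nested_ind; auto.
  cbn [tsubst]. rewrite !zeta_app. cbn [tsubst]. f_equal.
  rewrite map_app, tsubst_bits, !map_map. f_equal.
  apply map_ext_in. apply Forall_forall. exact IH.
Qed.

Lemma map_tsubst_zeta {F} (Rs : trs F) s qs :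
  map (zeta Rs) (map (tsubst s) qs) = map (tsubst (fun x => zeta Rs (s x))) (map (zeta Rs) qs).
Proof. rewrite !map_map. apply map_ext. intros; apply tsubst_zeta. Qed.

Lemma lvars_map {S T} (h : term S -> term T) ts :
  (forall t, In t ts -> tvars (h t) = tvars t) -> lvars (map h ts) = lvars ts.
Proof.
  induction ts; simpl; intros H; auto. f_equal; auto. 
Qed.

Lemma tvars_zeta {F} (Rs : trs F) q : tvars (zeta Rs q) = tvars q.
Proof.
  induction q as [x | g qs IH] using term_nested_ind; auto.
  rewrite zeta_app. cbn [tvars]. rewrite flat_map_app. fold (lvars (bits g)). rewrite lvars_bits, app_nil_r.
  apply (lvars_map (zeta Rs)). apply Forall_forall. exact IH.
Qed.

Lemma tvars_label {F} (Rs : trs F) t : tvars (label Rs t) = tvars t.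
Proof.
  induction t as [x | f ts IH] using term_nested_ind; auto.
  cbn [label tvars]. apply (lvars_map (label Rs)). apply Forall_forall. exact IH.
Qed.

(** The full label decodes to a row of [HTop]. Hence the terms built by [xi] in the transformed
    rules are images of labeled terms, and instances of them can be treated by induction. *)
Lemma zeta_label {F} (Rs : trs F) t : zeta Rs (label Rs t) = xi Rs HTop t.
Proof.
  induction t as [x | f ts IH] using term_nested_ind; auto.
  cbn [label xi]. rewrite zeta_app.
  assert (E : map (zeta Rs) (map (label Rs) ts) = map (xi Rs HTop) ts).
  { rewrite map_map. apply map_ext_in. apply Forall_forall. exact IH. }
  rewrite E. unfold msz. destruct (rules Rs f) as [| r l]; simpl; auto.
  do 3 f_equal. rewrite map_repeat. reflexivity.
Qed.

Lemma tvars_xi {F} (Rs : trs F) t : tvars (xi Rs HTop t) = tvars t.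
Proof. rewrite <- zeta_label, tvars_zeta. apply tvars_label. Qed.

Lemma wfG_label {F} (Rs : trs F) t : wfF Rs t -> wfG Rs (label Rs t).
Proof.
  induction t as [x | f ts IH] using term_nested_ind; intros H; [constructor |].
  apply all_syms_inv in H. destruct H as [H1 H2]. cbn [label]. constructor.
  - rewrite length_map. unfold constructor, defined, msz. destruct (rules Rs f) eqn:E; auto.
    rewrite E. split; [discriminate |]. split; [apply repeat_length | exact H1].
  - apply Forall_map. rewrite Forall_forall in *. intros t Ht. apply (IH t Ht). apply (H2 t Ht).
Qed.

Lemma ground_ok_subst {F} (Rs : trs F) s q :
  wfG Rs q -> (forall x, In x (tvars q) -> ground_ok Rs (s x)) -> ground_ok Rs (tsubst s q).
Proof.
  induction q as [x | g qs IH] using term_nested_ind; intros H Hs; simpl.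
  - apply Hs; simpl; auto.
  - apply all_syms_inv in H. destruct H as [H1 H2]. constructor.
    + rewrite length_map. exact H1.
    + apply Forall_map. rewrite Forall_forall in *. intros q Hq. apply IH; auto. apply H2; auto.
      intros x Hx. apply Hs. simpl. eapply in_lvars; eauto.
Qed.

Lemma ground_ok_of_wfG {F} (Rs : trs F) s : wfG Rs s -> tvars s = [] -> ground_ok Rs s.
Proof.
  intros H E.
  revert H E. induction s as [x | g us IH] using term_nested_ind; intros H E; [discriminate |].
  apply all_syms_inv in H. destruct H as [H1 H2]. constructor; auto.
  simpl in E. clear H1. induction us; constructor.
  - inversion IH; inversion H2; subst. simpl in E. apply app_eq_nil in E. apply H1; tauto.
  - inversion IH; inversion H2; subst. simpl in E. apply app_eq_nil in E. apply IHus; tauto.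
Qed.

(** * Reductions in contexts, argument lists and substitutions *)

Lemma cs_steps_trans {F} (Rs : trs F) a b c m n :
  cs_steps Rs a b m -> cs_steps Rs b c n -> cs_steps Rs a c (m + n).
Proof.
  induction 1; intros; simpl; auto. rewrite <- Nat.add_assoc. econstructor; eauto.
Qed.

Lemma cs_steps_one {F} (Rs : trs F) a b m : cs_step Rs a b m -> cs_steps Rs a b m.
Proof. intros. rewrite <- (Nat.add_0_r m). econstructor; eauto. constructor. Qed.

Lemma cs_step_arg {F} (Rs : trs F) h pre t t' post c :
  mu Rs h (S (length pre)) -> cs_step Rs t t' c ->
  cs_step Rs (App h (pre ++ t :: post)) (App h (pre ++ t' :: post)) c.
Proof.
  intros M H. rewrite <- (set_nth_app pre post t t').
  replace (length pre) with (S (length pre) - 1) at 1 by lia.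
  econstructor; eauto. simpl. rewrite Nat.sub_0_r. rewrite nth_error_app2, Nat.sub_diag by lia. reflexivity.
Qed.

Lemma cs_steps_arg {F} (Rs : trs F) h pre t t' post c :
  mu Rs h (S (length pre)) -> cs_steps Rs t t' c ->
  cs_steps Rs (App h (pre ++ t :: post)) (App h (pre ++ t' :: post)) c.
Proof.
  intros M. induction 1; [constructor |]. econstructor; eauto. apply cs_step_arg; auto.
Qed.

Lemma lsteps_trans {F} (Rs : trs F) a b c m n :
  lsteps Rs a b m -> lsteps Rs b c n -> lsteps Rs a c (m + n).
Proof.
  induction 1; intros; simpl; auto. rewrite <- Nat.add_assoc. econstructor; eauto.
Qed.

Lemma lsteps_one {F} (Rs : trs F) a b m : lstep Rs a b m -> lsteps Rs a b m.
Proof. intros. rewrite <- (Nat.add_0_r m). econstructor; eauto. constructor. Qed.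

Lemma lsteps_arg {F} (Rs : trs F) g pre t t' post c :
  lsteps Rs t t' c -> lsteps Rs (App g (pre ++ t :: post)) (App g (pre ++ t' :: post)) c.
Proof.
  induction 1; [constructor |]. econstructor; eauto.
  rewrite <- (set_nth_app pre post t1 t2). econstructor; eauto.
  rewrite nth_error_app2, Nat.sub_diag by lia. reflexivity.
Qed.

Inductive args_reduce {F} (Rs : trs F) :
    list (term (gsym F)) -> list (term (hsym F)) -> nat -> Prop :=
| ar_nil : args_reduce Rs [] [] 0
| ar_cons u us t ts d n :
    cs_steps Rs (zeta Rs u) t d -> args_reduce Rs us ts n ->
    args_reduce Rs (u :: us) (t :: ts) (d + n).

Lemma args_reduce_length {F} (Rs : trs F) us ts d : args_reduce Rs us ts d -> length us = length ts.
Proof. induction 1; simpl; auto. Qed.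

Lemma args_reduce_refl {F} (Rs : trs F) us : args_reduce Rs us (map (zeta Rs) us) 0.
Proof. induction us; simpl; [constructor |]. apply (ar_cons Rs _ _ _ _ 0 0); auto. constructor. Qed.

Lemma args_reduce_app {F} (Rs : trs F) g us ts d :
  gsym_ok Rs g (length us) -> args_reduce Rs us ts d ->
  cs_steps Rs (zeta Rs (App g us)) (App (HF (erase_sym g)) (ts ++ bits g)) d.
Proof.
  intros Hg H. apply gsym_ok_arity in Hg. rewrite zeta_app.
  change (map (zeta Rs) us ++ bits g) with ([] ++ map (zeta Rs) us ++ bits g).
  change (ts ++ bits g) with ([] ++ ts ++ bits g).
  assert (L : length (@nil (term (hsym F))) + length us <= ar Rs (erase_sym g)) by (simpl; lia).
  (* [pre] holds the arguments already reduced; [L] keeps the next position within the active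
     ones. *)
  clear Hg. revert L. generalize (@nil (term (hsym F))) as pre.
  induction H; simpl; intros pre L; [constructor |].
  apply cs_steps_trans with (App (HF (erase_sym g)) (pre ++ t :: map (zeta Rs) us ++ bits g)).
  - apply cs_steps_arg; auto. simpl. lia.
  - specialize (IHargs_reduce (pre ++ [t])). rewrite <- !app_assoc in IHargs_reduce. apply IHargs_reduce.
    rewrite length_app; simpl; lia.
Qed.

(** [c] counts labeled cost. The context-sensitive reduction records reachability: it places
    [zeta u'] below [zeta u] in the order of the induction and supplies condition reductions on the
    transformed side. *)
Definition sim {F} (Rs : trs F) (u u' : term (gsym F)) (c : nat) : Prop :=
  ground_ok Rs u /\ ground_ok Rs u' /\ lsteps Rs u u' c /\
  exists c', cs_steps Rs (zeta Rs u) (zeta Rs u') c'.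

Lemma sim_refl {F} (Rs : trs F) u : ground_ok Rs u -> sim Rs u u 0.
Proof. intros; repeat split; auto; try constructor. exists 0; constructor. Qed.

Lemma sim_trans {F} (Rs : trs F) a b c m n : sim Rs a b m -> sim Rs b c n -> sim Rs a c (m + n).
Proof.
  intros (? & ? & ? & c1 & ?) (? & ? & ? & c2 & ?); repeat split; auto.
  - eapply lsteps_trans; eauto.
  - exists (c1 + c2). eapply cs_steps_trans; eauto.
Qed.

Inductive sims {F} (Rs : trs F) : list (term (gsym F)) -> list (term (gsym F)) -> nat -> Prop :=
| sims_nil : sims Rs [] [] 0
| sims_cons u u' us us' c n : sim Rs u u' c -> sims Rs us us' n -> sims Rs (u :: us) (u' :: us') (c + n).

Lemma sims_length {F} (Rs : trs F) us us' c : sims Rs us us' c -> length us' = length us.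
Proof. induction 1; simpl; auto. Qed.

Lemma sims_args_reduce {F} (Rs : trs F) us us' c :
  sims Rs us us' c -> exists d, args_reduce Rs us (map (zeta Rs) us') d.
Proof.
  induction 1 as [| u u' us us' c n (? & ? & ? & c' & ?) _ [d IH]]; simpl; eauto using @args_reduce.
Qed.

Lemma sim_app {F} (Rs : trs F) g us us' c :
  gsym_ok Rs g (length us) -> sims Rs us us' c -> sim Rs (App g us) (App g us') c.
Proof.
  intros Hg H. split; [| split; [| split]].
  - constructor; auto. clear Hg. induction H; constructor; auto. apply H.
  - constructor; [rewrite (sims_length _ _ _ _ H); auto |].
    clear Hg. induction H; constructor; auto. apply H.
  - clear Hg. change us with ([] ++ us). change us' with ([] ++ us').
    generalize (@nil (term (gsym F))) as pre.
    induction H; simpl; intros pre; [constructor |].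
    apply lsteps_trans with (App g (pre ++ u' :: us)).
    + apply lsteps_arg. apply H.
    + specialize (IHsims (pre ++ [u'])). rewrite <- !app_assoc in IHsims. exact IHsims.
  - destruct (sims_args_reduce _ _ _ _ H) as [d Hd]. exists d.
    rewrite (zeta_app Rs g us'). apply args_reduce_app; auto.
Qed.

Lemma sim_subst {F} (Rs : trs F) s s' cc q :
  wfG Rs q -> (forall x, In x (tvars q) -> sim Rs (s x) (s' x) (cc x)) ->
  sim Rs (tsubst s q) (tsubst s' q) (sumv cc (tvars q)).
Proof.
  induction q as [x | g qs IH] using term_nested_ind; intros H Hs; simpl.
  - rewrite sumv_cons. unfold sumv; simpl. rewrite Nat.add_0_r. apply Hs; simpl; auto.
  - apply all_syms_inv in H. destruct H as [H1 H2]. apply sim_app; [rewrite length_map; auto |].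
    simpl in Hs. clear H1. induction qs as [| q qs IHq]; simpl; [constructor |].
    inversion IH; inversion H2; subst. rewrite sumv_app. constructor.
    + apply H1; auto. intros; apply Hs. simpl. apply in_app_iff; auto.
    + apply IHq; auto. intros; apply Hs. simpl. apply in_app_iff; auto.
Qed.

Lemma sims_subst {F} (Rs : trs F) s s' cc qs :
  Forall (wfG Rs) qs -> (forall x, In x (lvars qs) -> sim Rs (s x) (s' x) (cc x)) ->
  sims Rs (map (tsubst s) qs) (map (tsubst s') qs) (sumv cc (lvars qs)).
Proof.
  induction 1; simpl; intros Hs; [constructor |]. rewrite sumv_app. constructor.
  - apply sim_subst; auto. intros; apply Hs. apply in_app_iff; auto.
  - apply IHForall. intros; apply Hs. apply in_app_iff; auto.
Qed.

(** [tvars q] lists occurrences, so a repeated variable contributes its debt once per copy. *)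
Lemma subst_reduce {F} (Rs : trs F) s sg d q :
  wfG Rs q -> (forall x, In x (tvars q) -> cs_steps Rs (zeta Rs (s x)) (sg x) (d x)) ->
  cs_steps Rs (zeta Rs (tsubst s q)) (tsubst sg (zeta Rs q)) (sumv d (tvars q)).
Proof.
  induction q as [x | g qs IH] using term_nested_ind; intros H Hs.
  - cbn [tvars]. rewrite sumv_cons. unfold sumv; simpl. rewrite Nat.add_0_r. apply Hs; simpl; auto.
  - apply all_syms_inv in H. destruct H as [H1 H2]. rewrite zeta_app. cbn [tsubst].
    rewrite map_app, tsubst_bits. apply args_reduce_app; [rewrite length_map; auto |].
    cbn [tvars] in *. clear H1. induction qs as [| q qs IHq]; simpl; [constructor |].
    inversion IH; inversion H2; subst. rewrite sumv_app. constructor.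
    + apply H1; auto. intros; apply Hs. simpl. apply in_app_iff; auto.
    + apply IHq; auto. intros; apply Hs. simpl. apply in_app_iff; auto.
Qed.

Lemma args_subst_reduce {F} (Rs : trs F) s sg d qs :
  Forall (wfG Rs) qs -> (forall x, In x (lvars qs) -> cs_steps Rs (zeta Rs (s x)) (sg x) (d x)) ->
  args_reduce Rs (map (tsubst s) qs) (map (tsubst sg) (map (zeta Rs) qs)) (sumv d (lvars qs)).
Proof.
  induction 1; simpl; intros Hs; [constructor |]. rewrite sumv_app. constructor.
  - apply subst_reduce; auto. intros; apply Hs. apply in_app_iff; auto.
  - apply IHForall. intros; apply Hs. apply in_app_iff; auto.
Qed.
(** * Exposing patterns *)

(** At least one step, so that the target is strictly below the source in the order of the
    induction. *)
Definition cs_plus {F} (Rs : trs F) (t t' : term (hsym F)) : Prop :=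
  exists t1 c1 c2, cs_step Rs t t1 c1 /\ cs_steps Rs t1 t' c2.

Lemma cs_plus_steps {F} (Rs : trs F) a b : cs_plus Rs a b -> exists c, cs_steps Rs a b c.
Proof. intros (t & c1 & c2 & H1 & H2). eexists. econstructor; eauto. Qed.

Lemma cs_plus_trans {F} (Rs : trs F) a b c n : cs_plus Rs a b -> cs_steps Rs b c n -> cs_plus Rs a c.
Proof.
  intros (t & c1 & c2 & H1 & H2) H. exists t, c1, (c2 + n). split; auto. eapply cs_steps_trans; eauto.
Qed.

Definition active_arg {F} (Rs : trs F) (t t' : term (hsym F)) : Prop :=
  exists h pre post, t = App h (pre ++ t' :: post) /\ mu Rs h (S (length pre)).

Definition csr {F} (Rs : trs F) (t t' : term (hsym F)) : Prop := exists c, cs_step Rs t t' c.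

(** The order of the main induction. Active arguments are included so that the arguments of a
    labeled term, and the condition being evaluated inside an [HAux] term, lie below it. *)
Definition descends {F} (Rs : trs F) (t t' : term (hsym F)) : Prop :=
  csr Rs t t' \/ active_arg Rs t t'.

Definition descends_star {F} (Rs : trs F) := clos_refl_trans _ (descends Rs).

Lemma cs_steps_descends {F} (Rs : trs F) a b c : cs_steps Rs a b c -> descends_star Rs a b.
Proof.
  induction 1; [apply rt_refl |]. eapply rt_trans; [apply rt_step | eassumption].
  left; eexists; eauto.
Qed.

Lemma active_arg_zeta {F} (Rs : trs F) g us u :
  gsym_ok Rs g (length us) -> In u us -> active_arg Rs (zeta Rs (App g us)) (zeta Rs u).
Proof.
  intros Hg Hu. apply gsym_ok_arity in Hg. apply in_split in Hu. destruct Hu as (l1 & l2 & ->).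
  exists (HF (erase_sym g)), (map (zeta Rs) l1), (map (zeta Rs) l2 ++ bits g). split.
  - rewrite zeta_app, map_app. simpl. rewrite <- app_assoc. reflexivity.
  - simpl. rewrite length_app in Hg. simpl in Hg. rewrite length_map. lia.
Qed.

Definition head_exposed {F} (Rs : trs F) s t N : Prop :=
  forall f ts, t = App (HF f) ts ->
  exists g us ts1 c d, sim Rs s (App g us) c /\ erase_sym g = f /\ ts = ts1 ++ bits g /\
    args_reduce Rs us ts1 d /\ N <= c + d.

Definition cost_reached {F} (Rs : trs F) s N : Prop := exists s' c, sim Rs s s' c /\ N <= c.

Definition normal {F} (Rs : trs F) t : Prop := forall t' c, ~ cs_step Rs t t' c.

(** The three conjuncts serve different purposes: the first lets a pattern be matched, the second
    excludes normal forms stuck in a condition, and the third lets a debt be paid. *)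
Definition tame {F} (Rs : trs F) (s : term (gsym F)) : Prop :=
  forall t N, cs_steps Rs (zeta Rs s) t N ->
    head_exposed Rs s t N /\ (normal Rs t -> exists f ts, t = App (HF f) ts) /\ cost_reached Rs s N.

(** Quantifying over everything below [zeta s] makes the property pass to simulated reducts and to
    arguments, as is needed when a pattern is matched level by level. *)
Definition hered_tame {F} (Rs : trs F) (s : term (gsym F)) : Prop :=
  ground_ok Rs s /\
  forall s', ground_ok Rs s' -> descends_star Rs (zeta Rs s) (zeta Rs s') -> tame Rs s'.

Lemma hered_tame_tame {F} (Rs : trs F) s : hered_tame Rs s -> tame Rs s.
Proof. intros [H1 H2]. apply H2; auto. apply rt_refl. Qed.

Lemma hered_tame_descends {F} (Rs : trs F) s s' :
  hered_tame Rs s -> ground_ok Rs s' -> descends_star Rs (zeta Rs s) (zeta Rs s') -> hered_tame Rs s'.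
Proof.
  intros [H1 H2] H3 H4. split; auto. intros s2 H5 H6. apply H2; auto. eapply rt_trans; eauto.
Qed.

Lemma hered_tame_sim {F} (Rs : trs F) s s' c : hered_tame Rs s -> sim Rs s s' c -> hered_tame Rs s'.
Proof.
  intros H (_ & H1 & _ & c' & H2). eapply hered_tame_descends; eauto. eapply cs_steps_descends; eauto.
Qed.

Lemma hered_tame_args {F} (Rs : trs F) g us : hered_tame Rs (App g us) -> Forall (hered_tame Rs) us.
Proof.
  intros H. destruct (ground_ok_inv _ _ _ (proj1 H)) as [H1 H2].
  apply Forall_forall. intros u Hu. eapply hered_tame_descends; eauto.
  - rewrite Forall_forall in H2; auto.
  - apply rt_step. right. apply active_arg_zeta; auto.
Qed.

(* [s x] still has to pay the cost [d x] of reducing it to [sg x]. *)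
Definition owes {F} (Rs : trs F) s sg (d : nat -> nat) x : Prop :=
  hered_tame Rs (s x) /\ cs_steps Rs (zeta Rs (s x)) (sg x) (d x).

(** Carries a match back from the transformed side to the labeled side. The cost of reaching the
    instance is divided into [c], spent on making [q] visible, and the debts left at its
    variables. *)
Definition exposable {F} (Rs : trs F) q : Prop :=
  forall u sg N, hered_tame Rs u -> cs_steps Rs (zeta Rs u) (tsubst sg (zeta Rs q)) N ->
  exists s d c, sim Rs u (tsubst s q) c /\ (forall x, In x (tvars q) -> owes Rs s sg d x) /\
    N <= c + sumv d (tvars q).

Lemma args_reduce_cons_inv {F} (Rs : trs F) us t ts n :
  args_reduce Rs us (t :: ts) n ->
  exists u us' d d', us = u :: us' /\ n = d + d' /\
    cs_steps Rs (zeta Rs u) t d /\ args_reduce Rs us' ts d'.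
Proof. intros H; inversion H; subst. repeat eexists; eauto. Qed.

Lemma args_reduce_nil_inv {F} (Rs : trs F) us n : args_reduce Rs us [] n -> us = [] /\ n = 0.
Proof. intros H; inversion H; auto. Qed.

Lemma expose_args {F} (Rs : trs F) qs us sg d0 :
  Forall (exposable Rs) qs -> NoDup (lvars qs) -> Forall (hered_tame Rs) us ->
  args_reduce Rs us (map (tsubst sg) (map (zeta Rs) qs)) d0 ->
  exists s d c, sims Rs us (map (tsubst s) qs) c /\
    (forall x, In x (lvars qs) -> owes Rs s sg d x) /\ d0 <= c + sumv d (lvars qs).
Proof.
  intros Hqs. revert us d0. induction Hqs as [| q qs Hq Hqs IHq]; intros us d0 Hl Hu Hred; simpl in Hred.
  - apply args_reduce_nil_inv in Hred. destruct Hred as [-> ->].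
    exists (fun _ => Var 0), (fun _ => 0), 0. split; [constructor |]. split; [simpl; tauto | lia].
  - apply args_reduce_cons_inv in Hred. destruct Hred as (u & us' & n1 & n2 & -> & -> & R1 & R2).
    apply Forall_cons_iff in Hu. simpl in Hl.
    apply NoDup_app_inv in Hl. destruct Hl as (Hl1 & Hl2 & Hl3).
    destruct (IHq _ _ Hl2 (proj2 Hu) R2) as (s2 & d2 & c2 & A1 & A2 & A3).
    destruct (Hq _ _ _ (proj1 Hu) R1) as (s1 & d1 & c1 & B1 & B2 & B3).
    (* By linearity [q] shares no variables with [qs], so both substitutions survive the gluing, and
       so do both debt functions. *)
    exists (override (tvars q) s1 s2), (override (tvars q) d1 d2), (c1 + c2).
    split; [| split].
    + simpl. constructor.
      * erewrite tsubst_ext; [eassumption |]. intros; apply override_in; auto.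
      * erewrite map_tsubst_ext; [eassumption |]. intros x Hx. apply override_out.
        intros Hx'; apply (Hl3 x); auto.
    + simpl. intros x Hx. unfold owes, override. destruct (in_dec Nat.eq_dec x (tvars q)).
      * apply B2; auto.
      * apply A2. apply in_app_iff in Hx. destruct Hx; tauto.
    + simpl. rewrite sumv_app.
      rewrite (sumv_ext (override (tvars q) d1 d2) d1) by (intros; apply override_in; auto).
      rewrite (sumv_ext _ d2 (flat_map tvars qs)).
      * unfold lvars in A3. lia.
      * intros x Hx. apply override_out. intros Hx'; apply (Hl3 x); auto.
Qed.

Lemma linear_of_lvars {S} (ts : list (term S)) t : NoDup (lvars ts) -> In t ts -> linear t.
Proof.
  induction ts; [simpl; tauto |]. simpl. intros H [-> | Ht]; apply NoDup_app_inv in H; destruct H as (? & ? & _); auto.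
Qed.

(** At a variable the whole reduction becomes its debt. At a symbol, tameness exposes a head; its
    erasure and bits agree with those of the pattern, which forces the same labeled symbol, and the
    arguments follow recursively. *)
Lemma wfG_exposable {F} (Rs : trs F) q : wfG Rs q -> linear q -> exposable Rs q.
Proof.
  induction q as [x | g qs IH] using term_nested_ind; intros Hq Hl u sg N Hu HN.
  - exists (fun _ => u), (fun _ => N), 0. split; [apply sim_refl, Hu |]. split.
    + simpl. intros y [<- | []]. split; auto.
    + unfold sumv; simpl; lia.
  - rewrite zeta_app in HN. cbn [tsubst] in HN. rewrite map_app, tsubst_bits in HN.
    apply all_syms_inv in Hq. destruct Hq as [Hg Hqs].
    destruct (proj1 (hered_tame_tame _ _ Hu _ _ HN) _ _ eq_refl)
      as (g' & us & ts1 & c0 & d0 & Hsim & Hf & Hts & Hred & HN').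
    assert (Hu' := hered_tame_sim _ _ _ _ Hu Hsim).
    destruct (ground_ok_inv _ _ _ (proj1 Hu')) as [Hg' _].
    assert (L : length (map (tsubst sg) (map (zeta Rs) qs)) = length ts1).
    { rewrite <- (args_reduce_length _ _ _ _ Hred), !length_map.
      apply gsym_ok_arity in Hg'. rewrite Hg', Hf. apply (gsym_ok_arity Rs g); auto. }
    apply app_inj_length in Hts; auto. destruct Hts as [<- Hb].
    assert (g' = g) by (eapply gsym_eq; eauto). subst g'.
    apply hered_tame_args in Hu'.
    destruct (expose_args Rs qs us sg d0) as (s & d & c & H1 & H2 & H3); auto.
    { rewrite Forall_forall in *. intros q Hq. apply IH; auto. apply Hqs; auto.
      eapply linear_of_lvars; eauto. }
    exists s, d, (c0 + c). split; [| split; auto].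
    + eapply sim_trans; eauto. simpl. apply sim_app; auto.
    + cbn [tvars]. fold (lvars qs). lia.
Qed.

Lemma expose_patterns {F} (Rs : trs F) qs us sg d0 :
  Forall (wfG Rs) qs -> NoDup (lvars qs) -> Forall (hered_tame Rs) us ->
  args_reduce Rs us (map (tsubst sg) (map (zeta Rs) qs)) d0 ->
  exists s d c, sims Rs us (map (tsubst s) qs) c /\
    (forall x, In x (lvars qs) -> owes Rs s sg d x) /\ d0 <= c + sumv d (lvars qs).
Proof.
  intros H Hl. apply expose_args; auto. rewrite Forall_forall in *. intros q Hq.
  apply wfG_exposable; [auto | eapply linear_of_lvars; eauto].
Qed.
(** * Instances of the transformed rules *)

Lemma in_skipn {A} (x : A) n l : In x (skipn n l) -> In x l.
Proof. intros H. rewrite <- (firstn_skipn n l). apply in_app_iff; auto. Qed.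

Lemma in_firstn {A} (x : A) n l : In x (firstn n l) -> In x l.
Proof. intros H. rewrite <- (firstn_skipn n l). apply in_app_iff; auto. Qed.

Lemma firstn_snoc {A} (l : list A) n x :
  nth_error l n = Some x -> firstn n l ++ [x] = firstn (S n) l.
Proof.
  revert n; induction l; destruct n; simpl; intros H; try discriminate.
  - injection H; intros ->; auto.
  - f_equal; auto.
Qed.

Lemma lvars_app {S} (l1 l2 : list (term S)) : lvars (l1 ++ l2) = lvars l1 ++ lvars l2.
Proof. apply flat_map_app. Qed.

Lemma lvars_Var {S} xs : lvars (map (@Var S) xs) = xs.
Proof. induction xs; simpl; f_equal; auto. Qed.

Lemma lvars_repl_Var {S} ys j (q : term S) :
  lvars (repl (map Var ys) j [q]) = firstn (j - 1) ys ++ tvars q ++ skipn j ys.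
Proof.
  unfold repl. rewrite !lvars_app, firstn_map, skipn_map, !lvars_Var. simpl.
  rewrite app_nil_r. reflexivity.
Qed.

Lemma NoDup_hole {A} (ys vs : list A) j :
  1 <= j -> NoDup ys -> NoDup vs -> (forall x, In x ys -> ~ In x vs) ->
  NoDup (firstn (j - 1) ys ++ vs ++ skipn j ys).
Proof.
  intros Hj H1 H2 H3.
  assert (E1 := H1). rewrite <- (firstn_skipn (j - 1) ys) in E1. apply NoDup_app_inv in E1.
  assert (E2 := H1). rewrite <- (firstn_skipn j ys) in E2. apply NoDup_app_inv in E2.
  destruct E1 as (E1 & _ & E3), E2 as (_ & E2 & _).
  apply NoDup_app_intro; auto.
  - apply NoDup_app_intro; auto. intros x Hx Hx'. apply (H3 x); auto. eapply in_skipn; eauto.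
  - intros x Hx Hx'. apply in_app_iff in Hx'. destruct Hx' as [Hx' | Hx'].
    + apply (H3 x); auto. eapply in_firstn; eauto.
    + apply (E3 x Hx). replace j with (1 + (j - 1)) in Hx' by lia.
      rewrite <- skipn_skipn in Hx'. eapply in_skipn; eauto.
Qed.

(** Presents an arbitrary argument list as an instance of fresh variables, as is needed to recognise
    concrete terms as instances of transformed rules. *)
Lemma fresh_variables {S} (V : list nat) (hs : list (term S)) :
  exists xs g, length xs = length hs /\ NoDup xs /\ disjoint xs V /\ map g xs = hs.
Proof.
  set (M := list_max V).
  exists (seq (1 + M) (length hs)), (fun x => nth (x - (1 + M)) hs (Var 0)).
  split; [apply length_seq |]. split; [apply seq_NoDup |]. split.
  - intros x Hx Hx'. apply in_seq in Hx.
    assert (Forall (fun k => k <= M) V) by (apply list_max_le; unfold M; lia).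
    rewrite Forall_forall in H. specialize (H x Hx'). lia.
  - apply nth_ext with (Var 0) (Var 0); rewrite length_map, length_seq; auto.
    (* The index is in range, so the default is free; it is chosen as the image of [0] to fit
       [map_nth]. *)
    intros n Hn. rewrite nth_indep with (d' := nth (0 - (1 + M)) hs (Var 0))
      by (rewrite length_map, length_seq; auto).
    rewrite (map_nth (fun x => nth (x - (1 + M)) hs (Var 0)) _ 0 n), seq_nth by auto.
    f_equal. lia.
Qed.

Lemma in_rvars_lhs {F} (rho : rule F) x : In x (lvars (r_lhs rho)) -> In x (rvars rho).
Proof. intros; apply in_app_iff; auto. Qed.

Lemma in_rvars_rhs {F} (rho : rule F) x : In x (tvars (r_rhs rho)) -> In x (rvars rho).
Proof. intros; apply in_app_iff; right; apply in_app_iff; auto. Qed.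

Lemma in_rvars_cond {F} (rho : rule F) a b x :
  In (a, b) (r_conds rho) -> In x (tvars a) \/ In x (tvars b) -> In x (rvars rho).
Proof.
  intros; apply in_app_iff; right; apply in_app_iff; left. apply in_flat_map.
  exists (a, b); split; auto. apply in_app_iff; auto.
Qed.

Lemma in_rvars_conds_snd {F} (rho : rule F) x :
  In x (lvars (map snd (r_conds rho))) -> In x (rvars rho).
Proof.
  intros H. apply in_flat_map in H. destruct H as (t & Ht & Hx). apply in_map_iff in Ht.
  destruct Ht as ([a b] & <- & Hab). eapply in_rvars_cond; eauto.
Qed.

Lemma lvars_Lh {F} (Rs : trs F) rho : lvars (Lh Rs rho) = lvars (r_lhs rho).
Proof. apply lvars_map. intros; apply tvars_xi. Qed.

Lemma lvars_Bh {F} (Rs : trs F) rho : lvars (Bh Rs rho) = lvars (map snd (r_conds rho)).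
Proof. unfold Bh. rewrite <- (map_map snd (xi Rs HTop)). apply lvars_map. intros; apply tvars_xi. Qed.

Lemma nth_Bh {F} (Rs : trs F) rho j a b :
  nth_error (r_conds rho) j = Some (a, b) -> nth_error (Bh Rs rho) j = Some (xi Rs HTop b).
Proof. intros H. unfold Bh. rewrite nth_error_map, H. reflexivity. Qed.

Definition rule_at {F} (Rs : trs F) f i rho : Prop :=
  1 <= i /\ nth_error (rules Rs f) (i - 1) = Some rho.

Lemma cs_step_rule {F} (Rs : trs F) sg l r t t' c :
  XiRule Rs l r c -> t = tsubst sg l -> t' = tsubst sg r -> cs_step Rs t t' c.
Proof. intros H -> ->. constructor; auto. Qed.

(* The argument list of [f_i^(j+1)], with the result [w] of the pending condition. *)
Definition aux_args {F} (Rs : trs F) rho hs i sg j w : list (term (hsym F)) :=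
  map (tsubst sg) (Lh Rs rho) ++ repl hs i (firstn j (map (tsubst sg) (Bh Rs rho)) ++ [w]).

Lemma aux_args_ext {F} (Rs : trs F) rho hs i s1 s2 j w :
  (forall x, In x (lvars (r_lhs rho) ++ lvars (map snd (firstn j (r_conds rho)))) -> s1 x = s2 x) ->
  aux_args Rs rho hs i s1 j w = aux_args Rs rho hs i s2 j w.
Proof.
  intros H. unfold aux_args. f_equal; [| do 2 f_equal].
  - apply map_tsubst_ext. intros x Hx. rewrite lvars_Lh in Hx. apply H, in_app_iff; auto.
  - rewrite !firstn_map. apply map_tsubst_ext. intros x Hx. apply H, in_app_iff; right.
    unfold Bh in Hx. rewrite firstn_map, <- (map_map snd (xi Rs HTop)) in Hx.
    rewrite (lvars_map (xi Rs HTop)) in Hx; auto. intros; apply tvars_xi.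
Qed.

Section RuleInstances.
Context {F : Type} (Rs : trs F) (f : F) (i : nat) (rho : rule F) (hs : list (term (hsym F))).
Context (Hrho : rule_at Rs f i rho) (Hhs : length hs = msz Rs f).

Lemma rule_at_le : i <= length hs.
Proof using Hrho Hhs.
  destruct Hrho as [H1 H2]. rewrite Hhs. unfold msz.
  assert (i - 1 < length (rules Rs f)) by (apply nth_error_Some; congruence). lia.
Qed.

Lemma tsubst_repl_Var xs (g sg : nat -> term (hsym F)) L :
  map g xs = hs -> (forall x, In x xs -> sg x = g x) ->
  map (tsubst sg) (repl (map Var xs) i L) = repl hs i (map (tsubst sg) L).
Proof.
  intros <- H. rewrite map_repl, map_map. f_equal. apply map_ext_in. intros; simpl; auto.
Qed.

(** [V] holds further variables whose values must be preserved, namely those of a failure pattern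
    and of the argument slots around it. *)
Lemma fresh_instance (V : list nat) sg :
  exists xs sg', length xs = msz Rs f /\ NoDup xs /\ disjoint xs (rvars rho ++ V) /\
    (forall L, map (tsubst sg') (repl (map Var xs) i L) = repl hs i (map (tsubst sg') L)) /\
    (forall x, In x (rvars rho ++ V) -> sg' x = sg x).
Proof using Hhs.
  destruct (fresh_variables (rvars rho ++ V) hs) as (xs & g & H1 & H2 & H3 & H4).
  exists xs, (override xs g sg). rewrite <- Hhs. repeat split; auto.
  - intros L. apply tsubst_repl_Var with g; auto. intros; apply override_in; auto.
  - intros x Hx. apply override_out. intros Hx'. apply (H3 x); auto.
Qed.

Lemma Lh_ext s1 s2 :
  (forall x, In x (rvars rho) -> s1 x = s2 x) -> map (tsubst s1) (Lh Rs rho) = map (tsubst s2) (Lh Rs rho).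
Proof.
  intros H. apply map_tsubst_ext. intros x Hx. rewrite lvars_Lh in Hx. apply H, in_rvars_lhs; auto.
Qed.

Lemma Bh_ext s1 s2 :
  (forall x, In x (rvars rho) -> s1 x = s2 x) -> map (tsubst s1) (Bh Rs rho) = map (tsubst s2) (Bh Rs rho).
Proof.
  intros H. apply map_tsubst_ext. intros x Hx. rewrite lvars_Bh in Hx. apply H, in_rvars_conds_snd; auto.
Qed.

Lemma xi_ext s1 s2 t :
  (forall x, In x (rvars rho) -> s1 x = s2 x) -> incl (tvars t) (rvars rho) ->
  tsubst s1 (xi Rs HTop t) = tsubst s2 (xi Rs HTop t).
Proof. intros H Ht. apply tsubst_ext. intros x Hx. rewrite tvars_xi in Hx. apply H, Ht; auto. Qed.

Lemma incl_cond_fst j a b :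
  nth_error (r_conds rho) j = Some (a, b) -> incl (tvars a) (rvars rho).
Proof. intros H x Hx. apply nth_error_In in H. eapply in_rvars_cond; eauto. Qed.

Lemma step_plain sg :
  nth_error hs (i - 1) = Some (hc HTop) -> r_conds rho = [] ->
  cs_step Rs (App (HF f) (map (tsubst sg) (Lh Rs rho) ++ hs)) (tsubst sg (xi Rs HTop (r_rhs rho))) 1.
Proof using Hrho Hhs.
  intros Ht Hk. destruct (fresh_instance [] sg) as (xs & sg' & X1 & X2 & X3 & X4 & X5).
  rewrite app_nil_r in X3, X5. destruct Hrho.
  eapply cs_step_rule with (sg := sg'); [eapply xi_1; eauto | |].
  - cbn [tsubst]. rewrite map_app, X4. simpl. rewrite (repl_self hs), (Lh_ext sg' sg); auto.
  - apply xi_ext; [intros; symmetry; auto |]. intros x; apply in_rvars_rhs.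
Qed.

Lemma step_start sg a b :
  nth_error hs (i - 1) = Some (hc HTop) -> nth_error (r_conds rho) 0 = Some (a, b) ->
  cs_step Rs (App (HF f) (map (tsubst sg) (Lh Rs rho) ++ hs))
    (App (HAux f i 1) (aux_args Rs rho hs i sg 0 (tsubst sg (xi Rs HTop a)))) 0.
Proof using Hrho Hhs.
  intros Ht Hk. destruct (fresh_instance [] sg) as (xs & sg' & X1 & X2 & X3 & X4 & X5).
  rewrite app_nil_r in X3, X5. destruct Hrho. assert (Ha := incl_cond_fst _ _ _ Hk).
  destruct (r_conds rho) as [| ab cs] eqn:E; [discriminate |]. injection Hk; intros ->.
  eapply cs_step_rule with (sg := sg'); [eapply xi_2; eauto | |].
  - cbn [tsubst]. rewrite map_app, X4. simpl. rewrite (repl_self hs), (Lh_ext sg' sg); auto.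
  - cbn [tsubst]. rewrite map_app, X4. unfold aux_args. rewrite (Lh_ext sg' sg) by auto.
    do 2 f_equal. simpl. do 2 f_equal. apply xi_ext; [intros; symmetry; auto | auto].
Qed.

Lemma step_finish sg j a b :
  nth_error (r_conds rho) j = Some (a, b) -> length (r_conds rho) = S j ->
  cs_step Rs (App (HAux f i (S j)) (aux_args Rs rho hs i sg j (tsubst sg (xi Rs HTop b))))
    (tsubst sg (xi Rs HTop (r_rhs rho))) 1.
Proof using Hrho Hhs.
  intros Hj Hk. destruct (fresh_instance [] sg) as (xs & sg' & X1 & X2 & X3 & X4 & X5).
  rewrite app_nil_r in X3, X5. destruct Hrho. rewrite <- Hk.
  eapply cs_step_rule with (sg := sg'); [eapply xi_3; eauto | |].
  - intros E; rewrite E in Hk; discriminate.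
  - cbn [tsubst]. rewrite map_app, X4. unfold aux_args. rewrite (Lh_ext sg' sg), (Bh_ext sg' sg) by auto.
    do 3 f_equal. erewrite firstn_snoc.
    + rewrite firstn_all2; auto. rewrite length_map. unfold Bh. rewrite length_map. lia.
    + rewrite nth_error_map, (nth_Bh Rs _ _ _ _ Hj). reflexivity.
  - apply xi_ext; [intros; symmetry; auto |]. intros x; apply in_rvars_rhs.
Qed.

Lemma step_next sg j a b a' b' :
  nth_error (r_conds rho) j = Some (a, b) -> nth_error (r_conds rho) (S j) = Some (a', b') ->
  cs_step Rs (App (HAux f i (S j)) (aux_args Rs rho hs i sg j (tsubst sg (xi Rs HTop b))))
    (App (HAux f i (S (S j))) (aux_args Rs rho hs i sg (S j) (tsubst sg (xi Rs HTop a')))) 0.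
Proof using Hrho Hhs.
  intros Hj Hj'. destruct (fresh_instance [] sg) as (xs & sg' & X1 & X2 & X3 & X4 & X5).
  rewrite app_nil_r in X3, X5. destruct Hrho.
  assert (S j < length (r_conds rho)) by (apply nth_error_Some; congruence).
  eapply cs_step_rule with (sg := sg'); [eapply xi_4 with (j := S j); eauto; lia | |].
  - cbn [tsubst]. rewrite map_app, X4. unfold aux_args. rewrite (Lh_ext sg' sg) by auto.
    rewrite <- firstn_map, (Bh_ext sg' sg) by auto.
    do 3 f_equal. apply firstn_snoc. rewrite nth_error_map, (nth_Bh Rs _ _ _ _ Hj). reflexivity.
  - cbn [tsubst]. rewrite map_app, X4. unfold aux_args. rewrite (Lh_ext sg' sg) by auto.
    rewrite map_app, <- firstn_map, (Bh_ext sg' sg) by auto. cbn [map].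
    do 4 f_equal. f_equal. apply xi_ext; [intros; symmetry; auto |]. eapply incl_cond_fst; eauto.
Qed.

Lemma step_fail sg ta j a b v :
  nth_error (r_conds rho) j = Some (a, b) -> AP Rs b v -> NoDup (tvars v) ->
  disjoint (tvars v) (rvars rho) ->
  cs_step Rs (App (HAux f i (S j)) (aux_args Rs rho hs i sg j (tsubst ta v)))
    (App (HF f) (map (tsubst sg) (Lh Rs rho) ++ repl hs i [hc HBot])) 0.
Proof using Hrho Hhs.
  intros Hj Hv Nv Dv.
  (* [ta] instantiates the pattern and [sg] the rule; [Dv] keeps their variables apart, so one
     substitution does both. *)
  destruct (fresh_instance (tvars v) (override (tvars v) ta sg)) as (xs & sg' & X1 & X2 & X3 & X4 & X5).
  destruct Hrho.
  assert (S j <= length (r_conds rho)) by (apply nth_error_Some; congruence).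
  assert (Hr : forall x, In x (rvars rho) -> sg' x = sg x).
  { intros x Hx. rewrite X5 by (apply in_app_iff; auto). apply override_out.
    intros Hx'. apply (Dv x); auto. }
  eapply cs_step_rule with (sg := sg'); [eapply xi_5 with (j := S j) (xs := xs) (v := v); eauto; try lia | |].
  - simpl. rewrite Nat.sub_0_r. exact Hj.
  - apply NoDup_app_intro; auto. intros x Hx Hx'. apply (X3 x Hx). apply in_app_iff; auto.
  - intros x Hx Hx'. apply in_app_iff in Hx. destruct Hx as [Hx | Hx].
    + apply (X3 x Hx). apply in_app_iff; auto.
    + apply (Dv x); auto.
  - cbn [tsubst]. rewrite map_app, X4. unfold aux_args. rewrite (Lh_ext sg' sg) by auto.
    rewrite map_app, <- firstn_map, (Bh_ext sg' sg) by auto. simpl (S j - 1). rewrite Nat.sub_0_r. cbn [map].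
    do 4 f_equal. f_equal. apply tsubst_ext. intros x Hx. rewrite X5 by (apply in_app_iff; auto).
    symmetry. apply override_in; auto.
  - cbn [tsubst]. rewrite map_app, X4. rewrite (Lh_ext sg' sg) by auto. reflexivity.
Qed.

Lemma step_bot ta ts j l v :
  nth_error hs (i - 1) = Some (hc HTop) ->
  1 <= j -> nth_error (r_lhs rho) (j - 1) = Some l -> AP Rs l v -> NoDup (tvars v) ->
  disjoint (tvars v) (rvars rho) -> length ts = ar Rs f -> nth_error ts (j - 1) = Some (tsubst ta v) ->
  cs_step Rs (App (HF f) (ts ++ hs)) (App (HF f) (ts ++ repl hs i [hc HBot])) 0.
Proof using Hrho Hhs.
  intros Ht Hj Hl Hv Nv Dv Hts Htj.
  destruct (fresh_variables (rvars rho ++ tvars v) ts) as (ys & g & Y1 & Y2 & Y3 & Y4).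
  destruct (fresh_instance (tvars v ++ ys) (override (tvars v) ta g)) as (xs & sg' & X1 & X2 & X3 & X4 & X5).
  destruct Hrho.
  assert (E : map (tsubst sg') (repl (map Var ys) j [v]) = ts).
  { rewrite map_repl, map_map. simpl.
    replace (tsubst sg' v) with (tsubst ta v).
    - replace (map (fun x => sg' x) ys) with ts; [apply repl_self; auto |].
      rewrite <- Y4. apply map_ext_in. intros y Hy. rewrite X5 by (rewrite !in_app_iff; auto).
      symmetry. apply override_out. intros Hy'. apply (Y3 y Hy). apply in_app_iff; auto.
    - apply tsubst_ext. intros x Hx. rewrite X5 by (rewrite !in_app_iff; auto).
      symmetry. apply override_in; auto. }
  eapply cs_step_rule with (sg := sg');
    [eapply xi_6 with (j := j) (xs := xs) (ys := ys) (v := v) (i := i); eauto; try lia | |].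
  - apply NoDup_app_intro; auto.
    + apply NoDup_app_intro; auto. intros x Hx Hx'. apply (Y3 x Hx), in_app_iff; auto.
    + intros x Hx Hx'. apply (X3 x Hx). rewrite !in_app_iff in *. tauto.
  - intros x Hx Hx'. rewrite !in_app_iff in Hx. destruct Hx as [Hx | [Hx | Hx]].
    + apply (X3 x Hx), in_app_iff; auto.
    + apply (Y3 x Hx), in_app_iff; auto.
    + apply (Dv x); auto.
  - cbn [tsubst]. rewrite map_app, E, X4. simpl. rewrite (repl_self hs); auto.
  - cbn [tsubst]. rewrite map_app, E, X4. reflexivity.
Qed.

(** The offset [ar Rs f + (i - 1) + j] is that of the only active argument of [HAux f i (S j)],
    whose 1-based index is [ar Rs f + i + S j - 1]. *)
Lemma aux_args_split sg j :
  j <= length (r_conds rho) -> length (r_lhs rho) = ar Rs f ->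
  exists pre post, length pre = ar Rs f + (i - 1) + j /\
    forall w', aux_args Rs rho hs i sg j w' = pre ++ w' :: post.
Proof using Hrho Hhs.
  intros Hj Hl. assert (Hi := rule_at_le).
  exists (map (tsubst sg) (Lh Rs rho) ++ firstn (i - 1) hs ++ firstn j (map (tsubst sg) (Bh Rs rho))), (skipn i hs).
  split.
  - rewrite !length_app, !length_firstn, !length_map. unfold Lh, Bh. rewrite !length_map. lia.
  - intros w'. unfold aux_args, repl. rewrite <- !app_assoc. reflexivity.
Qed.

Lemma aux_args_steps sg j w w' c :
  j <= length (r_conds rho) -> length (r_lhs rho) = ar Rs f -> cs_steps Rs w w' c ->
  cs_steps Rs (App (HAux f i (S j)) (aux_args Rs rho hs i sg j w))
    (App (HAux f i (S j)) (aux_args Rs rho hs i sg j w')) c.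
Proof using Hrho Hhs.
  intros Hj Hl H. destruct (aux_args_split sg j Hj Hl) as (pre & post & L & E).
  rewrite !E. apply cs_steps_arg; auto. simpl. destruct Hrho. lia.
Qed.

(** Each condition is evaluated in the active slot before [step_next] moves on. The opening
    [step_start] is always present, so the reduction is nonempty even for [j = 0]. *)
Lemma condition_reached sg j a b :
  nth_error hs (i - 1) = Some (hc HTop) -> length (r_lhs rho) = ar Rs f ->
  Forall (fun ab => exists c, cs_steps Rs (tsubst sg (xi Rs HTop (fst ab))) (tsubst sg (xi Rs HTop (snd ab))) c)
    (firstn j (r_conds rho)) ->
  nth_error (r_conds rho) j = Some (a, b) ->
  cs_plus Rs (App (HF f) (map (tsubst sg) (Lh Rs rho) ++ hs))
    (App (HAux f i (S j)) (aux_args Rs rho hs i sg j (tsubst sg (xi Rs HTop a)))).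
Proof using Hrho Hhs.
  intros Ht Hl. revert a b. induction j; intros a b HF Hj.
  - eexists _, _, _. split; [eapply step_start; eauto | apply css_refl].
  - destruct (nth_error (r_conds rho) j) as [[a' b'] |] eqn:E.
    2:{ apply nth_error_None in E. assert (S j < length (r_conds rho)) by (apply nth_error_Some; congruence). lia. }
    rewrite <- (firstn_snoc _ _ _ E) in HF. apply Forall_app in HF. destruct HF as [H1 H2].
    apply Forall_cons_iff in H2. destruct H2 as [[c H2] _]. simpl in H2.
    eapply cs_plus_trans; [eapply cs_plus_trans; [eapply IHj; eauto |] |].
    + apply aux_args_steps; auto; [| eassumption].
      assert (S j < length (r_conds rho)) by (apply nth_error_Some; congruence). lia.
    + eapply cs_steps_one. eapply step_next; eauto.
Qed.

Lemma rhs_reached sg :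
  nth_error hs (i - 1) = Some (hc HTop) -> length (r_lhs rho) = ar Rs f ->
  Forall (fun ab => exists c, cs_steps Rs (tsubst sg (xi Rs HTop (fst ab))) (tsubst sg (xi Rs HTop (snd ab))) c)
    (r_conds rho) ->
  cs_plus Rs (App (HF f) (map (tsubst sg) (Lh Rs rho) ++ hs)) (tsubst sg (xi Rs HTop (r_rhs rho))).
Proof using Hrho Hhs.
  intros Ht Hl HF. destruct (length (r_conds rho)) as [| j] eqn:E.
  - eexists _, _, _. split; [eapply step_plain; eauto; apply length_zero_iff_nil; auto | apply css_refl].
  - destruct (nth_error (r_conds rho) j) as [[a' b'] |] eqn:E1.
    2:{ apply nth_error_None in E1. lia. }
    assert (H2 := proj1 (Forall_forall _ _) HF _ (nth_error_In _ _ E1)). destruct H2 as [c H2]. simpl in H2.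
    eapply cs_plus_trans; [eapply cs_plus_trans; [eapply (condition_reached sg j); eauto |] |].
    + rewrite <- (firstn_skipn j (r_conds rho)) in HF. apply Forall_app in HF. tauto.
    + apply aux_args_steps; auto; [lia | eassumption].
    + eapply cs_steps_one. eapply step_finish; eauto.
Qed.
End RuleInstances.

(** The blocks of [HBot] decode to empty labels, so the pattern is the image of a labeled normal
    form. Along the path followed by [ap_arg] two different symbols finally meet; in the case
    [ap_def] they differ because the symbols of [b] are constructors. This clash survives
    erasure. *)
Lemma AP_labeled {F} (Rs : trs F) b v :
  AP Rs b v -> wfF Rs b -> con_term Rs b ->
  exists q, wfG Rs q /\ labeled_nf q /\ zeta Rs q = v /\ ~ unifiable (erase q) b.
Proof.
  induction 1 as [f ts g xs Hg Hne Hx | f ts g xs Hg Hx | f ts i ti u xs Hi Hti Hu IH Hx]; intros Hw Hc.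
  - exists (App (GCon g) (map Var xs)). split; [| split; [| split]].
    + constructor; [rewrite length_map; auto |]. apply Forall_map, Forall_forall. constructor.
    + constructor; auto. apply Forall_map, Forall_forall. constructor.
    + simpl. f_equal. rewrite map_map. reflexivity.
    + intros [th E]. injection E; intros; auto.
  - exists (App (GLab g (repeat false (msz Rs g))) (map Var xs)). split; [| split; [| split]].
    + constructor; [rewrite length_map, repeat_length; auto |]. apply Forall_map, Forall_forall. constructor.
    + constructor; [| apply Forall_map, Forall_forall; constructor].
      apply Forall_forall. intros x Hx'. apply repeat_spec in Hx'. auto.
    + simpl. rewrite map_map, map_repeat. reflexivity.
    + intros [th E]. injection E; intros _ <-. apply all_syms_inv in Hc. unfold defined, constructor in *. tauto.
  - apply all_syms_inv in Hw, Hc. destruct Hw as [Hw1 Hw2], Hc as [Hc1 Hc2].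
    assert (Hin := nth_error_In _ _ Hti).
    rewrite Forall_forall in Hw2, Hc2. destruct (IH (Hw2 _ Hin) (Hc2 _ Hin)) as (q & Q1 & Q2 & Q3 & Q4).
    assert (Hlt : i - 1 < length ts) by (apply nth_error_Some; congruence).
    exists (App (GCon f) (repl (map Var xs) i [q])).
    assert (HV : forall P : term (gsym F) -> Prop, (forall x, P (Var x)) -> P q -> Forall P (repl (map Var xs) i [q])).
    { intros P HP Pq. unfold repl. rewrite !Forall_app, firstn_map, skipn_map, !Forall_map.
      split; [apply Forall_forall; auto |]. split; [constructor; auto | apply Forall_forall; auto]. }
    split; [| split; [| split]].
    + constructor; [split; auto; rewrite length_repl1 by (rewrite ?length_map; lia); rewrite length_map; lia |].
      apply HV; auto. constructor.
    + constructor; auto. apply HV; auto. constructor.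
    + simpl. f_equal. rewrite map_repl, map_map. simpl. rewrite Q3. reflexivity.
    + intros [th E]. apply Q4. exists th. unfold erase in E. cbn [tmap tsubst] in E. injection E; intros E1.
      apply (f_equal (fun l => nth_error l (i - 1))) in E1.
      rewrite !map_repl, (nth_error_map (tsubst th) (i - 1) ts), Hti in E1. unfold repl in E1.
      rewrite nth_error_app2 in E1; rewrite length_firstn, !length_map in *; [| lia].
      replace (i - 1 - Nat.min (i - 1) (length xs)) with 0 in E1 by lia.
      simpl in E1. injection E1; auto.
Qed.
(** * Settling debts *)

Lemma sumv_plus f g l : sumv (fun x => f x + g x) l = sumv f l + sumv g l.
Proof. induction l; auto. rewrite !sumv_cons. lia. Qed.

Lemma sumv_incl d V T : NoDup V -> incl V T -> sumv d V <= sumv d T.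
Proof.
  intros H. revert T. induction H as [| x V Hx HV IH]; intros T HT; [apply Nat.le_0_l |].
  destruct (in_split x T) as (l1 & l2 & ->); [apply HT; left; auto |].
  assert (H : sumv d V <= sumv d (l1 ++ l2)).
  { apply IH. intros y Hy. specialize (HT y (or_intror Hy)). rewrite in_app_iff in *. simpl in HT.
    destruct HT as [? | [-> | ?]]; tauto. }
  rewrite sumv_app in *. rewrite !sumv_cons. lia.
Qed.

Lemma sumv_override_le d V T : NoDup V -> sumv (override T d (fun _ => 0)) V <= sumv d T.
Proof.
  intros H. set (p := fun x => if in_dec Nat.eq_dec x T then true else false).
  replace (sumv (override T d (fun _ => 0)) V) with (sumv d (filter p V)).
  - apply sumv_incl; [apply NoDup_filter; auto |]. intros x Hx. apply filter_In in Hx.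
    unfold p in Hx. destruct (in_dec Nat.eq_dec x T); [auto | destruct Hx; discriminate].
  - clear H. induction V; auto. simpl. rewrite sumv_cons, <- IHV. unfold override, p at 1.
    destruct (in_dec Nat.eq_dec a T); [rewrite sumv_cons; auto | auto].
Qed.

(** The balance behind every replayed rule: a debt not yet handed to a condition ([A]) is either
    paid ([P]) or inherited by an occurrence in what remains ([T]). [T] may repeat variables, but
    [V] must not, since each debt is to be counted once. *)
Lemma unused_le d A V P T :
  NoDup V -> (forall x, In x V -> ~ In x A -> In x P \/ In x T) ->
  unused d A V <= sumv (override P d (fun _ => 0)) V + sumv d T.
Proof.
  intros HV H. unfold unused.
  apply Nat.le_trans with (sumv (fun x => override P d (fun _ => 0) x + override T d (fun _ => 0) x) V).
  - apply sumv_le. intros x Hx. unfold override. specialize (H x Hx).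
    destruct (in_dec Nat.eq_dec x A); [lia |]. specialize (H n).
    destruct (in_dec Nat.eq_dec x P), (in_dec Nat.eq_dec x T); try lia; tauto.
  - rewrite sumv_plus. assert (H1 := sumv_override_le d V T HV). lia.
Qed.

Lemma NoDup_concat {A} (ls : list (list A)) :
  Forall (@NoDup A) ls ->
  (forall i j li lj, i <> j -> nth_error ls i = Some li -> nth_error ls j = Some lj ->
    forall x, In x li -> ~ In x lj) ->
  NoDup (concat ls).
Proof.
  induction 1 as [| l ls Hl _ IH]; simpl; intros H; [constructor |].
  apply NoDup_app_intro; auto.
  - apply IH. intros i j li lj Hij Hi Hj. apply (H (S i) (S j)); auto.
  - intros x Hx Hx'. apply in_concat in Hx'. destruct Hx' as (l' & Hl' & Hx').
    apply In_nth_error in Hl'. destruct Hl' as [n Hn].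
    apply (H 0 (S n) l l') with x; auto.
Qed.

Lemma finite_choice {B} (b0 : B) (Q : nat -> B -> Prop) l :
  (forall x, In x l -> exists y, Q x y) -> exists g, forall x, In x l -> Q x (g x).
Proof.
  induction l as [| x l IH]; intros H; [exists (fun _ => b0); simpl; tauto |].
  destruct IH as [g Hg]; [intros; apply H; simpl; auto |].
  destruct (H x (or_introl eq_refl)) as [y Hy].
  exists (fun z => if Nat.eq_dec z x then y else g z). intros z Hz.
  destruct (Nat.eq_dec z x) as [-> |]; auto. apply Hg. destruct Hz; [congruence | auto].
Qed.

Lemma repl_inj {A} (xs ys : list A) i L M :
  length xs = length ys -> length L = length M -> repl xs i L = repl ys i M ->
  L = M /\ forall N, repl xs i N = repl ys i N.
Proof.
  intros H1 H2 H. unfold repl in *.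
  apply app_inj_length in H; [| rewrite !length_firstn; lia]. destruct H as [E1 H].
  apply app_inj_length in H; auto. destruct H as [E2 E3]. rewrite E1, E3. auto.
Qed.

Lemma map_set_nth {A B} (h : A -> B) l n x : map h (set_nth l n x) = set_nth (map h l) n (h x).
Proof. revert n; induction l; destruct n; simpl; auto. f_equal; auto. Qed.

Lemma lhsG_map {F} (Rs : trs F) rho s : lhsG Rs rho s = map (tsubst s) (map (label Rs) (r_lhs rho)).
Proof. unfold lhsG. rewrite map_map. reflexivity. Qed.

Lemma Lh_label {F} (Rs : trs F) rho : map (zeta Rs) (map (label Rs) (r_lhs rho)) = Lh Rs rho.
Proof. rewrite map_map. apply map_ext. intros; apply zeta_label. Qed.

Lemma zeta_lhsG {F} (Rs : trs F) rho s :
  map (zeta Rs) (lhsG Rs rho s) = map (tsubst (fun x => zeta Rs (s x))) (Lh Rs rho).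
Proof. rewrite lhsG_map, map_tsubst_zeta, Lh_label. reflexivity. Qed.

Lemma zeta_subst_label {F} (Rs : trs F) s t :
  zeta Rs (tsubst s (label Rs t)) = tsubst (fun x => zeta Rs (s x)) (xi Rs HTop t).
Proof. rewrite tsubst_zeta, zeta_label. reflexivity. Qed.

Lemma lvars_label {F} (Rs : trs F) ts : lvars (map (label Rs) ts) = lvars ts.
Proof. apply lvars_map. intros; apply tvars_label. Qed.

(** * Variables and invariants of a partially evaluated rule *)

Definition matched_vars {F} (rho : rule F) j := lvars (r_lhs rho) ++ lvars (map snd (firstn j (r_conds rho))).
(** The debts of these variables are already contained in the costs of the condition reductions, and
    their values must no longer be changed. *)
Definition cond_vars {F} (rho : rule F) j := lvars (map fst (firstn j (r_conds rho))).

Section RuleFacts.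
Context {F : Type} (Rs : trs F) (f : F) (rho : rule F) (Hok : rule_ok Rs f rho).

Lemma rule_ok_wf_lhs : Forall (wfG Rs) (map (label Rs) (r_lhs rho)).
Proof using Hok.
  apply Forall_map. eapply Forall_impl; [intros; apply wfG_label; eassumption |]. apply Hok.
Qed.

Lemma rule_ok_wf_rhs : wfG Rs (label Rs (r_rhs rho)).
Proof using Hok. apply wfG_label. apply Hok. Qed.

Lemma rule_ok_wf_cond a b : In (a, b) (r_conds rho) -> wfF Rs a /\ wfF Rs b.
Proof using Hok.
  intros H. destruct Hok as (_ & _ & _ & H1 & _). rewrite Forall_forall in H1. apply (H1 _ H).
Qed.

Lemma rule_ok_con_cond a b : In (a, b) (r_conds rho) -> con_term Rs b.
Proof using Hok.
  intros H. destruct Hok as (_ & _ & _ & _ & _ & H1 & _). rewrite Forall_forall in H1. apply (H1 _ H).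
Qed.

Lemma rule_ok_linear_cond a b : In (a, b) (r_conds rho) -> linear b.
Proof using Hok.
  intros H. destruct Hok as (_ & _ & _ & _ & _ & _ & _ & _ & _ & _ & H1).
  rewrite Forall_forall in H1. apply (H1 _ H).
Qed.

Lemma NoDup_matched_vars j : NoDup (matched_vars rho j).
Proof using Hok.
  destruct Hok as (_ & _ & _ & _ & _ & _ & H1 & _ & _ & H2 & H3).
  enough (NoDup (matched_vars rho (length (r_conds rho)))) as H.
  { unfold matched_vars in *. rewrite firstn_all in H.
    rewrite <- (firstn_skipn j (r_conds rho)), map_app, lvars_app, app_assoc in H.
    apply NoDup_app_inv in H. tauto. }
  unfold matched_vars. rewrite firstn_all. unfold lvars at 2.
  rewrite flat_map_concat_map, map_map.
  change (NoDup (concat (lvars (r_lhs rho) :: map (fun ab => tvars (snd ab)) (r_conds rho)))).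
  apply NoDup_concat; auto. constructor; auto. apply Forall_map. exact H3.
Qed.

Lemma matched_vars_S j a b :
  nth_error (r_conds rho) j = Some (a, b) -> matched_vars rho (S j) = matched_vars rho j ++ tvars b.
Proof.
  intros H. unfold matched_vars. rewrite <- (firstn_snoc _ _ _ H), map_app, lvars_app. simpl.
  rewrite app_nil_r, app_assoc. reflexivity.
Qed.

Lemma cond_vars_S j a b :
  nth_error (r_conds rho) j = Some (a, b) -> cond_vars rho (S j) = cond_vars rho j ++ tvars a.
Proof.
  intros H. unfold cond_vars. rewrite <- (firstn_snoc _ _ _ H), map_app, lvars_app. simpl.
  rewrite app_nil_r. reflexivity.
Qed.

Lemma matched_vars_le j k : j <= k -> incl (matched_vars rho j) (matched_vars rho k).
Proof.
  intros H x Hx. unfold matched_vars in *. apply in_app_iff in Hx. apply in_app_iff.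
  destruct Hx as [Hx | Hx]; auto. right.
  rewrite <- (firstn_skipn j (firstn k (r_conds rho))), firstn_firstn, Nat.min_l by lia.
  rewrite map_app, lvars_app. apply in_app_iff; auto.
Qed.

Lemma incl_cond_matched j a b :
  nth_error (r_conds rho) j = Some (a, b) -> incl (tvars a) (matched_vars rho j).
Proof using Hok. intros H. destruct Hok as (_ & _ & _ & _ & _ & _ & _ & _ & H1 & _). eapply H1; eauto. Qed.

Lemma cond_vars_incl j : incl (cond_vars rho j) (matched_vars rho j).
Proof using Hok.
  intros x Hx. apply in_flat_map in Hx. destruct Hx as (t & Ht & Hx).
  apply in_map_iff in Ht. destruct Ht as ([a b] & <- & Hab).
  apply In_nth_error in Hab. destruct Hab as [n Hn].
  assert (n < j).
  { assert (n < length (firstn j (r_conds rho))) by (apply nth_error_Some; congruence).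
    rewrite length_firstn in *. lia. }
  rewrite nth_error_firstn in Hn. destruct (Nat.ltb_spec n j); [| lia].
  eapply matched_vars_le; [| eapply incl_cond_matched; eauto]. lia.
Qed.

Lemma incl_rhs_matched : incl (tvars (r_rhs rho)) (matched_vars rho (length (r_conds rho))).
Proof using Hok.
  destruct Hok as (_ & _ & _ & _ & _ & _ & _ & H1 & _). unfold matched_vars. rewrite firstn_all. exact H1.
Qed.
End RuleFacts.

(** [c0] is the labeled cost of exposing the redex and [cs] lists the costs of the conditions, which
    are credited only when the rule is finally applied or fails. Outside the matched variables [ss]
    is arbitrary, hence the restriction in [cm_ground]. *)
Record conditions_met {F} (Rs : trs F) s f R i rho j (ss : nat -> term (gsym F)) c0 cs : Prop := {
  cm_rule : rule_at Rs f i rho;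
  cm_bit : nth_error R (i - 1) = Some true;
  cm_lhs : sim Rs s (App (GLab f R) (lhsG Rs rho ss)) c0;
  cm_le : j <= length (r_conds rho);
  cm_conds : Forall2 (fun ab c => sim Rs (tsubst ss (label Rs (fst ab))) (tsubst ss (label Rs (snd ab))) c)
               (firstn j (r_conds rho)) cs;
  cm_ground : forall x, In x (matched_vars rho j) -> ground_ok Rs (ss x) }.

Definition in_debt {F} (Rs : trs F) (rho : rule F) j ss sg d : Prop :=
  forall x, In x (matched_vars rho j) -> owes Rs ss sg d x.

Lemma rule_at_ok {F} (Rs : trs F) f i rho : strong_cctrs Rs -> rule_at Rs f i rho -> rule_ok Rs f rho.
Proof. intros HR [_ H]. apply (HR f). eapply nth_error_In; eauto. Qed.

Lemma cm_lsteps {F} (Rs : trs F) s f R i rho j ss c0 cs :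
  conditions_met Rs s f R i rho j ss c0 cs ->
  length cs = j /\
  forall q a b c, nth_error (r_conds rho) q = Some (a, b) -> nth_error cs q = Some c ->
    lsteps Rs (tsubst ss (label Rs a)) (tsubst ss (label Rs b)) c.
Proof.
  intros [_ _ _ H1 H2 _].
  assert (L := Forall2_length H2). rewrite length_firstn in L.
  split; [lia |]. intros q a b c Hq Hc.
  assert (q < length cs) by (apply nth_error_Some; congruence).
  assert (Hq' : nth_error (firstn j (r_conds rho)) q = Some (a, b)).
  { rewrite nth_error_firstn. destruct (Nat.ltb_spec q j); auto; lia. }
  clear - H2 Hq' Hc. revert q Hq' Hc. induction H2 as [| ab c' l cs' H]; intros q Hq Hc.
  - destruct q; discriminate.
  - destruct q; simpl in *; eauto. injection Hq as ->. injection Hc as ->. apply H.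
Qed.

Lemma cm_cs_steps {F} (Rs : trs F) s f R i rho j ss c0 cs :
  conditions_met Rs s f R i rho j ss c0 cs ->
  Forall (fun ab => exists c, cs_steps Rs (tsubst (fun x => zeta Rs (ss x)) (xi Rs HTop (fst ab)))
            (tsubst (fun x => zeta Rs (ss x)) (xi Rs HTop (snd ab))) c) (firstn j (r_conds rho)).
Proof.
  intros [_ _ _ _ H _]. induction H as [| ab c l cs' (_ & _ & _ & c' & H)]; constructor; auto.
  exists c'. rewrite <- !zeta_subst_label. exact H.
Qed.

Lemma cm_bits {F} (Rs : trs F) s f R i rho j ss c0 cs :
  conditions_met Rs s f R i rho j ss c0 cs ->
  length (map (@bit2h F) R) = msz Rs f /\ nth_error (map (@bit2h F) R) (i - 1) = Some (hc HTop) /\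
  gsym_ok Rs (GLab f R) (length (lhsG Rs rho ss)) /\ 1 <= i /\ i <= length R.
Proof.
  intros [[Hi _] H1 (_ & H2 & _) _ _ _]. apply ground_ok_inv in H2. destruct H2 as [H2 _].
  assert (i - 1 < length R) by (apply nth_error_Some; congruence).
  rewrite length_map, nth_error_map, H1. repeat split; auto; try apply H2. lia.
Qed.

Lemma settle {F} (Rs : trs F) ss (d : nat -> nat) P :
  (forall x, In x P -> cost_reached Rs (ss x) (d x)) ->
  exists ss' cc, (forall x, ~ In x P -> ss' x = ss x) /\ (forall x, In x P -> d x <= cc x) /\
    (forall x, ground_ok Rs (ss x) -> sim Rs (ss x) (ss' x) (cc x)).
Proof.
  intros H.
  (* The default pair only fills the choice function outside [P], where [override] restores the old
     value at cost 0. *)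
  destruct (finite_choice (Var 0, 0) (fun x y => sim Rs (ss x) (fst y) (snd y) /\ d x <= snd y) P) as [g Hg].
  { intros x Hx. destruct (H x Hx) as (s' & c & H1 & H2). exists (s', c); auto. }
  exists (override P (fun x => fst (g x)) ss), (override P (fun x => snd (g x)) (fun _ => 0)).
  split; [| split].
  - intros; apply override_out; auto.
  - intros x Hx. rewrite override_in by auto. apply Hg; auto.
  - intros x Hx. unfold override. destruct (in_dec Nat.eq_dec x P); [apply Hg; auto | apply sim_refl; auto].
Qed.

(* The substitution may be reduced on variables that no condition has used: the condition
   reductions are unchanged except for some more steps at their end. *)
Lemma settle_conditions {F} (Rs : trs F) s f R i rho j ss sg d c0 cs P :
  strong_cctrs Rs -> conditions_met Rs s f R i rho j ss c0 cs -> in_debt Rs rho j ss sg d ->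
  (forall x, In x P -> In x (matched_vars rho j) /\ ~ In x (cond_vars rho j)) ->
  exists ss' c0' cs', conditions_met Rs s f R i rho j ss' c0' cs' /\
    (forall x, ~ In x P -> ss' x = ss x) /\
    c0 + list_sum cs + sumv (override P d (fun _ => 0)) (matched_vars rho j) <= c0' + list_sum cs'.
Proof.
  intros HR Hcm Hd HP.
  assert (Hok := rule_at_ok _ _ _ _ HR (cm_rule _ _ _ _ _ _ _ _ _ _ Hcm)).
  destruct (settle Rs ss d P) as (ss' & cc & S1 & S2 & S3).
  { intros x Hx. destruct (HP x Hx) as [Hx' _]. destruct (Hd x Hx') as [H1 H2].
    apply (hered_tame_tame _ _ H1 _ _ H2). }
  destruct (cm_bits _ _ _ _ _ _ _ _ _ _ Hcm) as (_ & _ & Hg & _).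
  destruct Hcm as [M1 M2 M3 M4 M5 M6].
  assert (Hlhs : sims Rs (lhsG Rs rho ss) (lhsG Rs rho ss') (sumv cc (lvars (r_lhs rho)))).
  { rewrite !lhsG_map, <- (lvars_label Rs). apply sims_subst.
    - eapply rule_ok_wf_lhs; eauto.
    - intros x Hx. rewrite lvars_label in Hx. apply S3, M6, in_app_iff; auto. }
  assert (Hcs : exists cs', Forall2 (fun ab c => sim Rs (tsubst ss' (label Rs (fst ab))) (tsubst ss' (label Rs (snd ab))) c)
               (firstn j (r_conds rho)) cs' /\
            list_sum cs' = list_sum cs + sumv cc (lvars (map snd (firstn j (r_conds rho))))).
  { assert (HC : Forall (fun ab => tsubst ss' (label Rs (fst ab)) = tsubst ss (label Rs (fst ab)) /\
        sim Rs (tsubst ss (label Rs (snd ab))) (tsubst ss' (label Rs (snd ab))) (sumv cc (tvars (snd ab))))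
        (firstn j (r_conds rho))).
    { apply Forall_forall. intros [a b] Hab. simpl. split.
      - apply tsubst_ext. intros x Hx. rewrite tvars_label in Hx. apply S1. intros Hx'.
        apply (proj2 (HP x Hx')). apply in_flat_map. exists a. split; auto.
        apply in_map_iff. exists (a, b); auto.
      - rewrite <- (tvars_label Rs b). apply sim_subst.
        + apply wfG_label. eapply rule_ok_wf_cond; eauto. eapply in_firstn; eauto.
        + intros x Hx. rewrite tvars_label in Hx. apply S3, M6, in_app_iff; right.
          apply in_flat_map. exists b. split; auto. apply in_map_iff. exists (a, b); auto. }
    clear - M5 HC. induction M5 as [| ab c l cs H _ IH]; [exists []; split; auto |].
    apply Forall_cons_iff in HC. destruct HC as [[E1 E2] HC]. destruct (IH HC) as (cs' & H1 & H2).
    exists (c + sumv cc (tvars (snd ab)) :: cs'). split.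
    - constructor; auto. rewrite E1. eapply sim_trans; eauto.
    - unfold list_sum, lvars in *. simpl. rewrite sumv_app. lia. }
  destruct Hcs as (cs' & C1 & C2).
  exists ss', (c0 + sumv cc (lvars (r_lhs rho))), cs'. split; [| split; auto].
  - constructor; auto.
    + eapply sim_trans; eauto. apply sim_app; auto.
    + intros x Hx. apply (S3 x (M6 x Hx)).
  - assert (sumv (override P d (fun _ => 0)) (matched_vars rho j) <= sumv cc (matched_vars rho j)).
    { apply sumv_le. intros x Hx. unfold override. destruct (in_dec Nat.eq_dec x P); auto. lia. }
    unfold matched_vars in H at 2. rewrite sumv_app in H. lia.
Qed.

(** A labeled step that accounts for the progress made so far. Its result [s1] is strictly below
    [s], so the induction hypothesis covers the rest of the reduction; [d] is what [s1] still owes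
    to reach [t]. *)
Definition unfolds {F} (Rs : trs F) s t N : Prop :=
  exists s0 s1 c0 c1 d, sim Rs s s0 c0 /\ lstep Rs s0 s1 c1 /\ ground_ok Rs s1 /\
    cs_plus Rs (zeta Rs s0) (zeta Rs s1) /\ cs_steps Rs (zeta Rs s1) t d /\ N <= c0 + c1 + d.

Definition minus (V A : list nat) : list nat :=
  filter (fun x => if in_dec Nat.eq_dec x A then false else true) V.

Lemma in_minus x V A : In x (minus V A) <-> In x V /\ ~ In x A.
Proof.
  unfold minus. rewrite filter_In. destruct (in_dec Nat.eq_dec x A); intuition discriminate.
Qed.

(** The [+ 1] is the cost of the transformed rule that finishes, and it is met by the [S] in
    [ls_succ]. *)
Lemma unfolds_success {F} (Rs : trs F) s f R i rho ss sg d c0 cs N :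
  strong_cctrs Rs -> conditions_met Rs s f R i rho (length (r_conds rho)) ss c0 cs ->
  in_debt Rs rho (length (r_conds rho)) ss sg d ->
  N <= c0 + list_sum cs + unused d (cond_vars rho (length (r_conds rho))) (matched_vars rho (length (r_conds rho))) ->
  unfolds Rs s (tsubst sg (xi Rs HTop (r_rhs rho))) (N + 1).
Proof.
  intros HR Hcm Hd HN. set (k := length (r_conds rho)) in *.
  assert (Hok := rule_at_ok _ _ _ _ HR (cm_rule _ _ _ _ _ _ _ _ _ _ Hcm)).
  (* The variables outside [A] vanish with this step, so their debts have to be settled now. *)
  set (A := cond_vars rho k ++ tvars (r_rhs rho)).
  destruct (settle_conditions Rs s f R i rho k ss sg d c0 cs (minus (matched_vars rho k) A))
    as (ss' & c0' & cs' & H1 & H2 & H3); auto.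
  { intros x Hx. apply in_minus in Hx. unfold A in Hx. rewrite in_app_iff in Hx. tauto. }
  destruct (cm_bits _ _ _ _ _ _ _ _ _ _ H1) as (B1 & B2 & B3 & B4 & B5).
  destruct (cm_lsteps _ _ _ _ _ _ _ _ _ _ H1) as (L1 & L2).
  exists (App (GLab f R) (lhsG Rs rho ss')), (tsubst ss' (label Rs (r_rhs rho))), c0', (S (list_sum cs')),
    (sumv d (tvars (r_rhs rho))).
  split; [apply H1 |]. split; [| split; [| split; [| split]]].
  - destruct (cm_rule _ _ _ _ _ _ _ _ _ _ H1) as [_ Hn].
    eapply ls_succ; eauto. apply H1.
  - apply ground_ok_subst; [eapply rule_ok_wf_rhs; eauto |].
    intros x Hx. rewrite tvars_label in Hx. apply H1. eapply incl_rhs_matched; eauto.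
  - rewrite zeta_app, zeta_lhsG, zeta_subst_label. apply rhs_reached with (i := i); auto.
    + apply H1.
    + apply Hok.
    + assert (HC := cm_cs_steps _ _ _ _ _ _ _ _ _ _ H1). unfold k in HC. rewrite firstn_all in HC. exact HC.
  - rewrite <- (zeta_label Rs (r_rhs rho)), <- (tvars_label Rs). apply subst_reduce; [eapply rule_ok_wf_rhs; eauto |].
    intros x Hx. rewrite tvars_label in Hx. rewrite H2.
    + apply Hd. eapply incl_rhs_matched; eauto.
    + intros Hx'. apply in_minus in Hx'. unfold A in Hx'. rewrite in_app_iff in Hx'. tauto.
  - assert (HU := unused_le d (cond_vars rho k) (matched_vars rho k) (minus (matched_vars rho k) A)
      (tvars (r_rhs rho)) (NoDup_matched_vars _ _ _ Hok k)).
    enough (unused d (cond_vars rho k) (matched_vars rho k) <= sumv (override (minus (matched_vars rho k) A) d (fun _ => 0))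
        (matched_vars rho k) + sumv d (tvars (r_rhs rho))) by lia.
    apply HU. intros x Hx Hx'. unfold A. rewrite in_minus, in_app_iff.
    destruct (in_dec Nat.eq_dec x (tvars (r_rhs rho))); tauto.
Qed.

Lemma bits_set_false {F} f (R : list bool) i :
  1 <= i -> i <= length R ->
  bits (GLab f (set_nth R (i - 1) false)) = repl (@bits F (GLab f R)) i [hc HBot].
Proof.
  intros. simpl. rewrite map_set_nth. simpl. rewrite set_nth_repl; auto. rewrite length_map; auto.
Qed.

Lemma gsym_ok_set_false {F} (Rs : trs F) f R i n :
  gsym_ok Rs (GLab f R) n -> gsym_ok Rs (GLab f (set_nth R i false)) n.
Proof. simpl. rewrite length_set_nth. auto. Qed.

Lemma ground_ok_lhsG {F} (Rs : trs F) rho ss f :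
  rule_ok Rs f rho -> (forall x, In x (lvars (r_lhs rho)) -> ground_ok Rs (ss x)) ->
  Forall (ground_ok Rs) (lhsG Rs rho ss).
Proof.
  intros Hok H. rewrite lhsG_map. apply Forall_map. apply Forall_forall. intros q Hq.
  apply ground_ok_subst.
  - exact (proj1 (Forall_forall _ _) (rule_ok_wf_lhs _ _ _ Hok) q Hq).
  - intros x Hx. apply H. rewrite <- (lvars_label Rs). eapply in_lvars; eauto.
Qed.

Lemma unfolds_failure {F} (Rs : trs F) s f R i rho j ss sg d c0 cs a b v ta e N :
  strong_cctrs Rs -> conditions_met Rs s f R i rho j ss c0 cs -> in_debt Rs rho j ss sg d ->
  nth_error (r_conds rho) j = Some (a, b) -> hered_tame Rs (tsubst ss (label Rs a)) ->
  AP Rs b v -> NoDup (tvars v) -> disjoint (tvars v) (rvars rho) ->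
  cs_steps Rs (zeta Rs (tsubst ss (label Rs a))) (tsubst ta v) e ->
  N <= c0 + list_sum cs + e + unused d (cond_vars rho (S j)) (matched_vars rho j) ->
  unfolds Rs s (App (HF f) (map (tsubst sg) (Lh Rs rho) ++ repl (map bit2h R) i [hc HBot])) N.
Proof.
  intros HR Hcm Hd Hj Ha Hv Nv Dv He HN.
  assert (Hok := rule_at_ok _ _ _ _ HR (cm_rule _ _ _ _ _ _ _ _ _ _ Hcm)).
  assert (Hab := nth_error_In _ _ Hj).
  destruct (rule_ok_wf_cond _ _ _ Hok _ _ Hab) as [Wa Wb].
  destruct (AP_labeled Rs b v Hv Wb (rule_ok_con_cond _ _ _ Hok _ _ Hab)) as (q & Q1 & Q2 & <- & Q4).
  rewrite tvars_zeta in Nv, Dv.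
  destruct (wfG_exposable Rs q Q1 Nv _ _ _ Ha He) as (ts & dq & cq & E1 & E2 & E3).
  (* The instance of [q] disappears with the failed step, so all debts inside it are paid by
     prolonging the failing condition reduction. *)
  destruct (settle Rs ts dq (tvars q)) as (ts' & cc & S1 & S2 & S3).
  { intros x Hx. destruct (E2 x Hx) as [T1 T2]. apply (hered_tame_tame _ _ T1 _ _ T2). }
  (* A failed step keeps the arguments, so debts of left-hand side variables live on. Only variables
     of earlier [b] terms vanish. Those of [a] are protected by [cond_vars rho (S j)], which keeps
     the failing condition itself unchanged. *)
  set (A := cond_vars rho (S j) ++ lvars (r_lhs rho)).
  assert (HA : cond_vars rho (S j) = cond_vars rho j ++ tvars a) by (eapply cond_vars_S; eauto).
  destruct (settle_conditions Rs s f R i rho j ss sg d c0 cs (minus (matched_vars rho j) A))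
    as (ss' & c0' & cs' & H1 & H2 & H3); auto.
  { intros x Hx. apply in_minus in Hx. unfold A in Hx. rewrite HA, !in_app_iff in Hx. tauto. }
  assert (Ea : tsubst ss' (label Rs a) = tsubst ss (label Rs a)).
  { apply tsubst_ext. intros x Hx. rewrite tvars_label in Hx. apply H2. intros Hx'.
    apply in_minus in Hx'. unfold A in Hx'. rewrite HA, !in_app_iff in Hx'. tauto. }
  assert (Hsim : sim Rs (tsubst ss' (label Rs a)) (tsubst ts' q) (cq + sumv cc (tvars q))).
  { rewrite Ea. eapply sim_trans; eauto. apply sim_subst; auto. intros x Hx. apply S3. apply (E2 x Hx). }
  destruct (cm_bits _ _ _ _ _ _ _ _ _ _ H1) as (B1 & B2 & B3 & B4 & B5).
  destruct (cm_lsteps _ _ _ _ _ _ _ _ _ _ H1) as (L1 & L2).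
  exists (App (GLab f R) (lhsG Rs rho ss')), (App (GLab f (set_nth R (i - 1) false)) (lhsG Rs rho ss')),
    c0', (list_sum cs' + (cq + sumv cc (tvars q))), (sumv d (lvars (r_lhs rho))).
  split; [apply H1 |]. split; [| split; [| split; [| split]]].
  - destruct (cm_rule _ _ _ _ _ _ _ _ _ _ H1) as [_ Hn].
    eapply ls_fail with (u := q) (tau := ts'); eauto.
    + apply H1.
    + apply Hsim.
    + intros x Hx Hx'. apply (Dv x Hx). eapply in_rvars_cond; eauto.
  - constructor; [apply gsym_ok_set_false; auto |]. eapply ground_ok_lhsG; eauto.
    intros x Hx. apply H1. apply in_app_iff; auto.
  - rewrite !zeta_app, zeta_lhsG, bits_set_false by auto.
    destruct Hsim as (_ & _ & _ & ch & Hch).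
    rewrite zeta_subst_label, tsubst_zeta in Hch.
    eapply cs_plus_trans; [eapply cs_plus_trans |].
    + eapply condition_reached; eauto; [apply H1 | apply Hok | eapply cm_cs_steps; eauto].
    + eapply aux_args_steps; eauto; [apply H1 | apply H1 | apply Hok].
    + apply cs_steps_one. eapply step_fail; eauto; [apply H1 | rewrite tvars_zeta; auto | rewrite tvars_zeta; auto].
  - change (map bit2h R) with (bits (GLab f R)). rewrite <- bits_set_false by auto.
    apply (args_reduce_app Rs (GLab f (set_nth R (i - 1) false))); [apply gsym_ok_set_false; auto |].
    rewrite lhsG_map, <- Lh_label, <- (lvars_label Rs (r_lhs rho)).
    apply args_subst_reduce; [eapply rule_ok_wf_lhs; eauto |].
    intros x Hx. rewrite lvars_label in Hx. rewrite H2.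
    + apply Hd. apply in_app_iff; auto.
    + intros Hx'. apply in_minus in Hx'. unfold A in Hx'. rewrite in_app_iff in Hx'. tauto.
  - assert (HU : unused d (cond_vars rho (S j)) (matched_vars rho j) <=
        sumv (override (minus (matched_vars rho j) A) d (fun _ => 0)) (matched_vars rho j) + sumv d (lvars (r_lhs rho))).
    { apply unused_le; [eapply NoDup_matched_vars; eauto |]. intros x Hx Hx'. unfold A.
      rewrite in_minus, in_app_iff. destruct (in_dec Nat.eq_dec x (lvars (r_lhs rho))); tauto. }
    assert (HV : sumv dq (tvars q) <= sumv cc (tvars q)) by (apply sumv_le; auto). lia.
Qed.
(** * Root steps *)

(** The list [qs] of variables with a single pattern at [j] is a linear list of labeled normal
    forms, as [ls_bot] requires. The step is free and keeps all arguments, so no debt needs to be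
    settled. *)
Lemma unfolds_mismatch {F} (Rs : trs F) f R us i rho xs ys j l v sg d :
  strong_cctrs Rs -> gsym_ok Rs (GLab f R) (length us) -> Forall (hered_tame Rs) us ->
  rule_at Rs f i rho -> nth_error R (i - 1) = Some true ->
  1 <= j -> nth_error (r_lhs rho) (j - 1) = Some l -> AP Rs l v ->
  length ys = ar Rs f -> NoDup (xs ++ ys ++ tvars v) -> disjoint (xs ++ ys ++ tvars v) (rvars rho) ->
  args_reduce Rs us (map (tsubst sg) (repl (map Var ys) j [v])) d ->
  unfolds Rs (App (GLab f R) us)
    (App (HF f) (map (tsubst sg) (repl (map Var ys) j [v]) ++ repl (map bit2h R) i [hc HBot])) d.
Proof.
  intros HR Hg Hu Hrho Hbit Hj Hl Hv Hys ND DJ Hred.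
  assert (Hok := rule_at_ok _ _ _ _ HR Hrho).
  assert (Hin := nth_error_In _ _ Hl).
  assert (Hlen : length (r_lhs rho) = ar Rs f) by apply Hok.
  assert (Hjl : j - 1 < length (r_lhs rho)) by (apply nth_error_Some; congruence).
  destruct Hok as (_ & Wl & _ & _ & Cl & _).
  rewrite Forall_forall in Wl, Cl.
  destruct (AP_labeled Rs l v Hv (Wl _ Hin) (Cl _ Hin)) as (q & Q1 & Q2 & <- & Q4).
  rewrite tvars_zeta in ND, DJ.
  set (qs := repl (map Var ys) j [q]).
  assert (Eqs : map (zeta Rs) qs = repl (map Var ys) j [zeta Rs q]).
  { unfold qs. rewrite map_repl, map_map. reflexivity. }
  rewrite <- Eqs in Hred |- *.
  apply NoDup_app_inv in ND. destruct ND as (_ & ND & _).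
  assert (Nqs : NoDup (lvars qs)).
  { unfold qs. rewrite lvars_repl_Var. apply NoDup_app_inv in ND. destruct ND as (? & ? & ?).
    apply NoDup_hole; auto. }
  assert (Dqs : disjoint (lvars qs) (rvars rho)).
  { unfold qs. rewrite lvars_repl_Var. intros x Hx. apply DJ. rewrite !in_app_iff in *.
    destruct Hx as [Hx | [Hx | Hx]]; auto.
    - right; left. eapply in_firstn; eauto.
    - right; left. eapply in_skipn; eauto. }
  assert (HV : forall P : term (gsym F) -> Prop, (forall x, P (Var x)) -> P q -> Forall P qs).
  { intros P HP Pq. unfold qs, repl. rewrite !Forall_app, firstn_map, skipn_map, !Forall_map.
    split; [apply Forall_forall; auto |]. split; [constructor; auto | apply Forall_forall; auto]. }
  assert (Wqs : Forall (wfG Rs) qs) by (apply HV; auto; constructor).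
  destruct (expose_patterns Rs qs us sg d Wqs Nqs Hu Hred) as (s & dd & c & S1 & S2 & S3).
  assert (Hbl : 1 <= i /\ i <= length R).
  { destruct Hrho. assert (i - 1 < length R) by (apply nth_error_Some; congruence). lia. }
  assert (Lqs : length qs = length us).
  { rewrite <- (sims_length _ _ _ _ S1), length_map. auto. }
  assert (Gqs : Forall (ground_ok Rs) (map (tsubst s) qs)).
  { apply Forall_map, Forall_forall. intros q' Hq'. apply ground_ok_subst.
    - rewrite Forall_forall in Wqs; auto.
    - intros x Hx. apply S2. eapply in_lvars; eauto. }
  exists (App (GLab f R) (map (tsubst s) qs)), (App (GLab f (set_nth R (i - 1) false)) (map (tsubst s) qs)),
    c, 0, (sumv dd (lvars qs)).
  split; [apply sim_app; auto |]. split; [| split; [| split; [| split]]].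
  - destruct Hrho as [_ Hn]. eapply ls_bot; eauto.
    + apply HV; auto. constructor.
    (* A unifier of the two applications unifies their arguments at [j], which [AP_labeled]
       forbids. *)
    + intros [th E]. apply Q4. exists th. simpl in E. injection E; intros E1.
      apply (f_equal (fun l => nth_error l (j - 1))) in E1.
      rewrite (nth_error_map (tsubst th) (j - 1) (r_lhs rho)), Hl in E1.
      unfold qs in E1. rewrite !map_repl in E1. unfold repl in E1.
      rewrite nth_error_app2 in E1; rewrite length_firstn, !length_map in *; [| lia].
      replace (j - 1 - Nat.min (j - 1) (length ys)) with 0 in E1 by lia.
      simpl in E1. injection E1; auto.
  - constructor; auto. apply gsym_ok_set_false. rewrite length_map, Lqs; auto.
  - rewrite !zeta_app, bits_set_false, map_tsubst_zeta by tauto.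
    eexists _, _, _. split; [| apply css_refl].
    eapply step_bot with (j := j) (l := l) (v := zeta Rs q); eauto.
    + simpl. rewrite length_map. apply Hg.
    + simpl. rewrite nth_error_map, Hbit. reflexivity.
    + rewrite tvars_zeta. apply NoDup_app_inv in ND. tauto.
    + rewrite tvars_zeta. intros x Hx. apply DJ. rewrite !in_app_iff; auto.
    + rewrite !length_map, Lqs. apply Hg.
    + rewrite Eqs, map_repl. unfold repl.
      rewrite nth_error_app2; rewrite length_firstn, !length_map; [| lia].
      replace (j - 1 - Nat.min (j - 1) (length ys)) with 0 by lia. reflexivity.
  - change (map bit2h R) with (bits (GLab f R)). rewrite <- bits_set_false by tauto.
    apply (args_reduce_app Rs (GLab f (set_nth R (i - 1) false))).
    + apply gsym_ok_set_false. rewrite length_map, Lqs; auto.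
    + apply args_subst_reduce; auto. intros x Hx. apply S2; auto.
  - lia.
Qed.

Lemma conditions_start {F} (Rs : trs F) f R us i rho sg d0 :
  strong_cctrs Rs -> gsym_ok Rs (GLab f R) (length us) -> Forall (hered_tame Rs) us ->
  rule_at Rs f i rho -> nth_error R (i - 1) = Some true ->
  args_reduce Rs us (map (tsubst sg) (Lh Rs rho)) d0 ->
  exists ss d c0, conditions_met Rs (App (GLab f R) us) f R i rho 0 ss c0 [] /\ in_debt Rs rho 0 ss sg d /\
    d0 <= c0 + list_sum [] + unused d (cond_vars rho 0) (matched_vars rho 0).
Proof.
  intros HR Hg Hu Hrho Hbit Hred.
  assert (Hok := rule_at_ok _ _ _ _ HR Hrho).
  rewrite <- Lh_label in Hred.
  destruct (expose_patterns Rs (map (label Rs) (r_lhs rho)) us sg d0) as (s & d & c & S1 & S2 & S3); auto.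
  { eapply rule_ok_wf_lhs; eauto. }
  { rewrite lvars_label. apply Hok. }
  rewrite lvars_label in S2, S3.
  exists s, d, c.
  assert (E : matched_vars rho 0 = lvars (r_lhs rho)) by (unfold matched_vars; simpl; apply app_nil_r).
  split; [constructor; auto | split].
  - rewrite lhsG_map. apply sim_app; auto.
  - lia.
  - rewrite E. intros x Hx. exact (proj1 (proj1 (S2 x Hx))).
  - intros x Hx. rewrite E in Hx. auto.
  - rewrite E. unfold unused, cond_vars. simpl. rewrite Nat.add_0_r. exact S3.
Qed.

Definition waiting {F} (Rs : trs F) s f R i rho j (a b : term F) ss sg w N : Prop :=
  exists d c0 cs e, conditions_met Rs s f R i rho j ss c0 cs /\ in_debt Rs rho j ss sg d /\
    nth_error (r_conds rho) j = Some (a, b) /\ cs_steps Rs (zeta Rs (tsubst ss (label Rs a))) w e /\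
    N <= c0 + list_sum cs + e + unused d (cond_vars rho (S j)) (matched_vars rho j).

Lemma waiting_start {F} (Rs : trs F) s f R i rho j a b ss sg d c0 cs N :
  strong_cctrs Rs -> conditions_met Rs s f R i rho j ss c0 cs -> in_debt Rs rho j ss sg d ->
  nth_error (r_conds rho) j = Some (a, b) ->
  N <= c0 + list_sum cs + unused d (cond_vars rho j) (matched_vars rho j) ->
  waiting Rs s f R i rho j a b ss sg (tsubst sg (xi Rs HTop a)) N.
Proof.
  intros HR Hcm Hd Hj HN.
  assert (Hok := rule_at_ok _ _ _ _ HR (cm_rule _ _ _ _ _ _ _ _ _ _ Hcm)).
  (* The debts of the variables of [a] become the initial cost of the condition reduction. *)
  exists d, c0, cs, (sumv d (tvars a)). split; [auto |]. split; [auto |]. split; [auto |]. split.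
  - rewrite <- zeta_label, <- (tvars_label Rs a). apply subst_reduce.
    + apply wfG_label. exact (proj1 (rule_ok_wf_cond _ _ _ Hok _ _ (nth_error_In _ _ Hj))).
    + intros x Hx. rewrite tvars_label in Hx. apply Hd. eapply incl_cond_matched; eauto.
  - assert (HU : unused d (cond_vars rho j) (matched_vars rho j) <=
       sumv (override (minus (matched_vars rho j) (cond_vars rho (S j))) d (fun _ => 0)) (matched_vars rho j)
       + sumv d (tvars a)).
    { apply unused_le; [eapply NoDup_matched_vars; eauto |]. intros x Hx Hx'.
      erewrite cond_vars_S, in_minus, in_app_iff by eauto.
      destruct (in_dec Nat.eq_dec x (tvars a)); tauto. }
    enough (sumv (override (minus (matched_vars rho j) (cond_vars rho (S j))) d (fun _ => 0)) (matched_vars rho j)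
      <= unused d (cond_vars rho (S j)) (matched_vars rho j)) by lia.
    apply sumv_le. intros x Hx. unfold override.
    destruct (in_dec Nat.eq_dec x (minus _ _)) as [H |]; [| lia]. apply in_minus in H.
    destruct (in_dec Nat.eq_dec x (cond_vars rho (S j))); [tauto | lia].
Qed.

Lemma waiting_ext {F} (Rs : trs F) s f R i rho j a b ss sg sg' w N :
  (forall x, In x (matched_vars rho j) -> sg x = sg' x) ->
  waiting Rs s f R i rho j a b ss sg w N -> waiting Rs s f R i rho j a b ss sg' w N.
Proof.
  intros H (d & c0 & cs & e & H1 & H2 & H3 & H4 & H5). exists d, c0, cs, e. split; [auto |]. split; [| auto].
  intros x Hx. destruct (H2 x Hx) as [A1 A2]. split; auto. rewrite <- H; auto.
Qed.

Lemma waiting_step {F} (Rs : trs F) s f R i rho j a b ss sg w w' c N :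
  waiting Rs s f R i rho j a b ss sg w N -> cs_step Rs w w' c ->
  waiting Rs s f R i rho j a b ss sg w' (N + c).
Proof.
  intros (d & c0 & cs & e & H1 & H2 & H3 & H4 & H5) H. exists d, c0, cs, (e + c).
  split; [auto |]. split; [auto |]. split; [auto |]. split; [| lia].
  eapply cs_steps_trans; eauto. apply cs_steps_one; auto.
Qed.

(** Exposing [b] in the condition divides its cost [e] into [c], recorded as the cost of this
    condition, and new debts of the variables of [b]. *)
Lemma condition_satisfied {F} (Rs : trs F) s f R i rho j a b ss sg N :
  strong_cctrs Rs -> waiting Rs s f R i rho j a b ss sg (tsubst sg (xi Rs HTop b)) N ->
  hered_tame Rs (tsubst ss (label Rs a)) ->
  exists ss' d c0 cs, conditions_met Rs s f R i rho (S j) ss' c0 cs /\ in_debt Rs rho (S j) ss' sg d /\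
    N <= c0 + list_sum cs + unused d (cond_vars rho (S j)) (matched_vars rho (S j)).
Proof.
  intros HR (d & c0 & cs & e & Hcm & Hd & Hj & He & HN) Ha.
  assert (Hok := rule_at_ok _ _ _ _ HR (cm_rule _ _ _ _ _ _ _ _ _ _ Hcm)).
  assert (Hab := nth_error_In _ _ Hj).
  destruct (rule_ok_wf_cond _ _ _ Hok _ _ Hab) as [Wa Wb].
  rewrite <- (zeta_label Rs b) in He.
  destruct (wfG_exposable Rs (label Rs b) (wfG_label _ _ Wb)) with (3 := He) as (s2 & d2 & c & S1 & S2 & S3); auto.
  { unfold linear. rewrite tvars_label. eapply rule_ok_linear_cond; eauto. }
  rewrite tvars_label in S2, S3.
  assert (ND := NoDup_matched_vars _ _ _ Hok (S j)).
  assert (EV := matched_vars_S rho j a b Hj). rewrite EV in ND |- *.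
  apply NoDup_app_inv in ND. destruct ND as (_ & _ & ND).
  (* The variables of [b] are new, so the redex and the earlier conditions are the same under
     [ss']. *)
  set (ss' := override (tvars b) s2 ss).
  assert (Ess : forall x, In x (matched_vars rho j) -> ss' x = ss x).
  { intros x Hx. apply override_out. intros Hx'. apply (ND x); auto. }
  assert (Et : forall t, incl (tvars t) (matched_vars rho j) -> tsubst ss' (label Rs t) = tsubst ss (label Rs t)).
  { intros t Ht. apply tsubst_ext. intros x Hx. rewrite tvars_label in Hx. auto. }
  assert (HD : in_debt Rs rho (S j) ss' sg (override (tvars b) d2 d)).
  { intros x Hx. rewrite EV, in_app_iff in Hx. unfold owes, ss', override.
    destruct (in_dec Nat.eq_dec x (tvars b)); [apply S2 | apply Hd]; tauto. }
  exists ss', (override (tvars b) d2 d), c0, (cs ++ [c]). split; [| split; auto].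
  - destruct Hcm as [M1 M2 M3 M4 M5 M6]. constructor; auto.
    + replace (lhsG Rs rho ss') with (lhsG Rs rho ss); auto. rewrite !lhsG_map. apply map_tsubst_ext.
      intros x Hx. rewrite lvars_label in Hx. symmetry. apply Ess, in_app_iff; auto.
    + assert (j < length (r_conds rho)) by (apply nth_error_Some; congruence). lia.
    + rewrite <- (firstn_snoc _ _ _ Hj). apply Forall2_app.
      * assert (HI : Forall (fun ab => incl (tvars (fst ab)) (matched_vars rho j) /\
                                       incl (tvars (snd ab)) (matched_vars rho j)) (firstn j (r_conds rho))).
        { apply Forall_forall. intros ab' Hab'. split; intros x Hx.
          - apply (cond_vars_incl _ _ _ Hok). apply in_flat_map. exists (fst ab'). split; auto. apply in_map; auto.
          - apply in_app_iff; right. apply in_flat_map. exists (snd ab'). split; auto. apply in_map; auto. }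
        clear - M5 HI Et. induction M5; constructor; apply Forall_cons_iff in HI; [| tauto].
        rewrite !Et; tauto.
      * constructor; [| constructor]. simpl. rewrite Et by (eapply incl_cond_matched; eauto).
        erewrite (tsubst_ext ss'); [eassumption |]. intros x Hx. rewrite tvars_label in Hx.
        apply override_in; auto.
    + intros x Hx. exact (proj1 (proj1 (HD x Hx))).
  - rewrite list_sum_app. simpl. unfold unused in *. rewrite sumv_app.
    rewrite (sumv_ext _ (override (cond_vars rho (S j)) (fun _ => 0) d) (matched_vars rho j)).
    + rewrite (sumv_ext _ d2 (tvars b)); [lia |]. intros x Hx. rewrite override_out.
      * apply override_in; auto.
      * intros Hx'. erewrite cond_vars_S, in_app_iff in Hx' by eauto. apply (ND x); auto.
        destruct Hx'; [eapply cond_vars_incl | eapply incl_cond_matched]; eauto.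
    + intros x Hx. unfold override. destruct (in_dec Nat.eq_dec x (cond_vars rho (S j))); auto.
      destruct (in_dec Nat.eq_dec x (tvars b)); auto. exfalso. apply (ND x); auto.
Qed.

Lemma map_Var_repl {F} (sg : nat -> term (hsym F)) xs i L :
  map (tsubst sg) (repl (map Var xs) i L) = repl (map sg xs) i (map (tsubst sg) L).
Proof. rewrite map_repl, map_map. reflexivity. Qed.

Definition root_step {F} (Rs : trs F) t t' c : Prop :=
  exists l r sg, XiRule Rs l r c /\ t = tsubst sg l /\ t' = tsubst sg r.

Lemma length_Lh {F} (Rs : trs F) f i rho :
  strong_cctrs Rs -> rule_at Rs f i rho -> length (Lh Rs rho) = ar Rs f.
Proof.
  intros HR H. unfold Lh. rewrite length_map. apply (rule_at_ok _ _ _ _ HR H).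
Qed.

Lemma rule_at_defined {F} (Rs : trs F) g f i rho n :
  gsym_ok Rs g n -> erase_sym g = f -> rule_at Rs f i rho -> exists R, g = GLab f R.
Proof.
  intros H <- [_ H1]. destruct g as [c |]; simpl in *; eauto.
  destruct H as [H _]. rewrite H in H1. destruct (i - 1); discriminate.
Qed.

Lemma rule_vars_length {F} (Rs : trs F) f R n i rho xs (sg : nat -> term (hsym F)) :
  gsym_ok Rs (GLab f R) n -> rule_at Rs f i rho -> length xs = msz Rs f ->
  length (map sg xs) = length (map (@bit2h F) R) /\ 1 <= i /\ i <= length (map sg xs).
Proof.
  intros (_ & H1 & _) H2 H3. rewrite !length_map. split; [lia |]. split; [apply H2 |].
  assert (H := rule_at_le Rs f i rho (map (@bit2h F) R) H2). rewrite length_map in H. lia.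
Qed.

Lemma bit2h_top {F} (R : list bool) n :
  nth_error (map (@bit2h F) R) n = Some (hc HTop) -> nth_error R n = Some true.
Proof. rewrite nth_error_map. destruct (nth_error R n) as [[] |]; try discriminate; auto. Qed.

Lemma root_step_defined {F} (Rs : trs F) g us ts d t c :
  strong_cctrs Rs -> gsym_ok Rs g (length us) -> Forall (hered_tame Rs) us -> args_reduce Rs us ts d ->
  root_step Rs (App (HF (erase_sym g)) (ts ++ bits g)) t c ->
  unfolds Rs (App g us) t (d + c) \/
  exists f R i rho a b ss sg w, waiting Rs (App g us) f R i rho 0 a b ss sg w (d + c) /\
    t = App (HAux f i 1) (aux_args Rs rho (map bit2h R) i sg 0 w).
Proof.
  intros HR Hg Hu Hred (l & r & sg & Hrule & El & ->).
  assert (Lus := args_reduce_length _ _ _ _ Hred).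
  assert (Lts : length ts = ar Rs (erase_sym g)) by (rewrite <- Lus; apply gsym_ok_arity; auto).
  inversion Hrule as [f i rho xs Hi Hn Hk Lx Nx Dx | f i rho xs a b cs Hi Hn Hk Lx Nx Dx | | |
                      | f i rho xs ys j l0 v Hi Hn Hj Hl0 Hv Lx Ly Nx Dx];
    subst l r c; cbn [tsubst] in El; try discriminate; injection El; intros El' Ef; clear El;
    assert (Hrho : rule_at Rs f i rho) by (split; auto);
    destruct (rule_at_defined _ _ _ _ _ _ Hg Ef Hrho) as [R ->]; cbn [erase_sym bits] in *;
    destruct (rule_vars_length _ _ _ _ _ _ _ sg Hg Hrho Lx) as (L1 & L2 & L3);
    rewrite map_app, !map_Var_repl in El'; cbn [map tsubst hc] in El'; fold (@hc F HTop) in El'.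
  - apply app_inj_length in El'; [| rewrite length_map, (length_Lh _ _ _ _ HR Hrho); auto].
    destruct El' as [-> E2]. symmetry in E2. apply repl_inv in E2; auto.
    destruct E2 as [E2 E3]. apply bit2h_top in E2.
    destruct (conditions_start Rs f R us i rho sg d) as (ss & dd & c0 & P1 & P2 & P3); auto.
    left. apply unfolds_success with (f := f) (R := R) (i := i) (ss := ss) (d := dd) (c0 := c0) (cs := []); auto.
    all: rewrite Hk; auto.
  - apply app_inj_length in El'; [| rewrite length_map, (length_Lh _ _ _ _ HR Hrho); auto].
    destruct El' as [-> E2]. symmetry in E2. apply repl_inv in E2; auto.
    destruct E2 as [E2 E3]. apply bit2h_top in E2.
    destruct (conditions_start Rs f R us i rho sg d) as (ss & dd & c0 & P1 & P2 & P3); auto.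
    right. rewrite Nat.add_0_r.
    exists f, R, i, rho, a, b, ss, sg, (tsubst sg (xi Rs HTop a)). split.
    + eapply waiting_start; eauto. rewrite Hk. reflexivity.
    + cbn [tsubst]. rewrite map_app, map_Var_repl, E3. reflexivity.
  - apply app_inj_length in El'.
    2: { assert (j - 1 < length (r_lhs rho)) by (apply nth_error_Some; congruence).
         assert (length (r_lhs rho) = ar Rs f) by apply (rule_at_ok _ _ _ _ HR Hrho).
         rewrite length_repl1 by (rewrite ?length_map; lia). rewrite length_map. lia. }
    destruct El' as [-> E2]. symmetry in E2. apply repl_inv in E2; auto.
    destruct E2 as [E2 E3]. apply bit2h_top in E2.
    left. rewrite Nat.add_0_r. cbn [tsubst]. rewrite map_app, (map_Var_repl sg xs), E3.
    eapply unfolds_mismatch; eauto. rewrite map_Var_repl. exact Hred.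
Qed.

Lemma root_step_waiting {F} (Rs : trs F) s f R i rho j a b ss sg w N t c :
  strong_cctrs Rs -> waiting Rs s f R i rho j a b ss sg w N -> hered_tame Rs (tsubst ss (label Rs a)) ->
  root_step Rs (App (HAux f i (S j)) (aux_args Rs rho (map bit2h R) i sg j w)) t c ->
  unfolds Rs s t (N + c) \/
  exists a' b' ss' sg' w', waiting Rs s f R i rho (S j) a' b' ss' sg' w' (N + c) /\
    t = App (HAux f i (S (S j))) (aux_args Rs rho (map bit2h R) i sg' (S j) w').
Proof.
  intros HR HW Ha (l & r & sg2 & Hrule & El & ->).
  assert (HW' := HW). destruct HW' as (d & c0 & cs & e & Hcm & Hd & Hj & He & HN).
  assert (Hrho := cm_rule _ _ _ _ _ _ _ _ _ _ Hcm).
  assert (Hok := rule_at_ok _ _ _ _ HR Hrho).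
  assert (Hg := proj1 (proj2 (proj2 (cm_bits _ _ _ _ _ _ _ _ _ _ Hcm)))).
  assert (Hjk : j < length (r_conds rho)) by (apply nth_error_Some; congruence).
  (* All rules at [HAux] match the same prefix. The matching substitution [sg2] agrees with [sg] on
     the variables matched so far, so the waiting state can be restated with [sg2]. *)
  assert (Agree : forall l1 l2 hs hs', length hs = length hs' ->
     aux_args Rs rho hs i sg j w = map (tsubst sg2) (Lh Rs rho) ++ repl hs' i (map (tsubst sg2) l1 ++ [l2]) ->
     l1 = firstn j (Bh Rs rho) ->
     w = l2 /\ (forall L, repl hs i L = repl hs' i L) /\
     forall x, In x (matched_vars rho j) -> sg x = sg2 x).
  { intros l1 l2 hs hs' Lh' E ->. unfold aux_args in E.
    apply app_inj_length in E; [| rewrite !length_map; auto]. destruct E as [E1 E2].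
    apply repl_inj in E2; auto; [| rewrite !length_app, !length_firstn, !length_map, length_firstn; auto].
    destruct E2 as [E2 E3]. apply app_inj_tail in E2. destruct E2 as [E2 ->]. split; [auto |]. split; [auto |].
    intros x Hx. apply in_app_iff in Hx. destruct Hx as [Hx | Hx].
    - eapply tsubst_agree_list; eauto. rewrite lvars_Lh. auto.
    - rewrite firstn_map in E2. eapply tsubst_agree_list; eauto.
      unfold Bh. rewrite firstn_map, <- (map_map snd (xi Rs HTop)), (lvars_map (xi Rs HTop)); auto.
      intros; apply tvars_xi. }
  inversion Hrule as [ | | f' i' rho' xs Hi Hn Hk Lx Nx Dx
                       | f' i' rho' xs j' a' b' Hi Hn Hj1 Hj2 Hj' Lx Nx Dx
                       | f' i' rho' xs j' a' b' v Hi Hn Hj1 Hj2 Hj' Hv Lx Nx Dx |];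
    subst l r c; cbn [tsubst] in El; try discriminate; injection El; intros El' Ej Ei Ef; clear El;
    subst f' i'; assert (rho' = rho) by (destruct Hrho; congruence); subst rho';
    destruct (rule_vars_length _ _ _ _ _ _ _ sg2 Hg Hrho Lx) as (L1 & L2 & L3);
    rewrite map_app, !map_Var_repl in El'.
  (* When [j] is the last condition, the full list of right sides is its first [j] entries followed
     by the pending [b]. *)
  - assert (EB : Bh Rs rho = firstn j (Bh Rs rho) ++ [xi Rs HTop b]).
    { rewrite (firstn_snoc _ _ _ (nth_Bh Rs _ _ _ _ Hj)). rewrite firstn_all2; auto.
      unfold Bh. rewrite length_map. lia. }
    rewrite EB, map_app in El'. cbn [map] in El'.
    apply Agree in El'; auto. destruct El' as (-> & E1 & E2).
    apply (waiting_ext _ _ _ _ _ _ _ _ _ _ sg sg2) in HW; auto.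
    destruct (condition_satisfied _ _ _ _ _ _ _ _ _ _ _ _ HR HW Ha) as (ss' & d' & c0' & cs' & P1 & P2 & P3).
    left. rewrite Ej in *. eapply unfolds_success; eauto.
  - subst j'.
    rewrite <- (firstn_snoc _ _ _ (nth_Bh Rs _ _ _ _ Hj)), map_app in El'. cbn [map] in El'.
    apply Agree in El'; auto. destruct El' as (-> & E1 & E2).
    apply (waiting_ext _ _ _ _ _ _ _ _ _ _ sg sg2) in HW; auto.
    destruct (condition_satisfied _ _ _ _ _ _ _ _ _ _ _ _ HR HW Ha) as (ss' & d' & c0' & cs' & P1 & P2 & P3).
    right. rewrite Nat.add_0_r. exists a', b', ss', sg2, (tsubst sg2 (xi Rs HTop a')). split.
    + eapply waiting_start; eauto.
    + cbn [tsubst]. rewrite map_app, map_Var_repl, <- E1, map_app, <- firstn_map. reflexivity.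
  - subst j'. simpl in Hj', El'. rewrite Nat.sub_0_r in Hj', El'.
    rewrite Hj in Hj'. injection Hj'; intros <- <-.
    rewrite map_app in El'. cbn [map] in El'.
    apply Agree in El'; auto. destruct El' as (-> & E1 & E2).
    left. rewrite Nat.add_0_r. cbn [tsubst]. rewrite map_app, map_Var_repl, <- E1.
    apply NoDup_app_inv in Nx.
    eapply unfolds_failure with (ss := ss) (ta := sg2) (v := v); eauto; try tauto.
    + intros x Hx. destruct (Hd x Hx) as [A1 A2]. split; auto. rewrite <- E2; auto.
    + intros x Hx. apply Dx, in_app_iff; auto.
Qed.
(** * Normal forms *)

(* [w] matches some pattern of [AP(b)], with variables as fresh as desired. *)
Definition clashes {F} (Rs : trs F) (b : term F) (w : term (hsym F)) : Prop :=
  forall V, exists v ta, AP Rs b v /\ NoDup (tvars v) /\ disjoint (tvars v) V /\ tsubst ta v = w.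

(** That [w] is reached from a hereditarily tame term excludes variables and terms stuck in a
    condition, for which neither alternative need hold. *)
Definition decided {F} (Rs : trs F) (w : term (hsym F)) : Prop :=
  forall b u e, wfF Rs b -> con_term Rs b -> linear b -> hered_tame Rs u -> cs_steps Rs (zeta Rs u) w e ->
  normal Rs w -> (exists sg, tsubst sg (xi Rs HTop b) = w) \/ clashes Rs b w.

Lemma normal_arg {F} (Rs : trs F) h pre t post :
  normal Rs (App h (pre ++ t :: post)) -> mu Rs h (S (length pre)) -> normal Rs t.
Proof. intros H M t' c Ht. eapply H. apply cs_step_arg; eauto. Qed.

Lemma normal_args {F} (Rs : trs F) f ts hs :
  normal Rs (App (HF f) (ts ++ hs)) -> length ts = ar Rs f -> Forall (normal Rs) ts.
Proof.
  intros H L. apply Forall_forall. intros t Ht. apply in_split in Ht. destruct Ht as (l1 & l2 & ->).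
  rewrite <- app_assoc in H. rewrite length_app in L. simpl in *. eapply normal_arg; eauto. simpl. lia.
Qed.

Lemma decide_args {F} (Rs : trs F) ts : Forall (decided Rs) ts -> forall bs us d,
  Forall (wfF Rs) bs -> Forall (con_term Rs) bs -> NoDup (lvars bs) -> length bs = length us ->
  Forall (hered_tame Rs) us -> args_reduce Rs us ts d -> Forall (normal Rs) ts ->
  (exists sg, map (tsubst sg) (map (xi Rs HTop) bs) = ts) \/
  (exists k b t, nth_error bs k = Some b /\ nth_error ts k = Some t /\ clashes Rs b t).
Proof.
  induction 1 as [| t ts Ht _ IH]; intros bs us d W C N L U A NF.
  - apply args_reduce_nil_inv in A. destruct A as [-> ->]. destruct bs; [| discriminate].
    left. exists Var. reflexivity.
  - apply args_reduce_cons_inv in A. destruct A as (u & us' & d1 & d2 & -> & -> & A1 & A2).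
    destruct bs as [| b bs]; [discriminate |]. simpl in L, N. injection L; intros L'.
    apply Forall_cons_iff in W, C, U, NF. destruct W, C, U, NF.
    assert (N' := N). apply NoDup_app_inv in N'. destruct N' as (N1 & N2 & N3).
    destruct (Ht b u d1) as [[sg E] | K]; auto.
    2: { right. exists 0, b, t. auto. }
    destruct (IH bs us' d2) as [[sg' E'] | (k & b' & t' & K1 & K2 & K3)]; auto.
    2: { right. exists (S k), b', t'. auto. }
    left. exists (override (tvars b) sg sg'). simpl. f_equal.
    + rewrite <- E. apply tsubst_ext. intros x Hx. rewrite tvars_xi in Hx. apply override_in; auto.
    + rewrite <- E'. apply map_tsubst_ext. intros x Hx.
      rewrite (lvars_map (xi Rs HTop)) in Hx by (intros; apply tvars_xi).
      apply override_out. intros Hx'. apply (N3 x); auto.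
Qed.

(** A surviving [HTop] would permit a step: once the arguments are decided, either the left-hand
    side of its rule matches and the rule starts, or a clash makes [step_bot] applicable. *)
Lemma normal_bits {F} (Rs : trs F) g us ts d :
  strong_cctrs Rs -> gsym_ok Rs g (length us) -> Forall (hered_tame Rs) us -> args_reduce Rs us ts d ->
  Forall (decided Rs) ts -> normal Rs (App (HF (erase_sym g)) (ts ++ bits g)) ->
  bits g = repeat (hc HBot) (msz Rs (erase_sym g)).
Proof.
  intros HR Hg Hu Hred HD HN.
  rewrite <- (gsym_ok_bits _ _ _ Hg).
  destruct g as [c | f R]; [reflexivity |]. simpl in HN |- *.
  assert (Lts : length ts = ar Rs f) by (rewrite <- (args_reduce_length _ _ _ _ Hred); apply Hg).
  enough (forall n, nth_error R n <> Some true) as HF.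
  { clear - HF. induction R as [| b R IH]; [reflexivity |]. simpl.
    assert (E := HF 0). destruct b; [exfalso; apply E; reflexivity |]. f_equal. apply IH.
    intros n. apply (HF (S n)). }
  intros n Hn. destruct Hg as (_ & LR & Lus).
  destruct (nth_error (rules Rs f) n) as [rho |] eqn:Hrho.
  2: { apply nth_error_None in Hrho. unfold msz in LR.
       assert (n < length R) by (apply nth_error_Some; congruence). lia. }
  assert (HA : rule_at Rs f (S n) rho) by (split; [lia |]; simpl; rewrite Nat.sub_0_r; auto).
  assert (Hok := rule_at_ok _ _ _ _ HR HA).
  assert (Hhs : length (map (@bit2h F) R) = msz Rs f) by (rewrite length_map; auto).
  assert (Htop : nth_error (map (@bit2h F) R) (S n - 1) = Some (hc HTop)).
  { simpl. rewrite Nat.sub_0_r, nth_error_map, Hn. reflexivity. }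
  destruct (decide_args Rs ts HD (r_lhs rho) us d) as [[sg E] | (k & l & t & K1 & K2 & K3)]; auto; try apply Hok.
  - rewrite Lus. apply Hok.
  - eapply normal_args; eauto.
  - change (map (tsubst sg) (Lh Rs rho) = ts) in E. rewrite <- E in HN.
    destruct (r_conds rho) as [| [a b] cs] eqn:Ek.
    + eapply HN, step_plain; eauto.
    + eapply HN, step_start; eauto. rewrite Ek. reflexivity.
  - destruct (K3 (rvars rho)) as (v & ta & V1 & V2 & V3 & V4).
    eapply HN, step_bot with (j := S k) (v := v) (ta := ta); eauto; [lia | |]; simpl; rewrite Nat.sub_0_r; eauto.
    rewrite V4; auto.
Qed.

(** Equal roots reduce the question to the arguments, where a clash is lifted by [ap_arg]; different
    roots give a clash at once. *)
Lemma all_decided {F} (Rs : trs F) : strong_cctrs Rs -> forall w, decided Rs w.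
Proof.
  intros HR. induction w as [x | h ts IH] using term_nested_ind; intros b u e W C N U HS NF.
  - destruct (hered_tame_tame _ _ U _ _ HS) as (_ & H & _).
    destruct (H NF) as (f & ts & E); discriminate.
  - destruct b as [x | f bs]; [left; exists (fun _ => App h ts); reflexivity |].
    destruct (hered_tame_tame _ _ U _ _ HS) as (H1 & H2 & _).
    destruct (H2 NF) as (f0 & ts0 & E). injection E; intros -> ->; clear E.
    destruct (H1 _ _ eq_refl) as (g & us & ts1 & c & d & S1 & S2 & S3 & S4 & _). subst f0 ts0.
    assert (U' := hered_tame_sim _ _ _ _ U S1).
    destruct (ground_ok_inv _ _ _ (proj1 U')) as [Hg _].
    apply hered_tame_args in U'. apply Forall_app in IH. destruct IH as [IH _].
    assert (Lts : length ts1 = ar Rs (erase_sym g)).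
    { rewrite <- (args_reduce_length _ _ _ _ S4). apply gsym_ok_arity; auto. }
    (* [ap_def] only covers defined symbols whose bits are all [HBot], so no rule may be left to
       try. *)
    assert (Hb := normal_bits Rs g us ts1 d HR Hg U' S4 IH NF).
    assert (NFs := normal_args _ _ _ _ NF Lts).
    apply all_syms_inv in W, C. destruct W as [W1 W2], C as [C1 C2].
    assert (Hm : msz Rs f = 0) by (unfold msz; rewrite C1; reflexivity).
    destruct (classic (erase_sym g = f)) as [Ef | Ef].
    + rewrite Ef, Hm in *. simpl in Hb. rewrite Hb, app_nil_r in *.
      destruct (decide_args Rs ts1 IH bs us d) as [[sg E] | (k & b & t & K1 & K2 & K3)]; auto.
      * apply gsym_ok_arity in Hg. congruence.
      * left. exists sg. simpl. rewrite map_app, E, Hm. simpl. rewrite app_nil_r. reflexivity.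
      * right. intros V. destruct (K3 V) as (v & ta & V1 & V2 & V3 & V4).
        destruct (fresh_variables (V ++ tvars v) ts1) as (xs & gg & X1 & X2 & X3 & X4).
        assert (Hv : tvars (App (HF f) (repl (map Var xs) (S k) [v])) = firstn k xs ++ tvars v ++ skipn (S k) xs).
        { replace k with (S k - 1) at 2 by lia. rewrite <- lvars_repl_Var. reflexivity. }
        exists (App (HF f) (repl (map Var xs) (S k) [v])), (override (tvars v) ta gg).
        rewrite Hv. split; [| split; [| split]].
        -- apply ap_arg with (ti := b); auto; [lia | simpl; rewrite Nat.sub_0_r; auto | congruence].
        -- replace k with (S k - 1) at 1 by lia. apply NoDup_hole; auto; [lia |].
           intros x Hx Hx'. apply (X3 x Hx), in_app_iff; auto.
        -- intros x Hx Hx'. rewrite !in_app_iff in Hx. destruct Hx as [Hx | [Hx | Hx]].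
           ++ apply in_firstn in Hx. apply (X3 x Hx), in_app_iff; auto.
           ++ apply (V3 x); auto.
           ++ apply in_skipn in Hx. apply (X3 x Hx), in_app_iff; auto.
        -- cbn [tsubst]. f_equal. rewrite map_Var_repl. cbn [map].
           replace (tsubst (override (tvars v) ta gg) v) with t.
           2: { rewrite <- V4. apply tsubst_ext. intros; symmetry; apply override_in; auto. }
           replace (map (override (tvars v) ta gg) xs) with ts1.
           2: { rewrite <- X4. apply map_ext_in. intros x Hx. symmetry. apply override_out. intros Hx'.
                apply (X3 x Hx), in_app_iff; auto. }
           apply repl_self; [lia |]. simpl. rewrite Nat.sub_0_r. auto.
    + right. intros V. destruct (fresh_variables V ts1) as (xs & gg & X1 & X2 & X3 & X4).
      assert (E : map (tsubst gg) (map Var xs) = ts1) by (rewrite map_map; exact X4).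
      assert (Hrep : forall m, map (tsubst gg) (repeat (@hc F HBot) m) = repeat (hc HBot) m).
      { intros m. rewrite map_repeat. reflexivity. }
      destruct (classic (constructor Rs (erase_sym g))) as [Hc | Hc].
      * exists (App (HF (erase_sym g)) (map Var xs)), gg.
        assert (Hv : tvars (App (HF (erase_sym g)) (map Var xs)) = xs) by apply lvars_Var.
        rewrite Hv. split; [apply ap_con; auto; congruence |]. split; auto. split; auto.
        cbn [tsubst]. rewrite E, Hb. unfold msz. rewrite Hc. simpl. rewrite app_nil_r. reflexivity.
      * exists (App (HF (erase_sym g)) (map Var xs ++ repeat (hc HBot) (msz Rs (erase_sym g)))), gg.
        assert (Hv : tvars (App (HF (erase_sym g)) (map Var xs ++ repeat (hc HBot) (msz Rs (erase_sym g)))) = xs).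
        { change (lvars (map Var xs ++ repeat (@hc F HBot) (msz Rs (erase_sym g))) = xs).
          rewrite lvars_app, lvars_Var. generalize (msz Rs (erase_sym g)). induction n; simpl; auto using app_nil_r. }
        rewrite Hv. split; [apply ap_def; auto; congruence |]. split; auto. split; auto.
        cbn [tsubst]. rewrite map_app, E, Hrep, Hb. reflexivity.
Qed.

(** * Terminating terms *)

Lemma cs_step_inv {F} (Rs : trs F) t t' c :
  cs_step Rs t t' c -> root_step Rs t t' c \/
  exists h pre u u' post, t = App h (pre ++ u :: post) /\ t' = App h (pre ++ u' :: post) /\
    mu Rs h (S (length pre)) /\ cs_step Rs u u' c.
Proof.
  intros H. destruct H as [l r c sg H | h ts p t t' c M Ht H].
  - left. exists l, r, sg. auto.
  - right. destruct (nth_error_split_at _ _ _ Ht) as [E L].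
    assert (Hp : S (p - 1) = p) by (destruct h; simpl in M; try tauto; lia).
    exists h, (firstn (p - 1) ts), t, t', (skipn (S (p - 1)) ts). rewrite L, Hp. rewrite Hp in E.
    split; [f_equal; exact E |]. split; auto. f_equal.
    rewrite set_nth_firstn_skipn, Hp; auto. apply nth_error_Some. congruence.
Qed.

Definition args_step {F} (Rs : trs F) (ts ts' : list (term (hsym F))) : Prop :=
  exists pre u u' post, ts = pre ++ u :: post /\ ts' = pre ++ u' :: post /\ csr Rs u u'.

Lemma app_split_left {A} (pre post ts hs : list A) u :
  pre ++ u :: post = ts ++ hs -> length pre < length ts ->
  exists post', ts = pre ++ u :: post' /\ post = post' ++ hs.
Proof.
  revert ts; induction pre; intros [| t ts]; simpl; intros E L; try lia.
  - injection E; intros -> ->. eauto.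
  - injection E; intros E1 ->. destruct (IHpre ts E1) as (p & -> & ->); [lia | eauto].
Qed.

Lemma args_reduce_step {F} (Rs : trs F) us pre u post d u' c :
  args_reduce Rs us (pre ++ u :: post) d -> cs_step Rs u u' c -> args_reduce Rs us (pre ++ u' :: post) (d + c).
Proof.
  revert us d; induction pre as [| t pre IH]; simpl; intros us d H Hc;
    apply args_reduce_cons_inv in H; destruct H as (v & us' & d1 & d2 & -> & -> & H1 & H2).
  - replace (d1 + d2 + c) with (d1 + c + d2) by lia. constructor; auto.
    eapply cs_steps_trans; eauto. apply cs_steps_one; auto.
  - rewrite <- Nat.add_assoc. constructor; auto.
Qed.

Lemma defined_step_inv {F} (Rs : trs F) f us ts hs d t c :
  length us = ar Rs f -> args_reduce Rs us ts d -> cs_step Rs (App (HF f) (ts ++ hs)) t c ->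
  root_step Rs (App (HF f) (ts ++ hs)) t c \/
  exists ts', t = App (HF f) (ts' ++ hs) /\ args_reduce Rs us ts' (d + c) /\ args_step Rs ts ts'.
Proof.
  intros L A H. apply cs_step_inv in H. destruct H as [H | (h & pre & u & u' & post & E1 & -> & M & H)]; auto.
  right. injection E1; intros E <-. symmetry in E. simpl in M.
  apply app_split_left in E; [| rewrite <- (args_reduce_length _ _ _ _ A), L; lia].
  destruct E as (post' & -> & ->). exists (pre ++ u' :: post').
  split; [rewrite <- app_assoc; reflexivity |]. split; [eapply args_reduce_step; eauto |].
  exists pre, u, u', post'. split; auto. split; auto. exists c; auto.
Qed.

Lemma aux_step_inv {F} (Rs : trs F) f i rho hs sg j w t c :
  strong_cctrs Rs -> rule_at Rs f i rho -> length hs = msz Rs f -> j <= length (r_conds rho) ->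
  cs_step Rs (App (HAux f i (S j)) (aux_args Rs rho hs i sg j w)) t c ->
  root_step Rs (App (HAux f i (S j)) (aux_args Rs rho hs i sg j w)) t c \/
  exists w', t = App (HAux f i (S j)) (aux_args Rs rho hs i sg j w') /\ cs_step Rs w w' c.
Proof.
  intros HR Hrho Hhs Hj H. apply cs_step_inv in H.
  destruct H as [H | (h & pre & u & u' & post & E1 & -> & M & H)]; auto.
  right. injection E1; intros E <-.
  destruct (aux_args_split Rs f i rho hs Hrho Hhs sg j Hj) as (pre' & post' & L & E').
  { apply (rule_at_ok _ _ _ _ HR Hrho). }
  rewrite E' in E. simpl in M. destruct Hrho.
  apply app_inj_length in E; [| lia]. destruct E as [-> E]. injection E; intros -> ->.
  exists u'. rewrite E'. auto.
Qed.

Lemma aux_normal {F} (Rs : trs F) f i rho hs sg j w :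
  strong_cctrs Rs -> rule_at Rs f i rho -> length hs = msz Rs f -> j <= length (r_conds rho) ->
  normal Rs (App (HAux f i (S j)) (aux_args Rs rho hs i sg j w)) -> normal Rs w.
Proof.
  intros HR Hrho Hhs Hj H w' c Hw.
  destruct (aux_args_split Rs f i rho hs Hrho Hhs sg j Hj) as (pre' & post' & L & E').
  { apply (rule_at_ok _ _ _ _ HR Hrho). }
  rewrite E' in H. eapply H. apply cs_step_arg; eauto. simpl. destruct Hrho. lia.
Qed.

Lemma sim_lstep {F} (Rs : trs F) s s0 s1 c0 c1 :
  sim Rs s s0 c0 -> lstep Rs s0 s1 c1 -> ground_ok Rs s1 -> cs_plus Rs (zeta Rs s0) (zeta Rs s1) ->
  sim Rs s s1 (c0 + c1).
Proof.
  intros H1 H2 H3 H4. eapply sim_trans; eauto. split; [apply H1 |]. split; auto.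
  split; [apply lsteps_one; auto | apply cs_plus_steps; auto].
Qed.

Definition descends_plus {F} (Rs : trs F) t t' : Prop :=
  exists t1, descends Rs t t1 /\ descends_star Rs t1 t'.

Lemma descends_plus_star {F} (Rs : trs F) a b c :
  descends_plus Rs a b -> descends_star Rs b c -> descends_plus Rs a c.
Proof. intros (t & H1 & H2) H. exists t. split; auto. eapply rt_trans; eauto. Qed.

Lemma descends_star_step {F} (Rs : trs F) a b c :
  descends_star Rs a b -> descends Rs b c -> descends_plus Rs a c.
Proof.
  intros H Hs. apply clos_rt_rt1n in H. destruct H as [| t1 t2 H1 H2].
  - exists c. split; auto. apply rt_refl.
  - exists t1. split; auto. eapply rt_trans; [apply clos_rt1n_rt; eauto | apply rt_step; auto].
Qed.

Lemma cs_plus_descends {F} (Rs : trs F) a b : cs_plus Rs a b -> descends_plus Rs a b.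
Proof.
  intros (t & c1 & c2 & H1 & H2). exists t. split; [left; exists c1; auto | eapply cs_steps_descends; eauto].
Qed.

Lemma descends_star_plus {F} (Rs : trs F) a b c :
  descends_star Rs a b -> descends_plus Rs b c -> descends_plus Rs a c.
Proof.
  intros H (t & H1 & H2). eapply descends_plus_star; [eapply descends_star_step; eauto | auto].
Qed.

(** The replayed redex reaches the corresponding [HAux] term, in which the instance of [a] is the
    active argument. So tameness of the condition comes from the induction hypothesis. *)
Lemma condition_descends {F} (Rs : trs F) s f R i rho j a b ss sg w N :
  strong_cctrs Rs -> waiting Rs s f R i rho j a b ss sg w N ->
  ground_ok Rs (tsubst ss (label Rs a)) /\
  descends_plus Rs (zeta Rs s) (zeta Rs (tsubst ss (label Rs a))).
Proof.
  intros HR (d & c0 & cs & e & Hcm & Hd & Hj & He & HN).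
  assert (Hrho := cm_rule _ _ _ _ _ _ _ _ _ _ Hcm).
  assert (Hok := rule_at_ok _ _ _ _ HR Hrho).
  destruct (cm_bits _ _ _ _ _ _ _ _ _ _ Hcm) as (B1 & B2 & B3 & B4 & B5).
  assert (Hlen : length (r_lhs rho) = ar Rs f) by apply Hok.
  split.
  - apply ground_ok_subst.
    + apply wfG_label. exact (proj1 (rule_ok_wf_cond _ _ _ Hok _ _ (nth_error_In _ _ Hj))).
    + intros x Hx. rewrite tvars_label in Hx. apply (cm_ground _ _ _ _ _ _ _ _ _ _ Hcm).
      eapply incl_cond_matched; eauto.
  - destruct (cm_lhs _ _ _ _ _ _ _ _ _ _ Hcm) as (_ & _ & _ & ch & Hch).
    eapply descends_star_plus; [eapply cs_steps_descends; exact Hch |].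
    rewrite zeta_app, zeta_lhsG, zeta_subst_label.
    eapply descends_plus_star; [apply cs_plus_descends; eapply condition_reached; eauto; eapply cm_cs_steps; eauto |].
    apply rt_step. right.
    assert (Hj' : j <= length (r_conds rho)) by (apply (cm_le _ _ _ _ _ _ _ _ _ _ Hcm)).
    match goal with |- active_arg _ (App _ (aux_args _ _ ?hs _ ?sg' _ _)) _ =>
      destruct (aux_args_split Rs f i rho hs Hrho B1 sg' j Hj' Hlen) as (pre & post & L & E) end.
    rewrite E. exists (HAux f i (S j)), pre, post. split; auto. simpl. lia.
Qed.

Lemma waiting_not_normal {F} (Rs : trs F) s f R i rho j a b ss sg w N :
  strong_cctrs Rs -> waiting Rs s f R i rho j a b ss sg w N -> hered_tame Rs (tsubst ss (label Rs a)) ->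
  ~ normal Rs (App (HAux f i (S j)) (aux_args Rs rho (map bit2h R) i sg j w)).
Proof.
  intros HR (d & c0 & cs & e & Hcm & Hd & Hj & He & HN) Ha NF.
  assert (Hrho := cm_rule _ _ _ _ _ _ _ _ _ _ Hcm).
  assert (Hok := rule_at_ok _ _ _ _ HR Hrho).
  destruct (cm_bits _ _ _ _ _ _ _ _ _ _ Hcm) as (B1 & B2 & B3 & B4 & B5).
  assert (Hab := nth_error_In _ _ Hj).
  assert (NFw := aux_normal _ _ _ _ _ _ _ _ HR Hrho B1 (cm_le _ _ _ _ _ _ _ _ _ _ Hcm) NF).
  destruct (all_decided Rs HR w b (tsubst ss (label Rs a)) e) as [[sg2 E] | K]; auto.
  - eapply rule_ok_wf_cond; eauto.
  - eapply rule_ok_con_cond; eauto.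
  - eapply rule_ok_linear_cond; eauto.
  - set (sg' := override (tvars b) sg2 sg).
    assert (ND := NoDup_matched_vars _ _ _ Hok (S j)). erewrite matched_vars_S in ND by eauto.
    apply NoDup_app_inv in ND. destruct ND as (_ & _ & ND).
    rewrite (aux_args_ext Rs rho _ i sg sg') in NF.
    2: { intros x Hx. symmetry. apply override_out. intros Hx'. apply (ND x); auto. }
    replace w with (tsubst sg' (xi Rs HTop b)) in NF.
    2: { rewrite <- E. apply tsubst_ext. intros x Hx. rewrite tvars_xi in Hx. apply override_in; auto. }
    destruct (nth_error (r_conds rho) (S j)) as [[a' b'] |] eqn:Hj'.
    + eapply NF, step_next; eauto.
    + eapply NF, step_finish; eauto. apply nth_error_None in Hj'.
      assert (j < length (r_conds rho)) by (apply nth_error_Some; congruence). lia.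
  - destruct (K (rvars rho)) as (v & ta & V1 & V2 & V3 & <-).
    eapply NF, step_fail; eauto.
Qed.

(** The part of [tame] that is proved first; [cost_reached] follows from it by applying it to an
    extension of the reduction that ends in a normal form. *)
Definition outcome {F} (Rs : trs F) s t N : Prop :=
  head_exposed Rs s t N /\ (normal Rs t -> exists f ts, t = App (HF f) ts).

Section Induction.
Context {F : Type} (Rs : trs F) (HR : strong_cctrs Rs) (g : gsym F) (us : list (term (gsym F))).
Context (Hs : ground_ok Rs (App g us)).
Context (IH : forall s', ground_ok Rs s' -> descends_plus Rs (zeta Rs (App g us)) (zeta Rs s') -> hered_tame Rs s').

Lemma outcome_unfolds t1 t N1 N2 :
  unfolds Rs (App g us) t1 N1 -> cs_steps Rs t1 t N2 -> outcome Rs (App g us) t (N1 + N2).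
Proof using IH.
  intros (s0 & s1 & c0 & c1 & d & H1 & H2 & H3 & H4 & H5 & H6) H7.
  assert (Hsim := sim_lstep _ _ _ _ _ _ H1 H2 H3 H4).
  assert (T : hered_tame Rs s1).
  { apply IH; auto. destruct H1 as (_ & _ & _ & c' & H1).
    eapply descends_star_plus; [eapply cs_steps_descends; eauto | apply cs_plus_descends; auto]. }
  destruct (hered_tame_tame _ _ T _ _ (cs_steps_trans _ _ _ _ _ _ H5 H7)) as (T1 & T2 & _).
  split; auto. intros f ts E. destruct (T1 f ts E) as (g' & us' & ts1 & c & d' & A1 & A2 & A3 & A4 & A5).
  exists g', us', ts1, (c0 + c1 + c), d'. split; [eapply sim_trans; eauto |]. repeat split; auto. lia.
Qed.

(** A reduction ending inside a condition has no exposed head to explain and is not normal.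
    Otherwise a root step leaves through [unfolds] or passes to the next condition, with the cost
    gathered in [N1]. *)
Lemma outcome_waiting t1 t N2 :
  cs_steps Rs t1 t N2 -> forall f R i rho j a b ss sg w N1,
  t1 = App (HAux f i (S j)) (aux_args Rs rho (map bit2h R) i sg j w) ->
  waiting Rs (App g us) f R i rho j a b ss sg w N1 -> outcome Rs (App g us) t (N1 + N2).
Proof using HR IH.
  induction 1 as [t | t1 t2 t3 c1 c2 H1 H2 IHs]; intros f R i rho j a b ss sg w N1 -> HW;
    destruct (condition_descends _ _ _ _ _ _ _ _ _ _ _ _ _ HR HW) as [Ga Da];
    assert (Ha := IH _ Ga Da).
  - split; [intros f' ts E; discriminate |]. intros NF. exfalso. eapply waiting_not_normal; eauto.
  - assert (HW' := HW). destruct HW' as (d & c0 & cs & e & Hcm & _).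
    rewrite Nat.add_assoc.
    apply aux_step_inv in H1; auto; [| apply Hcm | apply (cm_bits _ _ _ _ _ _ _ _ _ _ Hcm) | apply Hcm].
    destruct H1 as [H1 | (w' & -> & H1)].
    + destruct (root_step_waiting _ _ _ _ _ _ _ _ _ _ _ _ _ _ _ HR HW Ha H1)
        as [HU | (a' & b' & ss' & sg' & w' & HW' & ->)].
      * eapply outcome_unfolds; eauto.
      * eapply IHs; eauto.
    + eapply IHs; eauto. eapply waiting_step; eauto.
Qed.

Lemma args_hered_tame : Forall (hered_tame Rs) us.
Proof using Hs IH.
  destruct (ground_ok_inv _ _ _ Hs) as [Hg Hu]. apply Forall_forall. intros u Hin. apply IH.
  - rewrite Forall_forall in Hu; auto.
  - eapply descends_star_step; [apply rt_refl |]. right. apply active_arg_zeta; auto.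
Qed.

Lemma outcome_defined t1 t N2 :
  cs_steps Rs t1 t N2 -> forall ts d, t1 = App (HF (erase_sym g)) (ts ++ bits g) ->
  args_reduce Rs us ts d -> outcome Rs (App g us) t (d + N2).
Proof using HR Hs IH.
  destruct (ground_ok_inv _ _ _ Hs) as [Hg _]. assert (Hu := args_hered_tame).
  induction 1 as [t | t1 t2 t3 c1 c2 H1 H2 IHs]; intros ts d -> Hred.
  - split; [| eauto]. intros f ts' E. injection E; intros <- <-.
    exists g, us, ts, 0, d. split; [apply sim_refl; auto |]. repeat split; auto. lia.
  - rewrite Nat.add_assoc. eapply defined_step_inv in H1; eauto; [| apply gsym_ok_arity; auto].
    destruct H1 as [H1 | (ts' & -> & H1 & _)]; [| eapply IHs; eauto].
    destruct (root_step_defined _ _ _ _ _ _ _ HR Hg Hu Hred H1)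
      as [HU | (f & R & i & rho & a & b & ss & sg & w & HW & ->)].
    + eapply outcome_unfolds; eauto.
    + eapply outcome_waiting; eauto.
Qed.

Lemma outcome_zeta t N : cs_steps Rs (zeta Rs (App g us)) t N -> outcome Rs (App g us) t N.
Proof using HR Hs IH.
  intros H. rewrite zeta_app in H. change N with (0 + N). eapply outcome_defined; eauto.
  apply args_reduce_refl.
Qed.
End Induction.

Lemma cost_reached_args {F} (Rs : trs F) us ts d :
  args_reduce Rs us ts d -> Forall (hered_tame Rs) us -> exists us' c, sims Rs us us' c /\ d <= c.
Proof.
  induction 1 as [| u us t ts d n H _ IH]; intros Hu.
  - exists [], 0. split; [constructor | lia].
  - apply Forall_cons_iff in Hu. destruct Hu as [H1 H2]. destruct (IH H2) as (us' & c & A1 & A2).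
    destruct (hered_tame_tame _ _ H1 _ _ H) as (_ & _ & u' & c' & B1 & B2).
    exists (u' :: us'), (c' + c). split; [constructor; auto | lia].
Qed.

(** * Strong normalization and the main induction *)

Definition sn {F} (Rs : trs F) (t : term (hsym F)) : Prop := Acc (fun y x => csr Rs x y) t.

Lemma sn_normal_form {F} (Rs : trs F) t : sn Rs t -> exists t' N, cs_steps Rs t t' N /\ normal Rs t'.
Proof.
  induction 1 as [t _ IH]. destruct (classic (exists t1, csr Rs t t1)) as [[t1 [c H]] | H].
  - destruct (IH t1) as (t' & N & H1 & H2); [exists c; auto |].
    exists t', (c + N). split; auto. econstructor; eauto.
  - exists t, 0. split; [constructor |]. intros t' c H'. apply H. exists t', c; auto.
Qed.

Lemma sn_steps {F} (Rs : trs F) t t' c : sn Rs t -> cs_steps Rs t t' c -> sn Rs t'.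
Proof. intros H. induction 1; auto. apply IHcs_steps. eapply Acc_inv; eauto. eexists; eauto. Qed.

(* A step below an active position is a step of the whole term, so adding the active
   argument relation preserves well-foundedness. *)
Lemma sn_descends {F} (Rs : trs F) t : sn Rs t -> Acc (fun y x => descends Rs x y) t.
Proof.
  (* Nested induction on [C u] and on [u]: a step in [u] is a step of [C u], and passing to an
     active argument makes [u] smaller while [C] absorbs the rest. *)
  intros H. enough (forall u C, t = C u -> (forall u1 u2, csr Rs u1 u2 -> csr Rs (C u1) (C u2)) ->
    Acc (fun y x => descends Rs x y) u) as HE by (apply (HE t (fun u => u)); auto).
  induction H as [t _ IH]. intros u. induction u as [x | h ts IHu] using term_nested_ind; intros C -> HC.
  - constructor. intros y [Hy | (h & pre & post & E & _)]; [| discriminate].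
    apply (IH (C y)) with (C := C); auto.
  - constructor. intros y [Hy | (h' & pre & post & E & M)].
    + apply (IH (C y)) with (C := C); auto.
    + injection E; intros -> <-. apply Forall_app in IHu. destruct IHu as [_ IHu].
      apply Forall_cons_iff in IHu. apply (proj1 IHu) with (C := fun y => C (App h (pre ++ y :: post))); auto.
      intros u1 u2 [c Hc]. apply HC. exists c. apply cs_step_arg; auto.
Qed.

Lemma sn_hered_tame {F} (Rs : trs F) s :
  strong_cctrs Rs -> ground_ok Rs s -> sn Rs (zeta Rs s) -> hered_tame Rs s.
Proof.
  intros HR Hg Hsn. apply sn_descends in Hsn.
  enough (forall t, Acc (fun y x => descends Rs x y) t -> forall s', ground_ok Rs s' -> descends_star Rs t (zeta Rs s') ->
    tame Rs s') as HE by (split; auto; intros; eapply HE; eauto).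
  clear s Hg Hsn. induction 1 as [t Ht IH]. intros s Hg Hts.
  assert (IHp : forall s', ground_ok Rs s' -> descends_plus Rs t (zeta Rs s') -> hered_tame Rs s').
  { intros s' G (t1 & D1 & D2). split; auto. intros s2 G2 D3. eapply IH; eauto. eapply rt_trans; eauto. }
  assert (IHs : forall s', ground_ok Rs s' -> descends_plus Rs (zeta Rs s) (zeta Rs s') -> hered_tame Rs s').
  { intros s' G D. apply IHp; auto. eapply descends_star_plus; eauto. }
  assert (Hsn : sn Rs (zeta Rs s)).
  { assert (HA : Acc (fun y x => descends Rs x y) (zeta Rs s)).
    { clear - Ht Hts. assert (HA : Acc (fun y x => descends Rs x y) t) by (constructor; auto). clear Ht.
      apply clos_rt_rt1n in Hts. induction Hts; auto. apply IHHts. eapply Acc_inv; eauto. }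
    clear - HA. induction HA as [t _ IH]. constructor. intros y Hy. apply IH. left; auto. }
  intros t' N HN. destruct s as [x | g us]; [inversion Hg |].
  destruct (outcome_zeta Rs HR g us Hg IHs _ _ HN) as [O1 O2]. split; [auto |]. split; [auto |].
  (* [t'] itself may be inside a condition, so the reduction is prolonged to a normal form [t2]. Its
     root is [HF], its arguments are explained, and their debts, together with [c], cover even
     [N + N2]. *)
  destruct (sn_normal_form Rs t' (sn_steps _ _ _ _ Hsn HN)) as (t2 & N2 & H2 & NF).
  destruct (outcome_zeta Rs HR g us Hg IHs _ _ (cs_steps_trans _ _ _ _ _ _ HN H2)) as [O3 O4].
  destruct (O4 NF) as (f & ts & E). destruct (O3 f ts E) as (g' & us' & ts1 & c & d & A1 & _ & _ & A4 & A5).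
  assert (G' := proj1 (proj2 A1)). destruct (ground_ok_inv _ _ _ G') as [Gg Gu].
  destruct (cost_reached_args Rs us' ts1 d A4) as (us2 & c2 & B1 & B2).
  { apply Forall_forall. intros u Hu. apply IHs; [rewrite Forall_forall in Gu; auto |].
    destruct A1 as (_ & _ & _ & c' & A1).
    eapply descends_star_step; [eapply cs_steps_descends; eauto |]. right. apply active_arg_zeta; auto. }
  exists (App g' us2), (c + c2). split; [| lia]. eapply sim_trans; eauto. apply sim_app; auto.
Qed.
(** * Infinite reductions *)

Lemma dependent_choice {A} (R : A -> A -> Prop) (P : A -> Prop) x :
  (forall y, P y -> exists z, R y z /\ P z) -> P x -> exists g, g 0 = x /\ forall n : nat, R (g n) (g (S n)).
Proof.
  intros H Hx.
  assert (H' : forall y : {y | P y}, exists z : {z | P z}, R (proj1_sig y) (proj1_sig z)).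
  { intros [y Hy]. destruct (H y Hy) as (z & Hz & Pz). exists (exist _ z Pz). exact Hz. }
  set (next := fun y => proj1_sig (constructive_indefinite_description _ (H' y))).
  exists (fun n => proj1_sig (nat_rect (fun _ => {y | P y}) (exist _ x Hx) (fun _ => next) n)).
  split; [reflexivity |]. intros n. apply (proj2_sig (constructive_indefinite_description _ (H' _))).
Qed.

Lemma sn_of_terminating {F} (Rs : trs F) t : cs_terminating Rs t -> sn Rs t.
Proof.
  intros H. apply NNPP. intros Hn. apply H.
  apply (dependent_choice (csr Rs) (fun y => ~ sn Rs y)); auto.
  intros y Hy. apply NNPP. intros Hz. apply Hy. constructor. intros z Hyz.
  apply NNPP. intros Hz'. apply Hz. exists z. auto.
Qed.

Lemma not_sn_of_infinite {F} (Rs : trs F) t : cs_infinite Rs t -> ~ sn Rs t.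
Proof.
  intros (g & E & Hg) H. revert g E Hg. induction H as [t _ IH]. intros g <- Hg.
  apply (IH (g 1)) with (g := fun n => g (S n)); auto. apply Hg.
Qed.

(** Nested induction on the termination of the head and of the tail, since steps in the two may be
    interleaved arbitrarily. *)
Lemma args_step_wf {F} (Rs : trs F) ts : Forall (sn Rs) ts -> Acc (fun y x => args_step Rs x y) ts.
Proof.
  induction 1 as [| t ts Ht _ IH].
  - constructor. intros y (pre & u & u' & post & E & _). destruct pre; discriminate.
  - revert ts IH. induction Ht as [t _ IHt]. intros ts IH. induction IH as [ts Hts IHts].
    constructor. intros y (pre & u & u' & post & E & -> & Hu). destruct pre as [| t' pre].
    + injection E; intros <- <-. apply IHt; auto. constructor; auto.
    + injection E; intros E' <-. simpl. apply IHts. exists pre, u, u', post. auto.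
Qed.

Definition lred {F} (Rs : trs F) s s' : Prop := (exists c, lstep Rs s s' c) \/ lcond Rs s s'.

Definition lred_plus {F} (Rs : trs F) := clos_trans _ (lred Rs).

Lemma lsteps_lred_plus {F} (Rs : trs F) s s0 s1 c :
  lsteps Rs s s0 c -> lred Rs s0 s1 -> lred_plus Rs s s1.
Proof.
  induction 1; intros H1; [apply t_step; auto |]. eapply t_trans; [apply t_step | apply IHlsteps; auto].
  left; eauto.
Qed.

Section InfiniteReductions.
Context {F : Type} (Rs : trs F) (HR : strong_cctrs Rs) (g : gsym F) (us : list (term (gsym F))).
Context (Hs : ground_ok Rs (App g us)) (Hus : Forall (fun u => sn Rs (zeta Rs u)) us).
Context (IH : forall s', lred_plus Rs (App g us) s' -> ground_ok Rs s' -> sn Rs (zeta Rs s')).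

Lemma unfolds_sn t N : unfolds Rs (App g us) t N -> sn Rs t.
Proof using IH.
  intros (s0 & s1 & c0 & c1 & d & (_ & _ & H1 & _) & H2 & H3 & H4 & H5 & H6).
  eapply sn_steps; eauto. apply IH; auto. eapply lsteps_lred_plus; eauto. left; eauto.
Qed.

(** The condition instance is a successor through [lcond], so it terminates by hypothesis, and
    termination makes it hereditarily tame. *)
Lemma condition_sn f R i rho j a b ss sg w N :
  waiting Rs (App g us) f R i rho j a b ss sg w N -> hered_tame Rs (tsubst ss (label Rs a)) /\ sn Rs w.
Proof using HR IH.
  intros HW. destruct (condition_descends _ _ _ _ _ _ _ _ _ _ _ _ _ HR HW) as [Ga _].
  destruct HW as (d & c0 & cs & e & Hcm & Hd & Hj & He & HN).
  assert (Hsn : sn Rs (zeta Rs (tsubst ss (label Rs a)))).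
  { apply IH; auto. destruct (cm_lhs _ _ _ _ _ _ _ _ _ _ Hcm) as (_ & _ & H1 & _).
    eapply lsteps_lred_plus; eauto. right. eexists. split; [apply st_refl |].
    destruct (cm_lsteps _ _ _ _ _ _ _ _ _ _ Hcm) as [L1 L2].
    eapply lc_intro; eauto; [apply (cm_rule _ _ _ _ _ _ _ _ _ _ Hcm) | apply (cm_bit _ _ _ _ _ _ _ _ _ _ Hcm)]. }
  split; [apply sn_hered_tame; auto | eapply sn_steps; eauto].
Qed.

(** [m] bounds the number of conditions left. Within one condition the induction is on the
    termination of [w], so the reduction can neither stay in a condition nor pass through conditions
    forever. *)
Lemma waiting_sn f R i rho m : forall j a b ss sg w N,
  waiting Rs (App g us) f R i rho j a b ss sg w N -> length (r_conds rho) <= m + j ->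
  sn Rs (App (HAux f i (S j)) (aux_args Rs rho (map bit2h R) i sg j w)).
Proof using HR IH.
  induction m as [| m IHm]; intros j a b ss sg w N HW Hm.
  - destruct HW as (d & c0 & cs & e & Hcm & Hd & Hj & He & HN).
    assert (j < length (r_conds rho)) by (apply nth_error_Some; congruence). lia.
  - destruct (condition_sn _ _ _ _ _ _ _ _ _ _ _ HW) as [Ha Hw].
    revert N HW. induction Hw as [w _ IHw]. intros N HW. constructor. intros t [c Ht].
    assert (HW' := HW). destruct HW' as (d & c0 & cs & e & Hcm & _).
    apply aux_step_inv in Ht; auto; [| apply Hcm | apply (cm_bits _ _ _ _ _ _ _ _ _ _ Hcm) | apply Hcm].
    destruct Ht as [Ht | (w' & -> & Ht)].
    + destruct (root_step_waiting _ _ _ _ _ _ _ _ _ _ _ _ _ _ _ HR HW Ha Ht)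
        as [HU | (a' & b' & ss' & sg' & w' & HW' & ->)].
      * eapply unfolds_sn; eauto.
      * eapply IHm; eauto. lia.
    + eapply IHw; [exists c; eauto | eapply waiting_step; eauto].
Qed.

(** The arguments can only be reduced finitely often before a root step, and a root step leads
    either to a reduct of a successor or into a condition. Both terminate. *)
Lemma successors_sn : sn Rs (zeta Rs (App g us)).
Proof using HR Hs Hus IH.
  destruct (ground_ok_inv _ _ _ Hs) as [Hg Hu].
  assert (HT : Forall (hered_tame Rs) us).
  { rewrite Forall_forall in *. intros u Hin. apply sn_hered_tame; auto. }
  rewrite zeta_app.
  assert (HA := args_reduce_refl Rs us). revert HA. generalize 0 as d.
  assert (HW := args_step_wf Rs (map (zeta Rs) us)). rewrite Forall_map in HW. specialize (HW Hus).
  induction HW as [ts _ IHts]. intros d Hred. constructor. intros t [c Ht].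
  eapply defined_step_inv in Ht; eauto; [| apply gsym_ok_arity; auto].
  destruct Ht as [Ht | (ts' & -> & Ht & Hstep)]; [| eapply IHts; eauto].
  destruct (root_step_defined _ _ _ _ _ _ _ HR Hg HT Hred Ht)
    as [HU | (f & R & i & rho & a & b & ss & sg & w & HW & ->)].
  - eapply unfolds_sn; eauto.
  - eapply waiting_sn with (m := length (r_conds rho)); eauto. lia.
Qed.
End InfiniteReductions.

Lemma minimal_not_sn {F} (Rs : trs F) s :
  ground_ok Rs s -> ~ sn Rs (zeta Rs s) ->
  exists g us, subterm (App g us) s /\ ground_ok Rs (App g us) /\ ~ sn Rs (zeta Rs (App g us)) /\
    Forall (fun u => sn Rs (zeta Rs u)) us.
Proof.
  induction s as [x | g us IH] using term_nested_ind; intros Hg Hn; [inversion Hg |].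
  destruct (classic (Forall (fun u => sn Rs (zeta Rs u)) us)) as [H | H].
  - exists g, us. split; [apply st_refl | auto].
  - rewrite <- Exists_Forall_neg in H by (intros; apply classic).
    apply Exists_exists in H. destruct H as (u & Hu & Hnu).
    destruct (ground_ok_inv _ _ _ Hg) as [_ Hgu]. rewrite Forall_forall in IH, Hgu.
    destruct (IH u Hu (Hgu u Hu) Hnu) as (g' & us' & H1 & H2).
    exists g', us'. split; auto. eapply st_arg; eauto.
Qed.

Lemma lred_context {F} (Rs : trs F) s w s1 :
  subterm s w -> lred Rs s s1 -> exists w1, lred Rs w w1 /\ subterm s1 w1.
Proof.
  intros H Hs. induction H as [| s g ts t Ht Hst IH].
  - exists s1. split; auto. apply st_refl.
  - destruct (IH Hs) as (t1 & [[c H1] | (s' & H1 & H2)] & H3).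
    + apply in_split in Ht. destruct Ht as (pre & post & ->).
      exists (App g (pre ++ t1 :: post)). split.
      * left. exists c. rewrite <- (set_nth_app pre post t t1). econstructor; eauto.
        rewrite nth_error_app2, Nat.sub_diag by lia. reflexivity.
      * apply st_arg with t1; auto. apply in_app_iff. right; left; auto.
    (* [lcond] may start at any subterm and discards its context, so the same result is reached from
       the larger term. *)
    + exists t1. split; auto. right. exists s'. split; auto. apply st_arg with t; auto.
Qed.

Lemma lred_plus_context {F} (Rs : trs F) s s1 :
  lred_plus Rs s s1 -> forall w, subterm s w -> exists w1, lred_plus Rs w w1 /\ subterm s1 w1.
Proof.
  induction 1 as [s s1 H | s s1 s2 _ IH1 _ IH2]; intros w Hw.
  - destruct (lred_context _ _ _ _ Hw H) as (w1 & H1 & H2). exists w1. split; auto. apply t_step; auto.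
  - destruct (IH1 w Hw) as (w1 & A1 & A2). destruct (IH2 w1 A2) as (w2 & B1 & B2).
    exists w2. split; auto. eapply t_trans; eauto.
Qed.

(** Nontermination is sought at a minimal subterm, so the invariant of the infinite sequence has to
    admit a surrounding context. *)
Definition contains_not_sn {F} (Rs : trs F) w : Prop :=
  exists s, subterm s w /\ ground_ok Rs s /\ ~ sn Rs (zeta Rs s).

Lemma subterm_trans {S} (a b c : term S) : subterm a b -> subterm b c -> subterm a c.
Proof. intros H1 H2. induction H2; auto. eapply st_arg; eauto. Qed.

Lemma contains_not_sn_step {F} (Rs : trs F) w :
  strong_cctrs Rs -> contains_not_sn Rs w -> exists w1, lred_plus Rs w w1 /\ contains_not_sn Rs w1.
Proof.
  intros HR (s & H1 & H2 & H3).
  destruct (minimal_not_sn Rs s H2 H3) as (g & us & A1 & A2 & A3 & A4).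
  enough (exists s', lred_plus Rs (App g us) s' /\ ground_ok Rs s' /\ ~ sn Rs (zeta Rs s')) as (s' & B1 & B2 & B3).
  { destruct (lred_plus_context _ _ _ B1 w (subterm_trans _ _ _ A1 H1)) as (w1 & C1 & C2).
    exists w1. split; auto. exists s'. auto. }
  apply NNPP. intros Hno. apply A3. apply successors_sn; auto.
  intros s' P1 P2. apply NNPP. intros P3. apply Hno. exists s'. auto.
Qed.

Lemma linf_of_not_sn {F} (Rs : trs F) s :
  strong_cctrs Rs -> ground_ok Rs s -> ~ sn Rs (zeta Rs s) -> linf Rs s.
Proof.
  intros HR Hg Hn.
  (* Each round provides a nonempty sequence of steps. The invariant stores its end point, so that
     the rounds can be traversed one step at a time. *)
  apply (dependent_choice (lred Rs) (fun w => exists w1, lred_plus Rs w w1 /\ contains_not_sn Rs w1)).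
  - intros w (w1 & H1 & H2). apply clos_trans_t1n in H1. destruct H1 as [w1 H1 | w' w1 H1 H3].
    + exists w1. split; auto. apply contains_not_sn_step; auto.
    + exists w'. split; auto. exists w1. split; auto. apply clos_t1n_trans; auto.
  - apply contains_not_sn_step; auto. exists s. split; [apply st_refl | auto].
Qed.

Theorem theorem5 (F : Type) (Rs : trs F) (s : term (gsym F)) :
  strong_cctrs Rs -> wfG Rs s -> tvars s = [] ->
  (cs_terminating Rs (zeta Rs s) ->
     forall t N, cs_steps Rs (zeta Rs s) t N ->
     exists t' c, lsteps Rs s t' c /\ N <= c) /\
  (cs_infinite Rs (zeta Rs s) -> linf Rs s).
Proof.
  intros HR Hw Hv. assert (Hg := ground_ok_of_wfG Rs s Hw Hv). split.
  - intros Ht t N HN. apply sn_of_terminating in Ht.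
    destruct (hered_tame_tame _ _ (sn_hered_tame Rs s HR Hg Ht) _ _ HN) as (_ & _ & t' & c & H & Hc).
    exists t', c. split; auto. apply H.
  - intros Hi. apply linf_of_not_sn; auto. apply not_sn_of_infinite; auto.
Qed.
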